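(* Let $d \geq 1$ and let $P \subset \mathbb{R}^{d}$ be a closed convex cone which is pointed ($P \cap -P=\{0\}$) and spanning ($P-P=\mathbb{R}^{d}$). Let $A_1$ and $A_2$ be $P$-modules and let $k_1,k_2 \in \{1,2,\dots\}\cup\{\infty\}$. For $i \in \{1,2\}$ let $\alpha^{(A_i,k_i)}$ be the CCR flow corresponding to the $P$-module $A_i$ of multiplicity $k_i$. Then the following are equivalent. (1) The CCR flow $\alpha^{(A_1,k_1)}$ is conjugate to $\alpha^{(A_2,k_2)}$. (2) The CCR flow $\alpha^{(A_1,k_1)}$ is cocycle conjugate to $\alpha^{(A_2,k_2)}$. (3) There exists $z \in \mathbb{R}^{d}$ such that $A_1+z=A_2$, and $k_1=k_2$.
   Context: $P$-module: a proper closed subset $A \subset \mathbb{R}^{d}$ with $A+x \subset A$ for all $x \in P$; by convention all $P$-modules are assumed to contain the origin $0$. $E_0$-semigroups: let $\mathcal{H}$ be an infinite dimensional separable Hilbert space. An $E_0$-semigroup over $P$ on $B(\mathcal{H})$ is a family $\alpha=\{\alpha_x\}_{x \in P}$ of normal unital $*$-endomorphisms of $B(\mathcal{H})$ with $\alpha_x \circ \alpha_y=\alpha_{x+y}$ for $x,y\in P$, such that for all $T \in B(\mathcal{H})$, $\xi,\eta \in \mathcal{H}$, the map $P \ni x \mapsto \langle \alpha_x(T)\xi|\eta\rangle$ is continuous. Two $E_0$-semigroups $\alpha$ on $B(\mathcal{H})$ and $\beta$ on $B(\mathcal{K})$ are conjugate if there is a unitary $U:\mathcal{H}\to\mathcal{K}$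 with $\beta_x=Ad(U)\circ\alpha_x\circ Ad(U)^{*}$ for all $x \in P$, where $Ad(U)(T)=UTU^{*}$ and $Ad(U)^*(T)=U^{*}TU$. An $\alpha$-cocycle is a strongly continuous family of unitaries $\{U_x\}_{x \in P}$ on $\mathcal{H}$ with $U_x\alpha_x(U_y)=U_{x+y}$; then $\{Ad(U_x)\circ\alpha_x\}_{x\in P}$ is an $E_0$-semigroup, called a cocycle perturbation of $\alpha$. $\beta$ is cocycle conjugate to $\alpha$ if a conjugate of $\beta$ is a cocycle perturbation of $\alpha$. Weyl operators: let $\Gamma(\mathcal{H})$ be the symmetric Fock space of $\mathcal{H}$ and $e(u)=\sum_{n\ge 0} u^{\otimes n}/\sqrt{n!}$ the exponential vector of $u \in \mathcal{H}$. $W(u)$ is the unique unitary on $\Gamma(\mathcal{H})$ with $W(u)e(v)=e^{-\|u\|^2/2-\langle u|v\rangle}e(u+v)$ for $v \in \mathcal{H}$ (inner products are linear in the second variable). CCR flows: a strongly continuous isometric representation of $P$ on $\mathcal{H}$ is a map $V:P\to B(\mathcal{H})$ with each $V_x$ an isometry, $V_xV_y=V_{x+y}$, and $x\mapsto V_x\xi$ continuous for each $\xi$. It is known that there is a unique $E_0$-semigroup $\alpha^{V}$ on $B(\Gamma(\mathcal{H}))$ with $\alpha^{V}_x(W(u))=W(V_xu)$ for $x \in P$, $u \in \mathcal{H}$; it is called the CCR flow associated to $V$. CCR flows of modules: let $A$ be a $P$-module, $k \in \{1,2,\dots\}\cup\{\infty\}$ and $\mathcal{K}$ a separable Hilbert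 space of dimension $k$. The isometric representation associated to $A$ of multiplicity $k$ is $V:P\to B(L^2(A,\mathcal{K}))$ (Lebesgue measure), where $(V_xf)(y)=f(y-x)$ if $y-x\in A$ and $(V_xf)(y)=0$ if $y-x\notin A$. The CCR flow $\alpha^{V}$ is denoted $\alpha^{(A,k)}$ and called the CCR flow corresponding to the $P$-module $A$ of multiplicity $k$. *)

(* Defs.v *)
From HB Require Import structures.
From mathcomp Require Import all_boot all_order all_algebra all_fingroup.
From mathcomp Require Import sesquilinear complex.
From mathcomp Require Import all_classical all_reals all_analysis.

Set Implicit Arguments.
Unset Strict Implicit.
Unset Printing Implicit Defensive.

Import Order.TTheory GRing.Theory Num.Theory numFieldNormedType.Exports.

Local Open Scope classical_set_scope.
Local Open Scope ring_scope.
Local Open Scope complex_scope.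

Section hilbert.
Context {R : realType}.

Record hilbert := Hilbert {
  hsort :> completeNormedModType R[i] ;
  hform : {dot hsort for Num.conj} ;
  hnormE : forall u : hsort, `|u| ^+ 2 = hform u u }.

(* The library's forms are linear in the first argument; [ip] is linear in the
   second one. *)
Definition ip (H : hilbert) (u v : H) : R[i] := hform H v u.

Definition sqnorm (H : hilbert) (u : H) : R := complex.Re (ip u u).

Definition lspan (H : hilbert) (S : set H) : set H :=
  [set v | exists n (c : 'I_n -> R[i]) (s : 'I_n -> H),
    (forall i, S (s i)) /\ v = \sum_i c i *: s i].

Definition separable (H : hilbert) : Prop :=
  exists2 D : set H, countable D & dense D.

Definition infinite_dim (H : hilbert) : Prop :=
  forall s : seq H, lspan [set` s] <> setT.

(* A dimension in {0, 1, 2, ...} \cup {oo} is an [option nat], with [None] for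
   the countably infinite one. *)
Definition lt_dim (i : nat) (k : option nat) : bool :=
  if k is Some n then (i < n)%N else true.

Definition has_dim (H : hilbert) (k : option nat) : Prop :=
  exists e : nat -> H,
    (forall i j, lt_dim i k -> lt_dim j k -> ip (e i) (e j) = (i == j)%:R) /\
    closure (lspan [set e i | i in [set i | lt_dim i k]]) = setT.

Record bop (H K : hilbert) := Bop {
  bfun :> {linear H -> K} ;
  bcont : continuous bfun }.

Lemma bopP (H K : hilbert) (S T : bop H K) : S =1 T -> S = T.
Proof.
case: S T => [[f [[fa] [fs]]] fc] [[g [[ga] [gs]]] gc] /= fg.
have {}fg : f = g by apply/funext.
subst g; have e1 := Prop_irrelevance fa ga; have e2 := Prop_irrelevance fs gs.
by subst ga gs; rewrite (Prop_irrelevance fc gc).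
Qed.

Section operations.
Variables H K L : hilbert.

Lemma bid_cont : continuous (@idfun H).
Proof. by move=> x; exact: cvg_id. Qed.
Definition bid : bop H H := Bop bid_cont.

Lemma bcomp_cont (S : bop K L) (T : bop H K) : continuous (S \o T).
Proof.
by move=> x; apply: continuous_comp; exact: bcont.
Qed.
Definition bcomp (S : bop K L) (T : bop H K) : bop H L := Bop (@bcomp_cont S T).

Lemma badd_cont (S T : bop H K) : continuous (S \+ T).
Proof. by move=> x; apply: cvgD; exact: bcont. Qed.
Definition badd (S T : bop H K) : bop H K := Bop (@badd_cont S T).

Lemma bscale_cont (a : R[i]) (T : bop H K) : continuous (a \*: T).
Proof. by move=> x; apply: cvgZr; exact: bcont. Qed.
Definition bscale (a : R[i]) (T : bop H K) : bop H K := Bop (@bscale_cont a T).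

End operations.

Definition is_adjoint (H K : hilbert) (S : bop H K) (T : bop K H) : Prop :=
  forall xi eta, ip (S xi) eta = ip xi (T eta).

Record unitary (H K : hilbert) := Unitary {
  uop :> bop H K ;
  uadj : bop K H ;
  uadjP : is_adjoint uop uadj ;
  uopK : bcomp uadj uop = bid H ;
  uadjK : bcomp uop uadj = bid K }.

Definition Ad (H K : hilbert) (U : unitary H K) (T : bop H H) : bop K K :=
  bcomp U (bcomp T (uadj U)).

Definition Ad_star (H K : hilbert) (U : unitary H K) (T : bop K K) : bop H H :=
  bcomp (uadj U) (bcomp T U).

Definition selfadjoint (H : hilbert) (T : bop H H) : Prop := is_adjoint T T.

(* Positivity order: in R[i], [a <= b] says that [b - a] is a nonnegative
   real. *)
Definition bop_le (H : hilbert) (S T : bop H H) : Prop :=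
  forall xi, ip xi (S xi) <= ip xi (T xi).

Definition bop_sup (H : hilbert) (D : set (bop H H)) (T : bop H H) : Prop :=
  [/\ selfadjoint T, (forall S, D S -> bop_le S T)
    & forall T', selfadjoint T' -> (forall S, D S -> bop_le S T') ->
        bop_le T T'].

(* Normality: preservation of suprema of bounded increasing nets of
   self-adjoint operators. *)
Definition normal_map (H : hilbert) (phi : bop H H -> bop H H) : Prop :=
  forall (D : set (bop H H)) (T : bop H H),
    D !=set0 -> (forall S, D S -> selfadjoint S) ->
    (forall S1 S2, D S1 -> D S2 ->
       exists S, [/\ D S, bop_le S1 S & bop_le S2 S]) ->
    bop_sup D T -> bop_sup (phi @` D) (phi T).

Record normal_unital_star_endo (H : hilbert) (phi : bop H H -> bop H H) : Prop :=
  { endoD : forall S T, phi (badd S T) = badd (phi S) (phi T) ;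
    endoZ : forall a T, phi (bscale a T) = bscale a (phi T) ;
    endoM : forall S T, phi (bcomp S T) = bcomp (phi S) (phi T) ;
    endo1 : phi (bid H) = bid H ;
    endo_adj : forall S T, is_adjoint S T -> is_adjoint (phi S) (phi T) ;
    endo_normal : normal_map phi }.

End hilbert.
Arguments hilbert : clear implicits.

Section E0_semigroups.
Context {R : realType} {d : nat}.
Implicit Types (P A : set 'rV[R]_d) (H K L G : hilbert R).

(* Families indexed by P are functions on all of R^d; only their values on P
   are constrained. *)
Record E0_semigroup P H (alpha : 'rV[R]_d -> bop H H -> bop H H) : Prop :=
  { E0_separable : separable H ;
    E0_infinite_dim : infinite_dim H ;
    E0_endo : forall x, P x -> normal_unital_star_endo (alpha x) ;
    E0_add : forall x y T, P x -> P y ->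
      alpha x (alpha y T) = alpha (x + y) T ;
    E0_cont : forall (T : bop H H) (xi eta : H),
      {within P, continuous
        (fun x => ip (alpha x T xi) eta : (R[i] : numFieldType))} }.

Definition conjugate P H K (alpha : 'rV[R]_d -> bop H H -> bop H H)
    (beta : 'rV[R]_d -> bop K K -> bop K K) : Prop :=
  exists U : unitary H K, forall x T, P x ->
    beta x T = Ad U (alpha x (Ad_star U T)).

Record cocycle P H (alpha : 'rV[R]_d -> bop H H -> bop H H)
    (U : 'rV[R]_d -> unitary H H) : Prop :=
  { cocycle_cont : forall xi : H, {within P, continuous (fun x => U x xi)} ;
    cocycle_mul : forall x y, P x -> P y ->
      bcomp (U x) (alpha x (U y)) = U (x + y) }.

Definition cocycle_perturbation P H
    (alpha gamma : 'rV[R]_d -> bop H H -> bop H H) : Prop :=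
  exists2 U : 'rV[R]_d -> unitary H H, cocycle P alpha U
    & forall x T, P x -> gamma x T = Ad (U x) (alpha x T).

Definition cocycle_conjugate P H K (beta : 'rV[R]_d -> bop H H -> bop H H)
    (alpha : 'rV[R]_d -> bop K K -> bop K K) : Prop :=
  exists2 gamma : 'rV[R]_d -> bop K K -> bop K K,
    conjugate P beta gamma & cocycle_perturbation P alpha gamma.

End E0_semigroups.

Section Fock.
Context {R : realType}.

(* Multilinearity of [tens] follows from the first condition. *)
Definition is_tensor_power (H : hilbert R) (n : nat) (T : hilbert R)
    (tens : ('I_n -> H) -> T) : Prop :=
  (forall u v, ip (tens u) (tens v) = \prod_i ip (u i) (v i)) /\
  closure (lspan (range tens)) = setT.

Definition sym_tensors (H : hilbert R) (n : nat) (T : hilbert R)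
    (tens : ('I_n -> H) -> T) : set T :=
  closure (lspan (range
    (fun u : 'I_n -> H => \sum_(s : 'S_n) tens (fun i => u (s i))))).

(* A symmetric Fock space over H: a Hilbert space identified, through
   [fock_comp], with the Hilbert direct sum over n of the symmetric subspaces
   of the tensor powers of H. All of them are canonically isomorphic. *)
Record fock (H : hilbert R) := Fock {
  fock_tpow : nat -> hilbert R ;
  fock_tens : forall n, ('I_n -> H) -> fock_tpow n ;
  fock_tensP : forall n, is_tensor_power (fock_tens (n := n)) ;
  fock_space :> hilbert R ;
  fock_comp : forall n, {linear fock_space -> fock_tpow n} ;
  fock_sym : forall n g, sym_tensors (fock_tens (n := n)) (fock_comp n g) ;
  fock_ip : forall g h,
    series (fun n => ip (fock_comp n g) (fock_comp n h)
                     : (R[i] : numFieldType)) @ \oo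
      --> (ip g h : (R[i] : numFieldType)) ;
  fock_surj : forall t : (forall n, fock_tpow n),
    (forall n, sym_tensors (fock_tens (n := n)) (t n)) ->
    cvgn (series (fun n => sqnorm (t n))) ->
    exists g, forall n, fock_comp n g = t n }.

(* The exponential vector e(u) = \sum_n u^{\otimes n} / sqrt (n!): the element
   with these components. *)
Definition expvec (H : hilbert R) (F : fock H) (u : H) : F :=
  xget 0 [set g | forall n,
    fock_comp F n g = (sqrtC (n`!%:R : R[i]))^-1 *: fock_tens F (fun _ : 'I_n => u)].

Definition cexp (z : R[i]) : R[i] :=
  (expR (complex.Re z))%:C * (cos (complex.Im z) +i* sin (complex.Im z)).

Definition is_weyl (H : hilbert R) (F : fock H) (W : H -> unitary F F) : Prop :=
  forall u v, W u (expvec F v) =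
    cexp (- (ip u u / 2%:R) - ip u v) *: expvec F (u + v).

Definition ccr_flow (d : nat) (P : set 'rV[R]_d) (H : hilbert R)
    (V : 'rV[R]_d -> bop H H) (F : fock H)
    (alpha : 'rV[R]_d -> bop F F -> bop F F) : Prop :=
  E0_semigroup P alpha /\
  exists2 W : H -> unitary F F, is_weyl W
    & forall x u, P x -> alpha x (W u) = W (V x u).

End Fock.

Section Lebesgue.
Context {R : realType}.
Local Open Scope ereal_scope.
Local Notation RT := (measurableTypeR R).

Definition tcons (n : nat) (p : RT * n.-tuple RT) : n.+1.-tuple RT :=
  [tuple of p.1 :: p.2].

Lemma measurable_tcons n : measurable_fun setT (@tcons n).
Proof. exact: measurable_cons. Qed.

Section lebesgue_succ.
Variables (n : nat) (m : {sigma_finite_measure set (n.-tuple RT) -> \bar R}).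

Definition lebesgue_succ : set (n.+1.-tuple RT) -> \bar R :=
  pushforward ((@lebesgue_measure R) \x m) (@tcons n).

Let preim (X : set (n.+1.-tuple RT)) : measurable X ->
  measurable (@tcons n @^-1` X).
Proof. by move=> mX; rewrite -[X in measurable X]setTI; exact: measurable_tcons. Qed.

Let succ0 : lebesgue_succ set0 = 0.
Proof. by rewrite /lebesgue_succ /pushforward preimage_set0 measure0. Qed.

Let succ_ge0 X : 0 <= lebesgue_succ X.
Proof. by rewrite /lebesgue_succ /pushforward; exact: measure_ge0. Qed.

Let succ_sigma_additive : semi_sigma_additive lebesgue_succ.
Proof.
move=> F mF tF mUF; rewrite /lebesgue_succ /pushforward preimage_bigcup.
apply: measure_semi_sigma_additive.
- by move=> k; exact: preim.
- apply/trivIsetP => /= i j _ _ ij; rewrite -preimage_setI.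
  by move/trivIsetP : tF => /(_ _ _ _ _ ij) ->//; rewrite preimage_set0.
- by rewrite -preimage_bigcup; exact: preim.
Qed.

HB.instance Definition _ := isMeasure.Build _ _ _
  lebesgue_succ succ0 succ_ge0 succ_sigma_additive.

Let succ_sigma_finite : sigma_finite setT lebesgue_succ.
Proof.
have /sigma_finiteP[F [TF ndF Foo]] := sigma_finiteT (@lebesgue_measure R).
have /sigma_finiteP[G [TG ndG Goo]] := sigma_finiteT m.
pose g (t : n.+1.-tuple RT) : RT * n.-tuple RT :=
  (thead t, [tuple of behead t]).
have tconsK : cancel (@tcons n) g.
  by case=> x t; congr pair; exact/val_inj.
have mg : measurable_fun setT g.
  by apply/measurable_fun_pair; [exact: measurable_tnth|exact: measurable_behead].
exists (fun k => g @^-1` (F k `*` G k)).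
  apply/esym/seteqP; split=> // t _.
  have [k _ Fk] : (\bigcup_k F k) (g t).1 by rewrite -TF.
  have [l _ Gl] : (\bigcup_k G k) (g t).2 by rewrite -TG.
  exists (maxn k l) => //; split.
    by move: Fk; exact/subsetPset/ndF/leq_maxl.
  by move: Gl; exact/subsetPset/ndG/leq_maxr.
move=> k; have [mF Fk] := Foo k; have [mG Gk] := Goo k; split.
  by rewrite -[X in measurable X]setTI; apply: mg => //; exact: measurableX.
rewrite /lebesgue_succ /pushforward -comp_preimage.
have -> : g \o @tcons n = idfun by exact/funext.
by rewrite preimage_id product_measure1E// lte_mul_pinfty// ge0_fin_numE.
Qed.

HB.instance Definition _ := Measure_isSigmaFinite.Build _ _ _
  lebesgue_succ succ_sigma_finite.

End lebesgue_succ.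

Fixpoint lebesgue_tuple (n : nat) :
    {sigma_finite_measure set (n.-tuple RT) -> \bar R} :=
  if n is n'.+1 then lebesgue_succ (lebesgue_tuple n')
  else dirac ([tuple] : 0.-tuple RT).

(* R^d carries its topology as ['rV[R]_d] and its Borel sets and Lebesgue
   measure as [d.-tuple R]; [rowt] identifies the two. *)
Definition rowt (d : nat) (t : d.-tuple RT) : 'rV[R]_d := \row_i tnth t i.

Definition borel (d : nat) (X : set 'rV[R]_d) : Prop :=
  measurable (@rowt d @^-1` X).

Definition leb_int (d : nat) (A : set 'rV[R]_d) (f : 'rV[R]_d -> \bar R) : \bar R :=
  \int[lebesgue_tuple d]_(t in @rowt d @^-1` A) f (rowt t).

Definition leb_intC (d : nat) (A : set 'rV[R]_d) (f : 'rV[R]_d -> R[i]) : R[i] :=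
  fine (leb_int A (fun y => (complex.Re (f y))%:E)) +i*
  fine (leb_int A (fun y => (complex.Im (f y))%:E)).

End Lebesgue.

Section modules.
Context {R : realType} {d : nat}.
Implicit Types (P A : set 'rV[R]_d) (K L : hilbert R).

Definition closed_convex_cone P : Prop :=
  [/\ closed P, convex_set P, P 0 & forall a x, 0 <= a -> P x -> P (a *: x)].

Definition pointed_cone P : Prop := P `&` [set - x | x in P] = [set 0].

Definition spanning_cone P : Prop := [set x - y | x in P & y in P] = setT.

Definition translate A (x : 'rV[R]_d) : set 'rV[R]_d := [set a + x | a in A].

Definition P_module P A : Prop :=
  [/\ closed A, A <> setT, A 0 & forall x, P x -> translate A x `<=` A].

(* Square-integrability on A; the values of f outside A are irrelevant. *)
Definition sq_integrable A K (f : 'rV[R]_d -> K) : Prop :=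
  (forall O : set K, open O -> borel (A `&` f @^-1` O)) /\
  (leb_int A (fun y => (sqnorm (f y))%:E) < +oo)%E.

(* L^2(A, K): [L2_class] sends a square-integrable function to its class
   modulo almost everywhere equality on A. *)
Record L2 A K := L2Space {
  L2_space :> hilbert R ;
  L2_class : ('rV[R]_d -> K) -> L2_space ;
  L2_lin : forall (a : R[i]) f g, sq_integrable A f -> sq_integrable A g ->
    L2_class (fun y => a *: f y + g y) = a *: L2_class f + L2_class g ;
  L2_ip : forall f g, sq_integrable A f -> sq_integrable A g ->
    ip (L2_class f) (L2_class g) = leb_intC A (fun y => ip (f y) (g y)) ;
  L2_surj : forall h : L2_space, exists2 f, sq_integrable A f & L2_class f = h }.

Definition shift A K (x : 'rV[R]_d) (f : 'rV[R]_d -> K) : 'rV[R]_d -> K :=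
  fun y => if y - x \in A then f (y - x) else 0.

Definition module_representation P A K (E : L2 A K) (V : 'rV[R]_d -> bop E E) :
    Prop :=
  forall x f, P x -> sq_integrable A f ->
    V x (L2_class E f) = L2_class E (shift A x f).

Definition module_ccr_flow P A K (E : L2 A K) (F : fock E)
    (alpha : 'rV[R]_d -> bop F F -> bop F F) : Prop :=
  exists2 V : 'rV[R]_d -> bop E E, module_representation P V
    & ccr_flow P V alpha.

End modules.

(* Main.v *)
(** A normal endomorphism phi is determined by its intertwiners, the operators
    S with phi(T) S = S T for all T, because their ranges are total. For a CCR
    flow, irreducibility of the Weyl operators identifies the intertwiners of
    alpha_x with the operators S such that S W(u) = W(V_x u) S for all u. Hence
    a unitary equivalence of the isometric representations gives a conjugacy
    of the flows, which yields (3) => (1).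

    For (2) => (3), a cocycle conjugacy maps the intertwiners of the first flow
    to those of the second one, multiplicatively and preserving the inner
    products of their values at the vacuum. The intertwiner that creates e(u),
    with u orthogonal to the range of V_x, can be divided along the segment from
    0 to x into arbitrarily many factors, and such divisible vectors are
    multiples of exponential vectors. This gives an isometry U of the
    one-particle spaces with U V1_x = V2_x U which maps the orthogonal
    complement of the range of V1_x into that of V2_x.

    A nonzero matrix coefficient of U can be localised near points y and y';
    translating by elements of P shows A1 + (y' - y) <= A2, and the adjoint of U
    gives the reverse inclusion. For the multiplicities, let f be an exponential
    function on a simplicial subcone of P. The translates of f by the points of
    A, in the directions of an orthonormal basis of K, are total, and their Gram
    matrix only depends on differences of points; so U would embed n + 1
    orthogonal families in the span of n such families. *)
Require Import Defs.
From HB Require Import structures.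
From mathcomp Require Import all_boot all_order all_algebra all_fingroup.
From mathcomp Require Import sesquilinear complex ring lra.
From mathcomp Require Import all_classical all_reals all_analysis.
From mathcomp Require Import measurable_realfun.

Set Implicit Arguments.
Unset Strict Implicit.
Unset Printing Implicit Defensive.

Import Order.TTheory GRing.Theory Num.Theory numFieldNormedType.Exports.

Local Open Scope classical_set_scope.
Local Open Scope ring_scope.
Local Open Scope complex_scope.

(** Three obstacles shape the argument. A cocycle may displace the vacuum and multiply by scalars,
    so the correspondence of intertwiners respects exponential vectors only up to scalars and a
    common displacement; subtracting the image of u = 0 removes both from the inner products.
    Exponentials determine inner products only modulo 2 pi i, so such identities are used along
    whole real lines t u. Finally, that divisible vectors are exponential rests on a bound that is
    uniform in the number of factors: once these are normalised to have vacuum coefficient 1, the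
    sum of their squared distances from the vacuum is at most the squared norm of the product, while
    the pieces of v become uniformly small by strong continuity. The product of the factors can then
    be compared with the exponential of the sum of their linear terms. For the multiplicities an
    exponential profile is chosen because its translates are proportional on a common orthant, which
    turns totality into a Dynkin argument. *)

Local Notation Re := (@complex.Re _).
Local Notation Im := (@complex.Im _).

(** * Complex numbers and Hilbert spaces *)

Section complex_modulus.
Variable R : realType.
Implicit Types z w : R[i].

(** The norm of [R[i]] takes its values in [R[i]]; estimates are carried out with this real-valued
    modulus, so that real arithmetic applies to them. *)
Definition cab z : R := Num.sqrt (Re z ^+ 2 + Im z ^+ 2).

Lemma cabE z : `|z| = (cab z)%:C.
Proof. exact: normc_def. Qed.

Lemma cab_ge0 z : 0 <= cab z. Proof. exact: sqrtr_ge0. Qed.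

Lemma cab0 : cab 0 = 0.
Proof. by apply: complexI; rewrite -cabE normr0. Qed.

Lemma cab1 : cab 1 = 1.
Proof. by apply: complexI; rewrite -cabE normr1. Qed.

Lemma cab_eq0 z : cab z = 0 -> z = 0.
Proof. by move=> z0; apply/eqP; rewrite -normr_eq0 cabE z0. Qed.

Lemma cabM z w : cab (z * w) = cab z * cab w.
Proof. by apply: complexI; rewrite -cabE normrM !cabE rmorphM. Qed.

Lemma cabD z w : cab (z + w) <= cab z + cab w.
Proof. by rewrite -lecR rmorphD /= -!cabE ler_normD. Qed.

Lemma cabN z : cab (- z) = cab z.
Proof. by apply: complexI; rewrite -!cabE normrN. Qed.

Lemma cabB z w : cab (z - w) <= cab z + cab w.
Proof. by rewrite -(cabN w) cabD. Qed.

Lemma cab_distC z w : cab (z - w) = cab (w - z).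
Proof. by rewrite -cabN opprB. Qed.

Lemma cabV z : cab z^-1 = (cab z)^-1.
Proof. by apply: complexI; rewrite -cabE normfV cabE fmorphV. Qed.

Lemma cab_real (x : R) : cab x%:C = `|x|.
Proof. by rewrite /cab /= expr0n addr0 sqrtr_sqr. Qed.

Lemma cabJ z : cab (conjc z) = cab z.
Proof. by case: z => a b; rewrite /cab /= sqrrN. Qed.

Lemma sqr_cab z : cab z ^+ 2 = Re z ^+ 2 + Im z ^+ 2.
Proof. by rewrite sqr_sqrtr// addr_ge0// sqr_ge0. Qed.

Lemma mulJc z : conjc z * z = (cab z ^+ 2)%:C.
Proof.
rewrite sqr_cab; case: z => a b /=; apply/eqP; rewrite eq_complex /=.
by apply/andP; split; apply/eqP; ring.
Qed.

Lemma normRe_le z : `|Re z| <= cab z.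
Proof.
by rewrite -(@ler_pXn2r _ 2) ?nnegrE ?normr_ge0 ?cab_ge0// sqr_cab real_normK
  ?num_real// lerDl sqr_ge0.
Qed.

Lemma Re_le_cab z : Re z <= cab z.
Proof. exact: le_trans (ler_norm _) (normRe_le z). Qed.

Lemma normIm_le z : `|Im z| <= cab z.
Proof.
by rewrite -(@ler_pXn2r _ 2) ?nnegrE ?normr_ge0 ?cab_ge0// sqr_cab real_normK
  ?num_real// lerDr sqr_ge0.
Qed.

Lemma cab_sum I (r : seq I) (Q : pred I) (F : I -> R[i]) :
  cab (\sum_(i <- r | Q i) F i) <= \sum_(i <- r | Q i) cab (F i).
Proof.
elim/big_ind2 : _ => [|x1 x2 y1 y2 h1 h2|//]; first by rewrite cab0.
exact: le_trans (cabD _ _) (lerD h1 h2).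
Qed.

Lemma cab_prod I (r : seq I) (Q : pred I) (F : I -> R[i]) :
  cab (\prod_(i <- r | Q i) F i) = \prod_(i <- r | Q i) cab (F i).
Proof. by rewrite (big_morph cab cabM cab1). Qed.

Lemma cReD z w : Re (z + w) = Re z + Re w. Proof. by case: z w => ? ? []. Qed.
Lemma cImD z w : Im (z + w) = Im z + Im w. Proof. by case: z w => ? ? []. Qed.
Lemma cReN z : Re (- z) = - Re z. Proof. by case: z. Qed.
Lemma cImN z : Im (- z) = - Im z. Proof. by case: z. Qed.
Lemma cReB z w : Re (z - w) = Re z - Re w. Proof. by rewrite cReD cReN. Qed.
Lemma cImB z w : Im (z - w) = Im z - Im w. Proof. by rewrite cImD cImN. Qed.
Lemma cReM z w : Re (z * w) = Re z * Re w - Im z * Im w.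
Proof. by case: z w => ? ? []. Qed.
Lemma cImM z w : Im (z * w) = Re z * Im w + Im z * Re w.
Proof. by case: z w => ? ? [] ? ? /=. Qed.
Lemma cReJ z : Re (conjc z) = Re z. Proof. by case: z. Qed.
Lemma cImJ z : Im (conjc z) = - Im z. Proof. by case: z. Qed.
Lemma cReZ (a : R) z : Re (a%:C * z) = a * Re z.
Proof. by rewrite cReM /= mul0r subr0. Qed.
Lemma cImZ (a : R) z : Im (a%:C * z) = a * Im z.
Proof. by rewrite cImM /= mul0r addr0. Qed.

Lemma complex_eq z w : Re z = Re w -> Im z = Im w -> z = w.
Proof. by case: z w => ? ? [? ?] /= -> ->. Qed.

Lemma Re_sum I (r : seq I) (Q : pred I) (F : I -> R[i]) :
  Re (\sum_(i <- r | Q i) F i) = \sum_(i <- r | Q i) Re (F i).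
Proof. by rewrite (big_morph Re cReD (erefl : Re (0 : R[i]) = 0)). Qed.

Lemma real_complexD (a b : R) : (a + b)%:C = a%:C + b%:C. Proof. exact: rmorphD. Qed.
Lemma real_complexB (a b : R) : (a - b)%:C = a%:C - b%:C. Proof. exact: rmorphB. Qed.
Lemma real_complexN (a : R) : (- a)%:C = - a%:C. Proof. exact: rmorphN. Qed.
Lemma real_complexM (a b : R) : (a * b)%:C = a%:C * b%:C. Proof. exact: rmorphM. Qed.
Lemma real_complexV (a : R) : (a^-1)%:C = (a%:C)^-1. Proof. exact: fmorphV. Qed.
Lemma real_complexX (a : R) n : (a ^+ n)%:C = a%:C ^+ n. Proof. exact: rmorphXn. Qed.
Lemma real_complexn n : (n%:R : R)%:C = n%:R. Proof. exact: rmorph_nat. Qed.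
Lemma conjcM z w : conjc (z * w) = conjc z * conjc w. Proof. exact: rmorphM. Qed.
Lemma conjcB z w : conjc (z - w) = conjc z - conjc w. Proof. exact: rmorphB. Qed.
Lemma conjcX z n : conjc (z ^+ n) = conjc z ^+ n. Proof. exact: rmorphXn. Qed.
Lemma conjc_sum I (r : seq I) (Q : pred I) (F : I -> R[i]) :
  conjc (\sum_(i <- r | Q i) F i) = \sum_(i <- r | Q i) conjc (F i).
Proof. exact: (rmorph_sum (@conjc R)). Qed.

Lemma gt0_complex (e : R[i]) : 0 < e -> 0 < Re e /\ e = (Re e)%:C.
Proof.
case: e => a b; rewrite ltcE /= => /andP[/eqP b0 a0]; split=> //.
by rewrite b0.
Qed.

Lemma small_eq0 (x : R) : 0 <= x -> (forall e, 0 < e -> x <= e) -> x = 0.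
Proof.
move=> x0 h; apply/eqP; rewrite eq_le x0 andbT leNgt; apply/negP => xp.
by have xp2 : 0 < x / 2; [lra|have := h _ xp2; lra].
Qed.

Lemma natSinv_lt (e : R) : 0 < e ->
  exists N, forall n, (N <= n)%N -> n.+1%:R^-1 < e.
Proof.
by move=> e0; have [N _ hN] := near_infty_natSinv_lt (PosNum e0); exists N => n /hN.
Qed.

End complex_modulus.

Section hilbert_geometry.
Variable R : realType.
Implicit Types H K L : hilbert R.

Section one_space.
Variable H : hilbert R.
Implicit Types u v w : H.

Lemma ipDr u v w : ip u (v + w) = ip u v + ip u w.
Proof. by rewrite /ip linearDl. Qed.
Lemma ipDl u v w : ip (u + v) w = ip u w + ip v w.
Proof. by rewrite /ip linearDr. Qed.
Lemma ipZr (a : R[i]) u v : ip u (a *: v) = a * ip u v.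
Proof. by rewrite /ip linearZl_LR. Qed.
Lemma ipZl (a : R[i]) u v : ip (a *: u) v = conjc a * ip u v.
Proof. by rewrite /ip linearZr_LR. Qed.
Lemma ipNr u v : ip u (- v) = - ip u v.
Proof. by rewrite /ip linearNl. Qed.
Lemma ipNl u v : ip (- u) v = - ip u v.
Proof. by rewrite /ip linearNr. Qed.
Lemma ipBr u v w : ip u (v - w) = ip u v - ip u w.
Proof. by rewrite ipDr ipNr. Qed.
Lemma ipBl u v w : ip (u - v) w = ip u w - ip v w.
Proof. by rewrite ipDl ipNl. Qed.
Lemma ip0r u : ip u 0 = 0. Proof. by rewrite /ip linear0l. Qed.
Lemma ip0l u : ip 0 u = 0. Proof. by rewrite /ip linear0r. Qed.
Lemma ipC u v : ip u v = conjc (ip v u).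
Proof. by rewrite /ip hermC expr0 mul1r. Qed.
Lemma ip_sumr u I (r : seq I) (Q : pred I) (F : I -> H) :
  ip u (\sum_(i <- r | Q i) F i) = \sum_(i <- r | Q i) ip u (F i).
Proof. by rewrite (big_morph (ip u) (ipDr u) (ip0r u)). Qed.
Lemma ip_suml u I (r : seq I) (Q : pred I) (F : I -> H) :
  ip (\sum_(i <- r | Q i) F i) u = \sum_(i <- r | Q i) ip (F i) u.
Proof. by rewrite (big_morph (fun v => ip v u) (fun v w => ipDl v w u) (ip0l u)). Qed.

Definition nrm u : R := Num.sqrt (sqnorm u).

Lemma ip_ge0 u : 0 <= ip u u. Proof. exact: dnorm_ge0. Qed.

Lemma ipuu u : ip u u = (sqnorm u)%:C.
Proof. by rewrite /sqnorm RRe_real// ger0_real// ip_ge0. Qed.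

Lemma sqnorm_ge0 u : 0 <= sqnorm u.
Proof. by rewrite -lecR -ipuu ip_ge0. Qed.

Lemma nrm_ge0 u : 0 <= nrm u. Proof. exact: sqrtr_ge0. Qed.

Lemma sqr_nrm u : nrm u ^+ 2 = sqnorm u.
Proof. by rewrite sqr_sqrtr// sqnorm_ge0. Qed.

Lemma normE u : `|u| = (nrm u)%:C.
Proof.
apply/eqP; rewrite -(@eqrXn2 _ 2)// ?lecR ?nrm_ge0//.
by rewrite hnormE -real_complexX sqr_nrm -ipuu.
Qed.

Lemma nrm0 : nrm 0 = 0.
Proof. by apply: complexI; rewrite -normE normr0. Qed.

Lemma nrm_eq0 u : nrm u = 0 -> u = 0.
Proof. by move=> u0; apply/eqP; rewrite -normr_eq0 normE u0. Qed.

Lemma sqnorm0 : sqnorm (0 : H) = 0. Proof. by rewrite /sqnorm ip0r. Qed.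

Lemma sqnorm_eq0 u : sqnorm u = 0 -> u = 0.
Proof. by move=> u0; apply: nrm_eq0; rewrite /nrm u0 sqrtr0. Qed.

Lemma nrm_gt0 u : u != 0 -> 0 < nrm u.
Proof.
by move=> u0; rewrite lt_neqAle nrm_ge0 andbT eq_sym; apply: contra_neq u0 => /nrm_eq0.
Qed.

Lemma sqnorm_gt0 u : u != 0 -> 0 < sqnorm u.
Proof. by move=> u0; rewrite -sqr_nrm exprn_gt0// nrm_gt0. Qed.

Lemma half_double u : (2^-1 : R)%:C *: (u + u) = u.
Proof.
rewrite -[u in u + u]scale1r -scalerDl scalerA.
have -> : (1 + 1 : R[i]) = (2 : R)%:C by rewrite real_complexD.
by rewrite -real_complexM mulVf// scale1r.
Qed.

Lemma nrmD u v : nrm (u + v) <= nrm u + nrm v.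
Proof. by rewrite -lecR real_complexD -!normE ler_normD. Qed.

Lemma nrmN u : nrm (- u) = nrm u.
Proof. by apply: complexI; rewrite -!normE normrN. Qed.

Lemma nrm_distC u v : nrm (u - v) = nrm (v - u).
Proof. by rewrite -nrmN opprB. Qed.

Lemma nrm_dist u v w : nrm (u - w) <= nrm (u - v) + nrm (v - w).
Proof. by have := nrmD (u - v) (v - w); rewrite addrA subrK. Qed.

Lemma nrm_le_sub u v : nrm u <= nrm v + nrm (u - v).
Proof. by have := nrmD v (u - v); rewrite addrC subrK addrC. Qed.

Lemma nrmZ (a : R[i]) u : nrm (a *: u) = cab a * nrm u.
Proof. by apply: complexI; rewrite -normE normrZ cabE normE real_complexM. Qed.

Lemma sqnormZ (a : R[i]) u : sqnorm (a *: u) = cab a ^+ 2 * sqnorm u.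
Proof. by rewrite -!sqr_nrm nrmZ exprMn. Qed.

Lemma sqnormN u : sqnorm (- u) = sqnorm u.
Proof. by rewrite -!sqr_nrm nrmN. Qed.

Lemma sqnormD u v : sqnorm (u + v) = sqnorm u + sqnorm v + 2 * Re (ip u v).
Proof.
rewrite /sqnorm ipDl !ipDr !cReD (ipC v u) cReJ; ring.
Qed.

Lemma sqnormB u v : sqnorm (u - v) = sqnorm u + sqnorm v - 2 * Re (ip u v).
Proof. by rewrite sqnormD sqnormN ipNr cReN mulrN. Qed.

Lemma cauchy_schwarz u v : cab (ip u v) <= nrm u * nrm v.
Proof.
have [->|v0] := eqVneq v 0; first by rewrite ip0r cab0 nrm0 mulr0.
have v1 : 0 < sqnorm v.
  by rewrite lt_neqAle sqnorm_ge0 andbT eq_sym; apply: contra_neq v0 => /sqnorm_eq0.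
rewrite -(@ler_pXn2r _ 2) ?nnegrE ?mulr_ge0 ?nrm_ge0 ?cab_ge0//.
rewrite exprMn !sqr_nrm; set c := ip v u / (sqnorm v)%:C.
have := sqnorm_ge0 (u - c *: v); rewrite sqnormB sqnormZ ipZr.
have -> : Re (c * ip u v) = cab (ip u v) ^+ 2 / sqnorm v.
  rewrite /c (ipC v u) mulrAC mulJc -real_complexV -real_complexM.
  by [].
rewrite cabM cabV cab_real (ger0_norm (sqnorm_ge0 v)) exprMn (ipC v u) cabJ.
have -> : cab (ip u v) ^+ 2 * (sqnorm v)^-1 ^+ 2 * sqnorm v = cab (ip u v) ^+ 2 / sqnorm v.
  by field; rewrite gt_eqF.
move=> h; have {h} : cab (ip u v) ^+ 2 / sqnorm v <= sqnorm u by lra.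
by rewrite ler_pdivrMr.
Qed.

Lemma ip_eq0P u : (forall v, ip v u = 0) -> u = 0.
Proof. by move=> h; apply: sqnorm_eq0; rewrite /sqnorm h. Qed.

Lemma ip_eqP u v : (forall w, ip w u = ip w v) -> u = v.
Proof.
by move=> h; apply/subr0_eq/ip_eq0P => w; rewrite ipBr h subrr.
Qed.

Lemma closureP (S : set H) u :
  closure S u <-> forall e : R, 0 < e -> exists2 s, S s & nrm (u - s) < e.
Proof.
split.
  move=> Su e e0; have [|s [Ss us]] := Su (ball u e%:C).
    by apply: nbhsx_ballx; rewrite ltcR.
  by exists s => //; move: us; rewrite -ball_normE /= normE ltcR.
move=> h B /nbhs_ballP[e /= e0 eB]; have [e1 eE] := gt0_complex e0.
have [s Ss us] := h _ e1; exists s; split=> //; apply: eB.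
by rewrite -ball_normE /= normE eE ltcR.
Qed.

Lemma nrm_complete (u : nat -> H) :
  (forall e : R, 0 < e -> exists N, forall n m, (N <= n)%N -> (N <= m)%N ->
     nrm (u n - u m) < e) ->
  exists l, forall e : R, 0 < e -> exists N, forall n, (N <= n)%N ->
     nrm (l - u n) < e.
Proof.
move=> h; have cu : cauchy (u @ \oo).
  apply: cauchy_exP => e e0; have [e1 eE] := gt0_complex e0.
  have [N hN] := h _ e1; exists (u N); exists N => // n /= Nn.
  by rewrite -ball_normE /= normE eE ltcR hN.
exists (lim (u @ \oo)) => e e0; move/cauchy_cvgP : cu => cu.
have /cvgrPdist_lt/(_ e%:C) := cu; rewrite ltcR => /(_ e0)[N _ hN].
by exists N => n Nn; have := hN n Nn; rewrite /= normE ltcR.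
Qed.

Lemma lspan_sub (S : set H) : S `<=` lspan S.
Proof.
move=> x Sx; exists 1%N, (fun _ => 1), (fun _ => x); split=> //.
by rewrite big_ord1 scale1r.
Qed.

Lemma lspanD (S : set H) (a : R[i]) u v : lspan S u -> lspan S v -> lspan S (a *: u + v).
Proof.
move=> [n [c [s [Ss ->]]]] [m [c' [s' [Ss' ->]]]].
exists (n + m)%N, (fun i => match fintype.split i with inl j => a * c j | inr j => c' j end),
  (fun i => match fintype.split i with inl j => s j | inr j => s' j end); split.
  by move=> i; case: (fintype.split i).
rewrite big_split_ord scaler_sumr; congr +%R; apply: eq_bigr => i _.
  by rewrite (unsplitK (inl i)) scalerA.
by rewrite (unsplitK (inr i)).
Qed.

Lemma lspan0 (S : set H) : lspan S 0.
Proof. by exists 0%N, (fun _ => 0), (fun _ => 0); split=> [[]//|]; rewrite big_ord0. Qed.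

End one_space.

Section bounded_operators.
Variables H K : hilbert R.

Lemma bopD (T : bop H K) u v : T (u + v) = T u + T v. Proof. exact: linearD. Qed.
Lemma bopB (T : bop H K) u v : T (u - v) = T u - T v. Proof. exact: linearB. Qed.
Lemma bopZ (T : bop H K) (a : R[i]) u : T (a *: u) = a *: T u. Proof. exact: linearZ. Qed.
Lemma bopN (T : bop H K) u : T (- u) = - T u. Proof. exact: linearN. Qed.
Lemma bop0 (T : bop H K) : T 0 = 0. Proof. exact: linear0. Qed.
Lemma bop_sum (T : bop H K) I (r : seq I) (Q : pred I) (f : I -> H) :
  T (\sum_(i <- r | Q i) f i) = \sum_(i <- r | Q i) T (f i).
Proof. exact: linear_sum. Qed.

Lemma bop_bounded (T : bop H K) :
  exists2 M : R, 0 <= M & forall u, nrm (T u) <= M * nrm u.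
Proof.
have /linear_bounded_continuous/linear_boundedP := @bcont R H K T.
move=> [M [Mr hM]].
have Mb : M < `|M| + 1 by rewrite (le_lt_trans (real_ler_norm Mr))// ltrDl.
have hM1 := hM _ Mb; exists (cab M + 1); first by rewrite addr_ge0// cab_ge0.
move=> u; have := hM1 u; rewrite !normE cabE.
by rewrite -[1 : R[i]](real_complexn R 1) -real_complexD -real_complexM lecR.
Qed.

Lemma mk_bop (f : H -> K) (M : R) :
  (forall a u v, f (a *: u + v) = a *: f u + f v) ->
  (forall u, nrm (f u) <= M * nrm u) ->
  exists T : bop H K, T =1 f.
Proof.
move=> flin fM; pose g : {linear H -> K} := HB.pack f (GRing.isLinear.Build _ _ _ _ f flin).
have gc : continuous g.
  apply/linear_bounded_continuous/linear_boundedP.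
  near=> N; move=> u; rewrite /= !normE; apply: le_trans (_ : (M * nrm u)%:C <= _).
    by rewrite lecR fM.
  rewrite real_complexM ler_wpM2r ?lecR ?nrm_ge0//.
  near: N; apply: nbhs_pinfty_ge; by rewrite complex_real eqxx.
by exists (Bop gc).
Unshelve. all: by end_near. Qed.

End bounded_operators.
End hilbert_geometry.

(** * Minimal vectors, density of total families, Riesz representation and adjoints *)

Section hilbert_existence.
Variable R : realType.
Implicit Types H K L : hilbert R.

(** By the parallelogram law, two vectors of nearly minimal norm whose midpoint also lies in [S] are
    close to each other. A minimising sequence is therefore Cauchy, and stability under midpoints
    replaces convexity. *)
Lemma min_norm H (S : set H) : S !=set0 ->
  (forall a b, S a -> S b -> S ((2^-1 : R)%:C *: (a + b))) ->
  exists2 m, closure S m & forall s, S s -> nrm m <= nrm s.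
Proof.
move=> [s0 Ss0] Smid; pose D := [set sqnorm s | s in S].
have infD : has_inf D.
  split; first by exists (sqnorm s0), s0.
  by exists 0 => _ [s _ <-]; exact: sqnorm_ge0.
have pick n : exists s, S s /\ sqnorm s < inf D + n.+1%:R^-1.
  have [_ [s Ss <-] sn] := @inf_adherent _ D (n.+1%:R^-1) (ltac:(by rewrite invr_gt0)) infD.
  by exists s.
have [s sP] := choice pick.
have Dle u : S u -> inf D <= sqnorm u by move=> Su; apply: ge_inf => //; [exact: infD.2|exists u].
have dist n m : sqnorm (s n - s m) <= 2 * n.+1%:R^-1 + 2 * m.+1%:R^-1.
  have := Dle _ (Smid _ _ (sP n).1 (sP m).1).
  rewrite sqnormZ cab_real ger0_norm// sqnormD sqnormB.
  have := (sP n).2; have := (sP m).2.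
  set x := Re _; set i1 := _.+1%:R^-1; set i2 := _.+1%:R^-1 => *; nra.
have [|m mlim] := @nrm_complete _ _ s.
  move=> e e0; have e2 : 0 < e ^+ 2 / 4 by rewrite divr_gt0// exprn_gt0.
  have [N hN] := natSinv_lt e2.
  exists N => n k Nn Nk; rewrite -(@ltr_pXn2r _ 2) ?nnegrE ?nrm_ge0 ?ltW// sqr_nrm.
  apply: le_lt_trans (dist _ _) _.
  have := hN _ Nn; have := hN _ Nk.
  by move: (n.+1%:R^-1) (k.+1%:R^-1) => x y; lra.
exists m.
  by apply/closureP => e e0; have [N hN] := mlim _ e0; exists (s N); [exact: (sP N).1|exact: hN].
move=> u Su; apply/ler_addgt0Pr => e e0.
have [N hN] := mlim _ (divr_gt0 e0 (ltr0Sn R 1)).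
have e2 : 0 < (e / 2) ^+ 2 by rewrite exprn_gt0// divr_gt0.
have [M hM] := natSinv_lt e2.
pose n := maxn N M; have h1 := hM n (leq_maxr _ _); have h2 := hN n (leq_maxl _ _).
apply: le_trans (nrm_le_sub m (s n)) _.
have : nrm (s n) <= nrm u + e / 2.
  rewrite -(@ler_pXn2r _ 2) ?nnegrE ?addr_ge0 ?nrm_ge0 ?ltW// ?divr_gt0//.
  rewrite sqr_nrm; apply: lt_le_trans (sP n).2 _; rewrite sqrrD sqr_nrm.
  have := Dle _ Su; have : 0 <= nrm u * (e / 2) by rewrite mulr_ge0 ?nrm_ge0 ?divr_ge0 ?ltW.
  move: h1; set i := _.+1%:R^-1; rewrite mulr2n; lra.
by move: h2; lra.
Qed.

Lemma min_orthogonal H (m n : H) :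
  (forall a : R[i], nrm m <= nrm (m + a *: n)) -> ip n m = 0.
Proof.
move=> h; have [->|n0] := eqVneq n 0; first by rewrite ip0l.
have n1 := sqnorm_gt0 n0.
(* This coefficient removes the component of [m] along [n]; the norm would drop by |z|^2 / |n|^2
   inside the square. *)
set z := ip n m; have := h (- (z / (sqnorm n)%:C)).
rewrite -(@ler_pXn2r _ 2) ?nnegrE ?nrm_ge0// !sqr_nrm sqnormD sqnormZ ipZr (ipC m n) -/z.
have -> : Re (- (z / (sqnorm n)%:C) * conjc z) = - (cab z ^+ 2 / sqnorm n).
  by rewrite mulNr cReN mulrAC (mulrC z) mulJc -real_complexV -real_complexM.
rewrite cabN cabM cabV cab_real (ger0_norm (ltW n1)).
have -> : (cab z / sqnorm n) ^+ 2 * sqnorm n = cab z ^+ 2 / sqnorm n.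
  by field; rewrite gt_eqF.
move=> hh; have : cab z ^+ 2 / sqnorm n <= 0 by lra.
rewrite pmulr_lle0 ?invr_gt0// => z2; apply: cab_eq0; apply/eqP.
by have := sqr_ge0 (cab z); rewrite le_eqVlt (le_gtF z2) orbF eq_sym expf_eq0.
Qed.

Lemma closure_midD H (S : set H) (a : R[i]) (u v : H) :
  (forall u v, S u -> S v -> S (a *: u + v)) ->
  closure S u -> closure S v -> closure S (a *: u + v).
Proof.
move=> SD /closureP Su /closureP Sv; apply/closureP => e e0.
have a1 : 0 < cab a + 1 by rewrite ltr_wpDl// cab_ge0.
have [u' Su' uu] := Su _ (divr_gt0 e0 (mulr_gt0 (ltr0Sn R 1) a1)).
have [v' Sv' vv] := Sv _ (divr_gt0 e0 (ltr0Sn R 1)).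
exists (a *: u' + v'); first exact: SD.
have -> : a *: u + v - (a *: u' + v') = a *: (u - u') + (v - v').
  by rewrite scalerBr opprD addrACA.
apply: le_lt_trans (nrmD _ _) _; rewrite nrmZ.
have : cab a * nrm (u - u') <= e / 2.
  have -> : e / 2 = (cab a + 1) * (e / (2 * (cab a + 1))) by field; lra.
  by rewrite ler_pM ?cab_ge0 ?nrm_ge0 ?ltW// ltrDl.
lra.
Qed.

Lemma nrm_le_closure H (S : set H) (x y : H) (c : R) :
  (forall s, S s -> c <= nrm (x + s)) -> closure S y -> c <= nrm (x + y).
Proof.
move=> h /closureP Sy; apply/ler_addgt0Pr => e e0; have [s Ss ys] := Sy _ e0.
apply: le_trans (h _ Ss) _; apply: le_trans (nrm_le_sub _ (x + y)) _.
by rewrite opprD addrACA subrr add0r nrm_distC lerD2l ltW.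
Qed.

Definition total H I (f : I -> H) := forall h, (forall i, ip (f i) h = 0) -> h = 0.

Lemma ip_lspan0 H (S : set H) (h u : H) :
  (forall s, S s -> ip s h = 0) -> closure (lspan S) u -> ip u h = 0.
Proof.
move=> Sh /closureP Su; apply: cab_eq0; apply: small_eq0; first exact: cab_ge0.
move=> e e0; have h1 : 0 < nrm h + 1 by rewrite ltr_wpDl// nrm_ge0.
have [_ [n [c [s [Ss ->]]]] us] := Su _ (divr_gt0 e0 h1).
rewrite -[u](subrK (\sum_i c i *: s i)) ipDl ip_suml.
have -> : \sum_i ip (c i *: s i) h = 0.
  by apply: big1 => i _; rewrite ipZl Sh ?mulr0.
rewrite addr0; apply: le_trans (cauchy_schwarz _ _) _.
have -> : e = e / (nrm h + 1) * (nrm h + 1) by field; lra.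
by rewrite ler_pM ?nrm_ge0 ?ltW// ltrDl.
Qed.

(** A vector of minimal norm in the closure of u + M is orthogonal to every [f i], hence 0 by
    totality; so -u, and with it u, is a limit of elements of the span M. *)
Lemma total_dense H I (f : I -> H) : total f -> closure (lspan (range f)) = setT.
Proof.
move=> tf; apply/seteqP; split=> // u _.
set M := lspan (range f).
have Msc a v : M v -> M (a *: v).
  by move=> Mv; rewrite -[a *: v]addr0; apply: lspanD => //; exact: lspan0.
have MD v w : M v -> M w -> M (v + w).
  by move=> Mv Mw; rewrite -[v]scale1r; exact: lspanD.
have [||m Sm mle] := @min_norm _ [set u + v | v in M].
- by exists (u + 0), 0 => //; exact: lspan0.
- move=> _ _ [v Mv <-] [w Mw <-]; exists ((2^-1 : R)%:C *: (v + w)); first by apply/Msc/MD.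
  rewrite addrACA [RHS]scalerDr; congr +%R.
  by rewrite half_double.
have Mm : closure M (m - u).
  apply/closureP => e e0; move/closureP : Sm => /(_ _ e0)[_ [v Mv <-] mv].
  by exists v => //; rewrite -addrA -opprD.
have m0 : m = 0.
  apply: tf => i; apply: min_orthogonal => a.
  have -> : m + a *: f i = u + (a *: f i + (m - u)) by rewrite addrCA subrKC addrC.
  apply: (nrm_le_closure (S := M)); first by move=> s Ms; apply: mle; exists s.
  apply: closure_midD => //; first by move=> *; exact: lspanD.
  by apply: subset_closure; apply: lspan_sub; exists i.
move: Mm; rewrite m0 sub0r => /closureP Mu; apply/closureP => e e0.
have [v Mv uv] := Mu _ e0; exists (- v); last by rewrite -nrmN opprB addrC.
by rewrite -scaleN1r; exact: Msc.
Qed.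

Lemma dense_total H I (f : I -> H) : closure (lspan (range f)) = setT -> total f.
Proof.
move=> fd h fh; apply: sqnorm_eq0; rewrite /sqnorm (@ip_lspan0 _ (range f)) ?fd//.
by move=> _ [i _ <-].
Qed.

(** The vector [m] of minimal norm in the closure of the hyperplane f = 1 still satisfies f m = 1 by
    boundedness, and it is orthogonal to the kernel of [f], which contains u - f(u) m. *)
Lemma riesz H (f : H -> R[i]) (M : R) :
  (forall a u v, f (a *: u + v) = a * f u + f v) ->
  (forall u, cab (f u) <= M * nrm u) ->
  exists w, forall u, f u = ip w u.
Proof.
move=> flin fM.
have [f0|/existsNP[u1 fu1]] := pselect (forall u, f u = 0).
  by exists 0 => u; rewrite ip0l f0.
have f00 : f 0 = 0 by have := flin (-1) 0 0; rewrite scaler0 addr0 mulN1r addNr.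
have fZ a u : f (a *: u) = a * f u by rewrite -[a *: u]addr0 flin f00 addr0.
have fB u v : f (u - v) = f u - f v by rewrite addrC -scaleN1r flin mulN1r addrC.
have fD u v : f (u + v) = f u + f v by rewrite -[u]scale1r flin mul1r scale1r.
have [||m Sm mle] := @min_norm _ [set u | f u = 1].
- by exists ((f u1)^-1 *: u1) => /=; rewrite fZ mulVf//; apply/eqP.
- move=> a b /= fa fb; rewrite fZ fD fa fb -[_ + _]/(2%:R) -(real_complexn R 2).
  by rewrite -real_complexM mulVf.
have M0 : 0 <= M.
  have u0 : u1 != 0 by apply/eqP => u0; apply: fu1; rewrite u0.
  by have := le_trans (cab_ge0 (f u1)) (fM u1); rewrite (pmulr_lge0 _ (nrm_gt0 u0)).
have fm : f m = 1.
  apply/subr0_eq; apply: cab_eq0; apply: small_eq0; first exact: cab_ge0.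
  move=> e e0; have M1 : 0 < M + 1 by rewrite ltr_wpDl.
  move/closureP : Sm => /(_ _ (divr_gt0 e0 M1))[s /= <- ms].
  rewrite -fB; apply: le_trans (fM _) _.
  have -> : e = (M + 1) * (e / (M + 1)) by rewrite mulrC divfK// gt_eqF.
  by apply: ler_pM; rewrite ?nrm_ge0 ?lerDl ?(ltW ms).
have orth n : f n = 0 -> ip n m = 0.
  move=> fn; apply: min_orthogonal => a; apply: mle => /=.
  by rewrite addrC flin fn mulr0 add0r.
exists ((sqnorm m)^-1%:C *: m) => u.
have m0 : (sqnorm m)%:C != 0.
  apply/eqP => -[/sqnorm_eq0 m0]; move/eqP: fm; rewrite m0 f00 eq_sym; exact/negP/oner_neq0.
have : ip m (u - f u *: m) = 0.
  by rewrite ipC orth ?conjc0// fB fZ fm mulr1 subrr.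
rewrite ipBr ipZr ipuu => /subr0_eq mu.
by rewrite ipZl mu conjc_real mulrCA real_complexV mulVf// mulr1.
Qed.

Lemma adjoint_exists H K (T : bop H K) : exists S : bop K H, is_adjoint T S.
Proof.
have [M M0 TM] := bop_bounded T.
have pick k : exists w, forall u, ip k (T u) = ip w u.
  apply: (@riesz _ _ (nrm k * M)).
    by move=> a u v; rewrite linearP ipDr ipZr.
  move=> u; apply: le_trans (cauchy_schwarz _ _) _.
  by rewrite -mulrA ler_wpM2l ?nrm_ge0.
have [g gP] := choice pick.
have [||S SE] := @mk_bop _ _ _ g M.
- move=> a u v; apply: ip_eqP => w; rewrite [LHS]ipC [RHS]ipC; congr conjc.
  by rewrite ipDl ipZl -!gP ipDl ipZl.
- move=> k; have [->|g0] := eqVneq (g k) 0; first by rewrite nrm0 mulr_ge0// nrm_ge0.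
  have gp := nrm_gt0 g0.
  rewrite -(ler_pM2l gp) -expr2 sqr_nrm /sqnorm -gP.
  apply: le_trans (Re_le_cab _) _; apply: le_trans (cauchy_schwarz _ _) _.
  by rewrite mulrC mulrCA mulrA ler_wpM2r ?nrm_ge0// mulrC TM.
by exists S => u k; rewrite SE ipC gP -ipC.
Qed.

Definition adjb H K (T : bop H K) : bop K H := sval (cid (adjoint_exists T)).

Lemma adjbP H K (T : bop H K) : is_adjoint T (adjb T).
Proof. exact: (svalP (cid (adjoint_exists T))). Qed.
End hilbert_existence.

(** * Isometries and unitaries defined on total families *)

Section isometries.
Variable R : realType.
Implicit Types H K L : hilbert R.

Definition isom H K (T : bop H K) := forall u v, ip (T u) (T v) = ip u v.

Lemma isom_nrm H K (T : bop H K) u : isom T -> nrm (T u) = nrm u.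
Proof. by move=> iT; rewrite /nrm /sqnorm iT. Qed.

Lemma ip_limit_eq H K (u u' : H) (v v' : K) :
  (forall e : R, 0 < e -> exists a a' b b', [/\ nrm (u - a) < e, nrm (u' - a') < e,
     nrm (v - b) < e, nrm (v' - b') < e & ip a a' = ip b b']) ->
  ip u u' = ip v v'.
Proof.
move=> h; apply/subr0_eq; apply: cab_eq0; apply: small_eq0; first exact: cab_ge0.
move=> e e0; pose M := nrm u + nrm u' + nrm v + nrm v' + 1.
have M1 : 1 <= M by rewrite lerDr !addr_ge0// nrm_ge0.
have M0 : 0 < 4 * M by lra.
(* Each of the two inner products moves by at most 2 d M, so their difference is at most 4 d M <=
   e. *)
pose d := Num.min 1 (e / (4 * M)).
have d0 : 0 < d by rewrite lt_min ltr01 divr_gt0.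
have dl : d <= e / (4 * M) by rewrite ge_min lexx orbT.
have d1 : d <= 1 by rewrite ge_min lexx.
have key L (x x' a a' : L) : nrm (x - a) < d -> nrm (x' - a') < d ->
    nrm x + nrm x' + 1 <= M -> cab (ip x x' - ip a a') <= 2 * d * M.
  move=> xa xa' xM.
  have -> : ip x x' - ip a a' = ip (x - a) x' + ip a (x' - a').
    by rewrite ipBl ipBr addrA subrK.
  apply: le_trans (cabD _ _) _.
  have h1 := cauchy_schwarz (x - a) x'; have h2 := cauchy_schwarz a (x' - a').
  have h3 := nrm_le_sub a x; rewrite nrm_distC in h3.
  have p1 := nrm_ge0 x; have p2 := nrm_ge0 x'; have p3 := nrm_ge0 (x - a).
  have p4 := nrm_ge0 (x' - a'); have p5 := nrm_ge0 a.
  have q1 : nrm (x - a) * nrm x' <= d * M by rewrite ler_pM// ?ltW//; lra.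
  have q2 : nrm a * nrm (x' - a') <= M * d by rewrite ler_pM// ?ltW//; lra.
  lra.
have [a [a' [b [b' [h1 h2 h3 h4 ab]]]]] := h _ d0.
have -> : ip u u' - ip v v' = (ip u u' - ip a a') - (ip v v' - ip b b').
  by rewrite ab; ring.
apply: le_trans (cabB _ _) _.
have pu := nrm_ge0 u; have pu' := nrm_ge0 u'; have pv := nrm_ge0 v; have pv' := nrm_ge0 v'.
have k1 : cab (ip u u' - ip a a') <= 2 * d * M by apply: key => //; rewrite /M; lra.
have k2 : cab (ip v v' - ip b b') <= 2 * d * M by apply: key => //; rewrite /M; lra.
have : e = e / (4 * M) * (4 * M) by field; lra.
have : d * (4 * M) <= e / (4 * M) * (4 * M) by rewrite ler_pM2r.
lra.
Qed.

(** [G] is the graph of the map on finite combinations, where a vector may have several expressions.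
    Inner products agree along [G] and so along its closure [C]; this makes [C] single-valued, and
    completeness with density makes it everywhere defined. *)
Lemma iso_ext H K I (f : I -> H) (g : I -> K) :
  (forall i j, ip (g i) (g j) = ip (f i) (f j)) -> total f ->
  exists2 T : bop H K, isom T & forall i, T (f i) = g i.
Proof.
move=> fg tf.
pose G (p : H * K) := exists n (c : 'I_n -> R[i]) (s : 'I_n -> I),
  p = (\sum_j c j *: f (s j), \sum_j c j *: g (s j)).
have Gip p q : G p -> G q -> ip p.1 q.1 = ip p.2 q.2.
  move=> [n [c [s ->]]] [n' [c' [s' ->]]] /=; rewrite !ip_suml; apply: eq_bigr => i _.
  by rewrite !ip_sumr; apply: eq_bigr => j _; rewrite !(ipZl, ipZr) fg.
have Glin a p q : G p -> G q -> G (a *: p.1 + q.1, a *: p.2 + q.2).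
  move=> [n [c [s ->]]] [m [c' [s' ->]]] /=.
  exists (n + m)%N, (fun i => match fintype.split i with inl j => a * c j | inr j => c' j end),
    (fun i => match fintype.split i with inl j => s j | inr j => s' j end).
  rewrite !big_split_ord !scaler_sumr; congr (_ + _, _ + _); apply: eq_bigr => i _;
    by rewrite ?(unsplitK (inl i)) ?(unsplitK (inr i)) ?scalerA.
pose C x y := forall e : R, 0 < e -> exists p, [/\ G p, nrm (x - p.1) < e & nrm (y - p.2) < e].
have Cip x y x' y' : C x y -> C x' y' -> ip y y' = ip x x'.
  move=> h h'; apply: ip_limit_eq => e e0.
  have [p [Gp h1 h2]] := h _ e0; have [p' [Gp' h1' h2']] := h' _ e0.
  by exists p.2, p'.2, p.1, p'.1; split=> //; rewrite (Gip _ _ Gp Gp').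
have Clin a x y x' y' : C x y -> C x' y' -> C (a *: x + x') (a *: y + y').
  move=> h h' e e0; have a1 : 0 < cab a + 1 by rewrite ltr_wpDl// cab_ge0.
  have [p [Gp h1 h2]] := h _ (divr_gt0 e0 (mulr_gt0 (ltr0Sn R 1) a1)).
  have [p' [Gp' h1' h2']] := h' _ (divr_gt0 e0 (ltr0Sn R 1)).
  exists (a *: p.1 + p'.1, a *: p.2 + p'.2); split => /=; first exact: Glin.
  - have -> : a *: x + x' - (a *: p.1 + p'.1) = a *: (x - p.1) + (x' - p'.1).
      by rewrite scalerBr opprD addrACA.
    apply: le_lt_trans (nrmD _ _) _; rewrite nrmZ.
    have : cab a * nrm (x - p.1) <= e / 2.
      have -> : e / 2 = (cab a + 1) * (e / (2 * (cab a + 1))) by field; lra.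
      by rewrite ler_pM ?cab_ge0 ?nrm_ge0 ?ltW// ltrDl.
    lra.
  - have -> : a *: y + y' - (a *: p.2 + p'.2) = a *: (y - p.2) + (y' - p'.2).
      by rewrite scalerBr opprD addrACA.
    apply: le_lt_trans (nrmD _ _) _; rewrite nrmZ.
    have : cab a * nrm (y - p.2) <= e / 2.
      have -> : e / 2 = (cab a + 1) * (e / (2 * (cab a + 1))) by field; lra.
      by rewrite ler_pM ?cab_ge0 ?nrm_ge0 ?ltW// ltrDl.
    lra.
have Cex x : exists y, C x y.
  have pick n : exists p, G p /\ nrm (x - p.1) < n.+1%:R^-1.
    have : closure (lspan (range f)) x by rewrite total_dense.
    move=> /closureP /(_ n.+1%:R^-1)[|_ [m [c [s [sf ->]]]] xs]; first by rewrite invr_gt0.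
    have [t tP] : exists t : 'I_m -> I, forall i, f (t i) = s i.
      have pick i : exists t, f t = s i by have [j _ <-] := sf i; exists j.
      by have [t tP] := choice pick; exists t.
    exists (\sum_j c j *: f (t j), \sum_j c j *: g (t j)); split; first by exists m, c, t.
    by rewrite /=; under eq_bigr do rewrite tP.
  have [p pP] := choice pick.
  have Gnrm q q' : G q -> G q' -> nrm (q.2 - q'.2) = nrm (q.1 - q'.1).
    move=> Gq Gq'; have Gd := Glin (-1) _ _ Gq' Gq.
    have := Gip _ _ Gd Gd; rewrite /= !scaleN1r ![- _ + _]addrC => e.
    by rewrite /nrm /sqnorm e.
  have [|y yP] := @nrm_complete _ _ (fun n => (p n).2).
    move=> e e0; have [N hN] := natSinv_lt (divr_gt0 e0 (ltr0Sn R 1)).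
    exists N => n m Nn Nm; rewrite (Gnrm _ _ (pP n).1 (pP m).1).
    apply: le_lt_trans (nrm_dist _ x _) _; rewrite nrm_distC.
    have := (pP n).2; have := (pP m).2; have := hN _ Nn; have := hN _ Nm.
    by move: (n.+1%:R^-1) (m.+1%:R^-1) => i1 i2; lra.
  exists y => e e0; have [N hN] := yP _ e0; have [M hM] := natSinv_lt e0.
  exists (p (maxn N M)); split; first exact: (pP _).1.
    exact: lt_trans (pP _).2 (hM _ (leq_maxr _ _)).
  exact: hN (leq_maxl _ _).
have [F FP] := choice Cex.
have Fip u v : ip (F u) (F v) = ip u v by exact: Cip.
have Cuniq x y y' : C x y -> C x y' -> y = y'.
  move=> h h'; apply/subr0_eq; apply: sqnorm_eq0.
  rewrite /sqnorm !ipBl !ipBr (Cip _ _ _ _ h h) (Cip _ _ _ _ h h') (Cip _ _ _ _ h' h).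
  by rewrite (Cip _ _ _ _ h' h') !subrr.
have [|u|T TE] := @mk_bop _ _ _ F 1.
- by move=> a u v; apply: (Cuniq (a *: u + v)) => //; exact: Clin.
- by rewrite mul1r /nrm /sqnorm Fip.
exists T => [u v|i]; first by rewrite !TE.
rewrite TE; apply: (Cuniq (f i)) => // e e0; exists (f i, g i).
split; rewrite /= ?subrr ?nrm0//; exists 1%N, (fun _ => 1), (fun _ => i).
by rewrite !big_ord1 !scale1r.
Qed.

Lemma mk_unitary H K (T : bop H K) I (g : I -> K) : isom T -> total g ->
  (forall i, exists u, T u = g i) -> exists U : unitary H K, uop U = T.
Proof.
move=> iT tg gT; have aT := adjbP T.
have TK u : adjb T (T u) = u by apply: ip_eqP => w; rewrite -aT iT.
have KT v : T (adjb T v) = v.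
  apply/subr0_eq/tg => i; have [u <-] := gT i.
  by rewrite aT linearB /= TK subrr ip0r.
by exists (Unitary aT (@bopP _ _ _ (bcomp _ _) (bid _) TK) (@bopP _ _ _ (bcomp _ _) (bid _) KT)).
Qed.

Lemma unitaryK H K (U : unitary H K) u : uadj U (U u) = u.
Proof. by have := congr1 (fun T : bop H H => T u) (uopK U). Qed.

Lemma unitaryKV H K (U : unitary H K) u : U (uadj U u) = u.
Proof. by have := congr1 (fun T : bop K K => T u) (uadjK U). Qed.

Lemma unitary_isom H K (U : unitary H K) : isom U.
Proof. by move=> u v; rewrite uadjP unitaryK. Qed.

Lemma adj_isom H K (U : unitary H K) : isom (uadj U).
Proof. by move=> u v; rewrite -uadjP unitaryKV. Qed.

Lemma is_adjoint_sym H K (S : bop H K) (T : bop K H) : is_adjoint S T -> is_adjoint T S.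
Proof. by move=> ST u v; rewrite ipC -ST -ipC. Qed.

Lemma total_ip_eq H I (f : I -> H) (u v : H) : total f ->
  (forall i, ip (f i) u = ip (f i) v) -> u = v.
Proof. by move=> tf h; apply/subr0_eq/tf => i; rewrite ipBr h subrr. Qed.

Lemma bop_total_eq H K I (f : I -> H) (S T : bop H K) : total f ->
  (forall i, S (f i) = T (f i)) -> S = T.
Proof.
move=> tf h; apply: bopP => u.
have aS := adjbP S; have aT := adjbP T; apply: ip_eqP => w.
have -> : ip w (S u) = ip (adjb S w) u by rewrite ipC aS -ipC.
have -> : ip w (T u) = ip (adjb T w) u by rewrite ipC aT -ipC.
congr ip; apply: (total_ip_eq tf) => i.
by rewrite -aS -aT h.
Qed.

End isometries.

(** * Power series and polarization *)

Section power_series.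
Variable R : realType.
Implicit Types c a b : nat -> R[i].

Lemma cvgCP (u : nat -> (R[i] : numFieldType)) (l : R[i]) : u @ \oo --> (l : (R[i] : numFieldType)) <->
  forall e : R, 0 < e -> exists N, forall n, (N <= n)%N -> cab (l - u n) < e.
Proof.
split.
  move=> /cvgrPdist_lt h e e0; have := h e%:C; rewrite ltcR => /(_ e0)[N _ hN].
  by exists N => n /hN /=; rewrite cabE ltcR.
move=> h; apply/cvgrPdist_lt => e /gt0_complex[e1 eE].
have [N hN] := h _ e1; exists N => // n /hN hn; by rewrite /= cabE eE ltcR.
Qed.

Lemma cvgC_unique (u : nat -> (R[i] : numFieldType)) (l l' : R[i]) :
  u @ \oo --> (l : (R[i] : numFieldType)) -> u @ \oo --> (l' : (R[i] : numFieldType)) -> l = l'.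
Proof.
move=> /cvgCP h /cvgCP h'; apply/subr0_eq; apply: cab_eq0; apply: small_eq0.
  exact: cab_ge0.
move=> e e0; have [N hN] := h _ (divr_gt0 e0 (ltr0Sn R 1)).
have [M hM] := h' _ (divr_gt0 e0 (ltr0Sn R 1)); pose n := maxn N M.
have := hN n (leq_maxl _ _); have := hM n (leq_maxr _ _).
have := cab_distC l' (u n); have := cabD (l - u n) (u n - l').
by rewrite addrA subrK; lra.
Qed.

Lemma cvgC_eq (u v : nat -> (R[i] : numFieldType)) (l : R[i]) : u =1 v ->
  u @ \oo --> (l : (R[i] : numFieldType)) -> v @ \oo --> (l : (R[i] : numFieldType)).
Proof. by move=> /funext ->. Qed.

Lemma cvgC_sub (u v : nat -> (R[i] : numFieldType)) (l l' : R[i]) :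
  u @ \oo --> (l : (R[i] : numFieldType)) -> v @ \oo --> (l' : (R[i] : numFieldType)) ->
  (fun n => u n - v n) @ \oo --> (l - l' : (R[i] : numFieldType)).
Proof.
move=> /cvgCP hu /cvgCP hv; apply/cvgCP => e e0.
have [N hN] := hu _ (divr_gt0 e0 (ltr0Sn R 1)).
have [M hM] := hv _ (divr_gt0 e0 (ltr0Sn R 1)); exists (maxn N M) => n.
rewrite geq_max => /andP[/hN h1 /hM h2].
have -> : l - l' - (u n - v n) = (l - u n) - (l' - v n) by ring.
by apply: le_lt_trans (cabB _ _) _; lra.
Qed.

Lemma series_terms_bounded c (l : R[i]) :
  series (c : nat -> (R[i] : numFieldType)) @ \oo --> (l : (R[i] : numFieldType)) ->
  exists2 M : R, 0 <= M & forall n, cab (c n) <= M.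
Proof.
move=> /cvgCP /(_ 1 ltr01)[N hN]; have S0 : 0 <= \sum_(i < N) cab (c i).
  by rewrite sumr_ge0// => i _; exact: cab_ge0.
exists (2 + \sum_(i < N) cab (c i)) => [|n]; first by rewrite addr_ge0.
have [nN|Nn] := ltnP n N.
  rewrite (bigD1 (Ordinal nN)) //= addrCA lerDl addr_ge0// sumr_ge0// => i _.
  exact: cab_ge0.
have := hN n.+1 (leqW Nn); have := hN n Nn; rewrite /series /= big_nat_recr//=.
set x := \sum_(0 <= i < n) c i => h1 h2.
have -> : c n = (l - x) - (l - (x + c n)) by ring.
by apply: le_trans (cabB _ _) _; lra.
Qed.

(** Strong induction: once the lower coefficients vanish, the zero sum divided by t^m bounds the
    m-th coefficient by a multiple of t. Convergence at t = 1 supplies a common bound of the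
    coefficients. *)
Lemma power_series_unique c :
  (forall t : R, series (fun n => c n * t%:C ^+ n : (R[i] : numFieldType)) @ \oo
     --> (0 : (R[i] : numFieldType))) ->
  forall n, c n = 0.
Proof.
move=> h; have [M M0 cM] : exists2 M : R, 0 <= M & forall n, cab (c n) <= M.
  apply: (@series_terms_bounded _ 0); apply: cvgC_eq (h 1) => n.
  by rewrite /series /=; apply: eq_bigr => i _; rewrite expr1n mulr1.
elim/ltn_ind => m IH; apply: cab_eq0; apply: small_eq0; first exact: cab_ge0.
(* With t <= 1/2 the tail after t^m is at most 2 M t^(m+1), and one more t^(m+1) is spent on the
   partial sum; the second bound makes (2 M + 1) t <= e / 2. *)
move=> e e0; pose t := Num.min 2^-1 (e / (2 * (2 * M + 1))).
have K0 : 0 < 2 * (2 * M + 1) by lra.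
have t0 : 0 < t by rewrite lt_min invr_gt0 ltr0n divr_gt0.
have t2 : t <= 2^-1 by rewrite ge_min lexx.
have tM : t * (2 * (2 * M + 1)) <= e by rewrite -ler_pdivlMr// ge_min lexx orbT.
have tm : 0 < t ^+ m by rewrite exprn_gt0.
have geo k : \sum_(0 <= i < k) t ^+ i <= 2 - 2 * t ^+ k.
  elim: k => [|k IHk]; first by rewrite big_geq// expr0; lra.
  rewrite big_nat_recr//= exprS; have : 0 < t ^+ k by rewrite exprn_gt0.
  by move: (t ^+ k) IHk => x *; nra.
have part N : (m < N)%N -> cab (c m) * t ^+ m <=
    cab (\sum_(0 <= i < N) c i * t%:C ^+ i) + 2 * M * t ^+ m.+1.
  move=> mN; rewrite (big_cat_nat (n := m.+1))//= big_nat_recr//= big_nat_cond.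
  rewrite big1 ?add0r; last by move=> i /andP[/andP[_ im] _]; rewrite IH// mul0r.
  have -> : cab (c m) * t ^+ m = cab (c m * t%:C ^+ m).
    by rewrite cabM -real_complexX cab_real ger0_norm// ltW.
  set x := c m * _; set y := \sum_(_ <= i < _) _.
  have -> : x = (x + y) - y by rewrite addrK.
  apply: le_trans (cabB _ _) _; rewrite subrK lerD2l.
  apply: le_trans (cab_sum _ _ _) _.
  apply: (@le_trans _ _ (\sum_(m.+1 <= i < N) M * t ^+ i)).
    apply: ler_sum => i _; rewrite cabM -real_complexX cab_real ger0_norm ?exprn_ge0 ?(ltW t0)//.
    by rewrite ler_pM2r ?exprn_gt0.
  rewrite -mulr_sumr (_ : 2 * M * t ^+ m.+1 = M * (2 * t ^+ m.+1)); last by ring.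
  apply: ler_wpM2l => //.
  have -> : \sum_(m.+1 <= i < N) t ^+ i = t ^+ m.+1 * \sum_(0 <= i < N - m.+1) t ^+ i.
    rewrite -{1}[m.+1]add0n big_addn mulr_sumr.
    by apply: eq_bigr => i _; rewrite exprD mulrC.
  rewrite mulrC ler_pM2r ?exprn_gt0//; apply: le_trans (geo _) _.
  by rewrite lerBlDr lerDl mulr_ge0// exprn_ge0// ltW.
have : cab (c m) * t ^+ m <= 2 * M * t ^+ m.+1 + t ^+ m.+1.
  have /cvgCP /(_ (t ^+ m.+1))[|N hN] := h t; first by rewrite exprn_gt0.
  have := hN (maxn N m.+1) (leq_maxl _ _); rewrite sub0r cabN /series /=.
  have := part (maxn N m.+1) (leq_maxr _ _); lra.
rewrite exprS mulrA -mulrDl ler_pM2r//; lra.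
Qed.

(* f is both holomorphic and antiholomorphic. *)
Lemma power_series_const a b (f : R[i] -> R[i]) :
  (forall t, series (fun n => a n * t ^+ n : (R[i] : numFieldType)) @ \oo
     --> (f t : (R[i] : numFieldType))) ->
  (forall t, series (fun n => b n * conjc t ^+ n : (R[i] : numFieldType)) @ \oo
     --> (f t : (R[i] : numFieldType))) ->
  forall t, f t = f 0.
Proof.
move=> fa fb.
have ab z n : a n * z ^+ n = b n * conjc z ^+ n.
  apply/subr0_eq; move: n.
  apply: (power_series_unique (c := fun n => a n * z ^+ n - b n * conjc z ^+ n)) => t.
  have := cvgC_sub (fa (z * t%:C)) (fb (z * t%:C)); rewrite subrr.
  apply: cvgC_eq => n; rewrite /series /= -sumrB.
  by apply: eq_bigr => i _; rewrite conjcM conjc_real !exprMn; ring.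
have a0 n : (0 < n)%N -> a n = 0.
  move=> n0; have := ab 1 n; rewrite conjc1 !expr1n !mulr1 => abn.
  (* At z = 1 the two coefficients agree; at an n-th root of i, the factors z^n = i and conj(z)^n =
     -i differ, which forces the coefficient to vanish. *)
  have := ab (n.-root ('i%C : R[i])) n; rewrite -conjcX rootCK// -abn => e.
  have : a n * ('i%C - conjc 'i%C) = 0 by rewrite mulrBr e subrr.
  move/eqP; rewrite mulf_eq0 => /orP[/eqP//|].
  by rewrite eq_complex /= opprK -mulr2n pnatr_eq0 andbF.
have fE t : f t = a 0%N.
  apply: cvgC_unique (fa t) _; apply/cvgCP => e e0; exists 1%N => -[//|n] _.
  rewrite /series /= big_nat_recl//= expr0 mulr1 big1 ?addr0 ?subrr ?cab0//.
  by move=> i _; rewrite a0// mul0r.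
by move=> t; rewrite !fE.
Qed.
End power_series.

(** * Symmetrised tensors as combinations of tensor powers *)

Section polarization.
Variable R : realType.

(** Ryser's formula for the permanent. After expanding, a function f gets the signed count of the
    subsets [b] containing its range; this factors over j into 1 or 1 - 1 according as j is a value
    of f, so only surjective, hence bijective, f survive. *)
Lemma ryser (n : nat) (a : 'I_n -> 'I_n -> R[i]) :
  \sum_(b : {ffun 'I_n -> bool}) (\prod_j (if b j then 1 else -1)) *
     \prod_i \sum_(j | b j) a i j
  = \sum_(s : 'S_n) \prod_i a i (s i).
Proof.
pose F := {ffun 'I_n -> 'I_n}.
transitivity (\sum_(f : F) (injectiveb f)%:R * \prod_i a i (f i)).
  transitivity (\sum_(b : {ffun 'I_n -> bool}) \sum_(f : F)
      (\prod_j (if b j then 1 else -1) * \prod_i (b (f i))%:R) * \prod_i a i (f i)).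
    apply: eq_bigr => b _.
    under [X in _ * X]eq_bigr => i _ do rewrite big_mkcond.
    rewrite bigA_distr_bigA big_distrr /=; apply: eq_bigr => f _.
    have -> : \prod_(i < n) (if b (f i) then a i (f i) else 0) =
        (\prod_i (b (f i))%:R) * \prod_i a i (f i).
      by rewrite -big_split /=; apply: eq_bigr => i _; case: (b (f i)); rewrite ?mul1r ?mul0r.
    by rewrite mulrA.
  rewrite exchange_big; apply: eq_bigr => f _; rewrite -big_distrl /=; congr (_ * _).
  transitivity (\sum_(b : {ffun 'I_n -> bool}) \prod_j
      ((if b j then 1 else -1) * \prod_(i | f i == j) (b j)%:R : R[i])).
    apply: eq_bigr => b _; rewrite big_split /=; congr (_ * _).
    rewrite (partition_big f predT)//=; apply: eq_bigr => j _.
    by apply: eq_bigr => i /eqP ->.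
  rewrite -(bigA_distr_bigA (fun j x => (if x then 1 else -1) * \prod_(i | f i == j) (x : bool)%:R)) /=.
  have fac j : \sum_(x : bool) (if x then 1 else -1) * \prod_(i | f i == j) x%:R
      = (j \in codom f)%:R :> R[i].
    rewrite big_bool /= mul1r mulN1r big1//.
    have [/codomP[i jf]|jf] := boolP (j \in codom f).
      by rewrite (bigD1 i) ?jf//= mul0r oppr0 addr0.
    rewrite big_pred0 ?subrr// => i; apply: contraNF jf => /eqP <-; exact: codom_f.
  under eq_bigr do rewrite fac.
  have [/injectiveP finj|ninj] := boolP (injectiveb f).
    rewrite big1// => j _; suff -> : j \in codom f by [].
    by have [g fg gf] := injF_bij finj; rewrite -[j]gf codom_f.
  suff [j jf] : exists j, j \notin codom f by rewrite (bigD1 j)//= (negbTE jf) mul0r.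
  apply/existsP; apply: contraR ninj; rewrite negb_exists => /forallP h.
  have /image_injP finj : #|fintype.image f 'I_n| == #|'I_n|.
    by apply/eqP/eq_card => j; rewrite inE; have := h j; rewrite negbK => ->.
  by apply/injectiveP => x y; exact: finj.
rewrite (bigID (fun f : F => injectiveb f)) /= addrC big1 ?add0r => [|f Uf]; last first.
  by rewrite (negbTE Uf) mul0r.
rewrite (reindex (@pval _)) /=; last first.
  pose in_Sn := insubd (1%g : 'S_n).
  by exists in_Sn => /= f Uf; first apply: val_inj; apply: insubdK.
apply: eq_big => /= [s | s _]; first by rewrite (valP s).
by rewrite (valP s) mul1r; apply: eq_bigr => i _; rewrite pvalE.
Qed.

(** Only inner products of pure tensors are given, so both sides are paired with an arbitrary pure
    tensor of vectors [w i]; the identity becomes Ryser's formula for the matrix of the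
    [ip (w i) (u j)]. *)
Lemma polarization (H T : hilbert R) n (tens : ('I_n -> H) -> T) (u : 'I_n -> H) :
  is_tensor_power tens ->
  \sum_(s : 'S_n) tens (fun i => u (s i)) =
  \sum_(b : {ffun 'I_n -> bool}) (\prod_j (if b j then 1 else -1) : R[i]) *:
     tens (fun=> \sum_(j | b j) u j).
Proof.
move=> [tip /dense_total tt]; apply: (total_ip_eq tt) => w.
rewrite !ip_sumr.
under eq_bigr do rewrite tip.
under [RHS]eq_bigr => b _ do rewrite ipZr tip.
rewrite -(ryser (fun i j => ip (w i) (u j))).
apply: eq_bigr => b _; congr (_ * _); apply: eq_bigr => i _.
by rewrite ip_sumr.
Qed.
End polarization.

(** * Exponential vectors *)

Section complex_exponential.
Variable R : realType.
Implicit Types z w : R[i].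

Lemma cexpD z w : cexp (z + w) = cexp z * cexp w.
Proof.
rewrite /cexp cReD cImD expRD real_complexM cosD sinD mulrACA; congr (_ * _).
by apply: complex_eq => /=; ring.
Qed.

Lemma cexp0 : cexp (0 : R[i]) = 1.
Proof. by rewrite /cexp /= expR0 cos0 sin0 mul1r. Qed.

Lemma cexpJ z : cexp (conjc z) = conjc (cexp z).
Proof.
rewrite /cexp cReJ cImJ conjcM conjc_real cosN sinN; congr (_ * _).
Qed.

Lemma cexp_real (x : R) : cexp x%:C = (expR x)%:C.
Proof. by rewrite /cexp /= cos0 sin0 mulr1. Qed.

Lemma cexpN z : cexp z * cexp (- z) = 1.
Proof. by rewrite -cexpD subrr cexp0. Qed.

Lemma cexp_neq0 z : cexp z != 0.
Proof. by apply: contra_eq_neq (cexpN z) => ->; rewrite mul0r eq_sym oner_eq0. Qed.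

Lemma cab_cexp z : cab (cexp z) = expR (Re z).
Proof.
rewrite /cexp cabM cab_real ger0_norm ?expR_ge0//.
by rewrite /cab /= cos2Dsin2 sqrtr1 mulr1.
Qed.

End complex_exponential.

Section exponential_vectors.
Variables (R : realType) (H : hilbert R) (F : fock H).
Implicit Types u v w : H.
Local Notation e := (expvec F).
Local Notation tens n u := (fock_tens F (fun _ : 'I_n => u)).
Local Notation rt n := ((sqrtC (n`!%:R : R[i]))^-1).

Lemma sqrtC_fact n : sqrtC (n`!%:R : R[i]) = (Num.sqrt n`!%:R)%:C.
Proof.
apply/eqP; rewrite -(@eqrXn2 _ 2)// ?sqrtC_ge0 ?ler0n// ?lecR ?sqrtr_ge0//.
by rewrite sqrtCK -real_complexX sqr_sqrtr ?ler0n// real_complexn.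
Qed.

Lemma sqrtC_factV n : rt n = ((Num.sqrt n`!%:R)^-1)%:C.
Proof. by rewrite sqrtC_fact real_complexV. Qed.

Lemma sqr_sqrtC_factV n : rt n * rt n = (n`!%:R)^-1.
Proof. by rewrite -invfM -expr2 sqrtCK. Qed.

Lemma sqrtC_factV_neq0 n : rt n != 0.
Proof. by rewrite invr_eq0 sqrtC_eq0 pnatr_eq0 -lt0n fact_gt0. Qed.

Lemma tens_ip n u v : ip (tens n u) (tens n v) = ip u v ^+ n.
Proof. by rewrite (fock_tensP F n).1 prodr_const card_ord. Qed.

Lemma tensZ n (a : R[i]) u : tens n (a *: u) = a ^+ n *: tens n u.
Proof.
have [tip /dense_total tt] := fock_tensP F n.
apply: (total_ip_eq tt) => w; rewrite ipZr !tip.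
under eq_bigr do rewrite ipZr.
by rewrite big_split /= prodr_const card_ord.
Qed.

Lemma tens_sym n (a : R[i]) u : sym_tensors (fock_tens F (n := n)) (a *: tens n u).
Proof.
apply: subset_closure; rewrite -[a *: _]addr0; apply: lspanD; last exact: lspan0.
exists 1%N, (fun _ => (n`!%:R : R[i])^-1), (fun _ => n`!%:R *: tens n u); split.
  move=> _; exists (fun _ => u) => //.
  by rewrite sumr_const -scaler_nat card_Sn.
by rewrite big_ord1 scalerA mulVf ?scale1r// pnatr_eq0 -lt0n fact_gt0.
Qed.

Lemma sqnorm_tens n u : sqnorm (rt n *: tens n u) = exp_coeff (sqnorm u) n.
Proof.
rewrite sqnormZ /exp_coeff /sqnorm tens_ip ipuu -real_complexX /= -/(sqnorm u).
rewrite sqrtC_factV cab_real ger0_norm ?invr_ge0 ?sqrtr_ge0// exprVn.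
by rewrite sqr_sqrtr ?ler0n// mulrC.
Qed.

(** [expvec] is an [xget] with default value 0. The default is excluded because the squared norms of
    the prescribed components form an exponential series, so [fock_surj] applies. *)
Lemma expvec_comp n u : fock_comp F n (e u) = rt n *: tens n u.
Proof.
rewrite /expvec; case: xgetP => [g _ ->//|/= no].
have [||g hg] := @fock_surj _ _ F (fun n => rt n *: tens n u).
- by move=> m; exact: tens_sym.
- under eq_fun do rewrite sqnorm_tens; exact: is_cvg_series_exp_coeff.
by have := no g; case.
Qed.

Lemma expvec_ip_series u v :
  series (fun n => ip u v ^+ n / n`!%:R : (R[i] : numFieldType)) @ \oo
    --> (ip (e u) (e v) : (R[i] : numFieldType)).
Proof.
apply: cvgC_eq (@fock_ip _ _ F (e u) (e v)) => n; rewrite /series /=; apply: eq_bigr => i _.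
rewrite !expvec_comp ipZl ipZr tens_ip sqrtC_factV conjc_real -sqrtC_factV mulrA.
by rewrite sqr_sqrtC_factV mulrC.
Qed.

Lemma expvec_power_series (g : F) u : exists a : nat -> R[i],
  (forall n, a n = ip (fock_comp F n g) (rt n *: tens n u)) /\
  forall t, series (fun n => a n * t ^+ n : (R[i] : numFieldType)) @ \oo
    --> (ip g (e (t *: u)) : (R[i] : numFieldType)).
Proof.
exists (fun n => ip (fock_comp F n g) (rt n *: tens n u)); split=> // t.
apply: cvgC_eq (@fock_ip _ _ F g (e (t *: u))) => n; rewrite /series /=; apply: eq_bigr => i _.
by rewrite expvec_comp tensZ scalerA mulrC -scalerA ipZr mulrC.
Qed.

(** A vector orthogonal to all e(t u) gives a power series in t that vanishes, so each of its
    components is orthogonal to all tensor powers. By polarization these span the symmetric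
    tensors. *)
Lemma exp_total : total e.
Proof.
move=> g eg; have tg n u : ip (tens n u) (fock_comp F n g) = 0.
  have [a [aE ac]] := expvec_power_series g u.
  have a0 : a n = 0.
    apply: power_series_unique => t; have := ac t%:C.
    by rewrite ipC eg conjc0.
  have := aE n; rewrite a0 ipZr => /esym/eqP.
  rewrite mulf_eq0 (negbTE (sqrtC_factV_neq0 n)) /= => /eqP h.
  by rewrite ipC h conjc0.
have g0 n : fock_comp F n g = 0.
  apply: sqnorm_eq0; rewrite /sqnorm (ip_lspan0 (h := fock_comp F n g) _ (@fock_sym _ _ F n g))//.
  move=> _ [u _ <-]; rewrite (polarization _ (fock_tensP F n)) ip_suml big1// => b _.
  by rewrite ipZl tg mulr0.
apply: sqnorm_eq0; rewrite /sqnorm.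
suff -> : ip g g = 0 by [].
apply: cvgC_unique (@fock_ip _ _ F g g) _; apply/cvgCP => r r0; exists 0%N => n _.
by rewrite /series /= big1 ?subrr ?cab0// => i _; rewrite g0 ip0l.
Qed.

Lemma exp0_ip v : ip (e 0) (e v) = 1.
Proof.
apply: cvgC_unique (@expvec_ip_series 0 v) _; apply/cvgCP => r r0; exists 1%N => -[//|n] _.
rewrite /series /= big_nat_recl//= ip0l expr0 fact0 divr1 big1 ?addr0 ?subrr ?cab0//.
by move=> i _; rewrite exprS mul0r mul0r.
Qed.

Lemma one_particle_exists u : exists g : F, (forall v, ip (e v) g = ip v u) /\
  forall n, fock_comp F n g = (n == 1%N)%:R *: tens n u.
Proof.
have [||g hg] := @fock_surj _ _ F (fun n => (n == 1%N)%:R *: tens n u).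
- by move=> m; exact: tens_sym.
- apply/cvg_ex; exists (sqnorm (tens 1 u)); apply/cvgrPdist_lt => r r0; exists 2%N => // -[//|[//|n]] _; rewrite /series /= big_nat_recl//= big_nat_recl//= big1.
    by rewrite scale0r sqnorm0 add0r addr0 scale1r subrr normr0.
  by move=> i _; rewrite scale0r sqnorm0.
exists g; split=> // v; apply: cvgC_unique (@fock_ip _ _ F (e v) g) _.
apply/cvgCP => r r0; exists 2%N => -[//|[//|n]] _.
rewrite /series /= big_nat_recl//= big_nat_recl//= big1.
  rewrite !hg scale0r ip0r add0r addr0 scale1r expvec_comp ipZl tens_ip expr1.
  by rewrite (_ : 1`! = 1%N)// sqrtC1 invr1 conjc1 mul1r subrr cab0.
by move=> i _; rewrite hg scale0r ip0r.
Qed.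

Definition one_particle u : F := sval (cid (one_particle_exists u)).

Lemma exp_one u v : ip (e v) (one_particle u) = ip v u.
Proof. exact: (svalP (cid (one_particle_exists u))).1. Qed.

Lemma one_one u v : ip (one_particle u) (one_particle v) = ip u v.
Proof.
have hu := (svalP (cid (one_particle_exists u))).2.
have hv := (svalP (cid (one_particle_exists v))).2.
apply: cvgC_unique (@fock_ip _ _ F (one_particle u) (one_particle v)) _.
apply/cvgCP => r r0; exists 2%N => -[//|[//|n]] _.
rewrite /series /= big_nat_recl//= big_nat_recl//= big1.
  by rewrite !hu !hv !scale0r ip0r add0r addr0 !scale1r tens_ip expr1 subrr cab0.
by move=> i _; rewrite hu scale0r ip0l.
Qed.

Lemma one_particleD u v : one_particle (u + v) = one_particle u + one_particle v.
Proof.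
by apply: (total_ip_eq exp_total) => w; rewrite ipDr !exp_one ipDr.
Qed.

Lemma one_particleZ (a : R[i]) u : one_particle (a *: u) = a *: one_particle u.
Proof.
by apply: (total_ip_eq exp_total) => w; rewrite ipZr !exp_one ipZr.
Qed.

End exponential_vectors.

(** * Irreducibility of the Weyl operators *)

Section weyl_operators.
Variables (R : realType) (H : hilbert R) (F : fock H) (W : H -> unitary F F).
Hypothesis Wweyl : is_weyl W.
Implicit Types u v w : H.
Local Notation e := (expvec F).

Lemma ipuu_half u : ip u u / 2%:R = (sqnorm u / 2)%:C.
Proof. by rewrite ipuu real_complexM real_complexV real_complexn. Qed.

(** Unitarity of W(u) between e(0) and e(v - u) expresses the inner product of e(u) and e(v) through
    that of e(0) and e(v - u), which is 1. This avoids identifying the sum of the complex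
    exponential series. *)
Lemma exp_ip u v : ip (e u) (e v) = cexp (ip u v).
Proof.
have := unitary_isom (W u) (e 0) (e (v - u)).
rewrite !Wweyl exp0_ip addr0 subrKC ipZl ipZr -cexpJ mulrA -cexpD ip0r subr0.
rewrite ipuu_half -real_complexN conjc_real ipBr ipuu.
set x := _ + _; have -> : x = - ip u v.
  rewrite /x [in X in _ - (_ - X)](splitr (sqnorm u)) real_complexD real_complexN.
  by ring.
by move=> h; rewrite -[LHS]mul1r -(cexpN (ip u v)) -mulrA h mulr1.
Qed.

Lemma exp_sqnorm u : sqnorm (e u) = expR (sqnorm u).
Proof. by rewrite /sqnorm exp_ip ipuu cexp_real. Qed.

(** The vector on the left is the part of e(u) with at least two particles, the remainder of its
    first-order expansion. *)
Lemma two_more u :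
  sqnorm (e u - e 0 - one_particle F u) = expR (sqnorm u) - 1 - sqnorm u.
Proof.
have n1 : sqnorm (one_particle F u) = sqnorm u by rewrite /sqnorm one_one.
rewrite 2!sqnormB !exp_sqnorm n1 sqnorm0 expR0 ipBl !cReB !exp_one ip0l !exp_ip.
by rewrite !ip0r cexp0 /= -/(sqnorm u); ring.
Qed.

(** All matrix coefficients between exponential vectors reduce to the function [h]. On a complex
    line through 0 it is a power series in t, from the vector e(w), and also one in conj(t), from
    [hN]; hence it is constant. *)
Lemma weyl_commutant (T : bop F F) :
  (forall u xi eta, ip (W u xi) (T (W u eta)) = ip xi (T eta)) ->
  forall eta, T eta = ip (e 0) (T (e 0)) *: eta.
Proof.
move=> WT; pose h w := ip (e 0) (T (e w)).
have bE v w : ip (e v) (T (e w)) = cexp (ip v w) * h (w - v).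
  rewrite -(WT (- v)) !Wweyl [- v + v]addrC subrr [- v + w]addrC bopZ ipZl ipZr.
  rewrite mulrA -cexpJ -cexpD; congr (cexp _ * _).
  rewrite !ipNl !ipNr opprK ipuu_half ipuu -real_complexN opprK -real_complexD conjc_real.
  rewrite addrA -real_complexD; set y := (_ + _)%:C.
  suff -> : y = 0 by rewrite add0r.
  by rewrite /y (_ : _ - _ = 0)//; field.
have hN w : h w = ip (e (- w)) (T (e 0)) by rewrite bE ip0r cexp0 mul1r sub0r opprK.
have h0 w : h w = h 0.
  have [a [_ aP]] := expvec_power_series (adjb T (e 0)) w.
  have [b [_ bP]] := expvec_power_series (T (e 0)) (- w).
  rewrite -[w]scale1r -[in RHS](scale0r w).
  apply: (@power_series_const _ a (fun n => conjc (b n)) (fun t => h (t *: w))) => t.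
    have -> : h (t *: w) = ip (adjb T (e 0)) (e (t *: w)) by rewrite /h ipC (adjbP T) -ipC.
    exact: aP.
  have /cvgCP bt := bP t; apply/cvgCP => r r0; have [N hN'] := bt _ r0.
  exists N => n /hN'; rewrite -cabJ conjcB; congr (cab (_ - _) < _).
    by rewrite hN -scalerN -ipC.
  by rewrite /series /= conjc_sum; apply: eq_bigr => i _; rewrite conjcM conjcX.
suff TE : T = bscale (h 0) (bid F) by move=> eta; rewrite {1}TE.
apply: (bop_total_eq (@exp_total _ _ F)) => w /=.
apply: (total_ip_eq (@exp_total _ _ F)) => v.
by rewrite bE h0 [RHS]ipZr exp_ip mulrC.
Qed.

(** The product of [S] with the adjoint of [S'] satisfies the hypothesis of [weyl_commutant], so it
    is a scalar. *)
Lemma weyl_irreducible (K : hilbert R) (S S' : bop F K) :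
  (forall u xi eta, ip (S' (W u xi)) (S (W u eta)) = ip (S' xi) (S eta)) ->
  forall xi eta, ip (S' xi) (S eta) = ip (S' (e 0)) (S (e 0)) * ip xi eta.
Proof.
move=> h xi eta; pose T := bcomp (adjb S') S.
have TE a b : ip a (T b) = ip (S' a) (S b) by rewrite (adjbP S').
have Tc : forall b, T b = ip (e 0) (T (e 0)) *: b.
  by apply: weyl_commutant => u a b; rewrite !TE.
by rewrite -TE Tc ipZr TE.
Qed.

End weyl_operators.

(** * Normal endomorphisms and their intertwiners *)

Section rank_one.
Variable R : realType.
Implicit Types H : hilbert R.

Lemma rank_one_exists H (xi w : H) : exists T : bop H H, forall v, T v = ip w v *: xi.
Proof.
apply: (@mk_bop _ _ _ _ (nrm w * nrm xi)).
  by move=> a u v; rewrite ipDr ipZr scalerDl scalerA.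
move=> u; rewrite nrmZ mulrAC ler_wpM2r ?nrm_ge0//; exact: cauchy_schwarz.
Qed.

Definition rank_one H (xi w : H) : bop H H := sval (cid (rank_one_exists xi w)).

Lemma rank_oneE H (xi w v : H) : rank_one xi w v = ip w v *: xi.
Proof. exact: (svalP (cid (rank_one_exists xi w))). Qed.

Lemma rank_one_adj H (xi w : H) : is_adjoint (rank_one xi w) (rank_one w xi).
Proof. by move=> u v; rewrite !rank_oneE ipZl ipZr -ipC mulrC. Qed.

Definition is_proj H (p : bop H H) := selfadjoint p /\ forall u, p (p u) = p u.

Lemma proj_ip H (p : bop H H) u : is_proj p -> ip u (p u) = (sqnorm (p u))%:C.
Proof. by move=> [ps pp]; rewrite -[in LHS]pp -ps ipuu. Qed.

Lemma proj_contract H (p : bop H H) u : is_proj p -> nrm (p u) <= nrm u.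
Proof.
move=> pp; have := cauchy_schwarz u (p u); rewrite proj_ip// cab_real.
rewrite ger0_norm ?sqnorm_ge0// -sqr_nrm.
have [p0|] := eqVneq (p u) 0; first by rewrite p0 nrm0 nrm_ge0.
by move=> /nrm_gt0 p0; rewrite expr2 ler_pM2r.
Qed.

Lemma proj_le H (p q : bop H H) : is_proj p -> is_proj q ->
  (forall u, nrm (p u) <= nrm (q u)) -> bop_le p q.
Proof.
move=> pp pq h u; rewrite !proj_ip// lecR -!sqr_nrm.
by rewrite ler_pXn2r ?nnegrE ?nrm_ge0.
Qed.

Lemma bid_proj H : is_proj (bid H). Proof. by split=> // u v. Qed.

Definition bop_zero H : bop H H := bscale 0 (bid H).

Lemma bop_zeroE H (u : H) : bop_zero H u = 0. Proof. exact: scale0r. Qed.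

(** For nonzero z, the orthogonal projection that kills z; it serves as a competing upper bound in
    [intertwiner_total]. *)
Definition off_line H (z : H) : bop H H :=
  badd (bid H) (bscale (- (sqnorm z)^-1%:C) (rank_one z z)).

Lemma off_lineE H (z u : H) : off_line z u = u - ((sqnorm z)^-1%:C * ip z u) *: z.
Proof. by rewrite /= rank_oneE scalerA mulNr scaleNr. Qed.

Lemma off_line_proj H (z : H) : z != 0 -> is_proj (off_line z) /\ off_line z z = 0.
Proof.
move=> z0; have nz : off_line z z = 0.
  rewrite off_lineE ipuu -real_complexM mulVf ?scale1r ?subrr//.
  by rewrite gt_eqF// sqnorm_gt0.
split=> //; split.
  move=> u v; rewrite !off_lineE ipBl ipBr ipZl ipZr conjcM conjc_real -ipC.
  by congr (_ - _); ring.
by move=> u; rewrite [in LHS](off_lineE z u) bopB bopZ nz scaler0 subr0.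
Qed.

End rank_one.

Section exhausting_projections.
Variables (R : realType) (H : hilbert R) (d : nat -> H).

(** Gram-Schmidt: the projection onto the span of the first n vectors of [d]. If [d m] is already in
    the range, then v = 0 and the added term vanishes. *)
Fixpoint gs (n : nat) : bop H H :=
  if n is m.+1 then
    let v := d m - gs m (d m) in badd (gs m) (rank_one ((sqnorm v)^-1%:C *: v) v)
  else bop_zero H.

Lemma gsS n u (v := d n - gs n (d n)) :
  gs n.+1 u = gs n u + ip v u *: ((sqnorm v)^-1%:C *: v).
Proof. by rewrite /= rank_oneE. Qed.

Lemma gs_proj n : is_proj (gs n).
Proof.
elim: n => [|n [ps pp]].
  by split=> [u v|u]; rewrite !bop_zeroE ?ip0l ?ip0r.
pose v := d n - gs n (d n).
have pv : gs n v = 0 by rewrite bopB pp subrr.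
split.
  move=> u w; rewrite !gsS -/v ipDl ipDr ps !ipZl !ipZr conjc_real -ipC.
  by congr (_ + _); ring.
move=> u; rewrite [in LHS](gsS n u) -/v bopD !bopZ !gsS -/v pp pv add0r.
have -> : ip v (gs n u) = 0 by rewrite -ps pv ip0l.
rewrite scale0r addr0; congr (_ + _); rewrite ipuu.
have [v0|v0] := eqVneq v 0; first by rewrite v0 !scaler0.
congr (_ *: _).
by rewrite [LHS]scalerA -real_complexM mulVf ?scale1r ?gt_eqF ?sqnorm_gt0.
Qed.

Lemma gs_fix n : gs n.+1 (d n) = d n.
Proof.
have [ps pp] := gs_proj n; rewrite gsS; set v := d n - _.
have pv : gs n v = 0 by rewrite bopB pp subrr.
have -> : ip v (d n) = ip v v.
  by rewrite {3}/v ipBr -ps pv ip0l subr0.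
rewrite ipuu scalerA -real_complexM.
have [v0|v0] := eqVneq v 0; first by rewrite v0 scaler0 addr0; apply/esym/subr0_eq.
by rewrite mulfV ?scale1r ?gt_eqF ?sqnorm_gt0// /v addrC subrK.
Qed.

Lemma gs_mono n m : (n <= m)%N -> forall u, gs m (gs n u) = gs n u.
Proof.
move=> /subnK <-; elim: (m - n)%N => [|k IH] u; first exact: (gs_proj n).2.
rewrite addSn gsS IH; have [ps pp] := gs_proj (k + n).
have -> : ip (d (k + n) - gs (k + n) (d (k + n))) (gs n u) = 0.
  by rewrite -{1}(IH u) -ps bopB pp subrr ip0l.
by rewrite scale0r addr0.
Qed.

Lemma gs_le n m : (n <= m)%N -> bop_le (gs n) (gs m).
Proof.
move=> nm; apply: proj_le; try exact: gs_proj.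
move=> u; have -> : gs n u = gs n (gs m u).
  apply: ip_eqP => w; rewrite -(gs_proj n).1 -(gs_proj n).1.
  by rewrite -(gs_proj m).1 gs_mono.
exact/proj_contract/gs_proj.
Qed.

(** Normality is stated through suprema of operators, so the identity has to be exhibited as one. If
    u is close to [d n], then [gs n.+1 u] is close to u, so an upper bound T satisfies ip u (T u) >=
    |u|^2. *)
Lemma gs_sup : closure (range d) = setT -> bop_sup (range gs) (bid H).
Proof.
move=> dd; split; first exact: (bid_proj H).1.
  move=> _ [n _ <-]; apply: proj_le; [exact: gs_proj|exact: bid_proj|].
  by move=> u; exact/proj_contract/gs_proj.
move=> T Ts hT u; have rT : ip u (T u) = (Re (ip u (T u)))%:C.
  rewrite RRe_real//; have /hT /(_ u) : range gs (gs 0) by exists 0%N.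
  by rewrite bop_zeroE ip0r => /ger0_real.
have T0 : 0 <= Re (ip u (T u)).
  have /hT /(_ u) : range gs (gs 0) by exists 0%N.
  by rewrite bop_zeroE ip0r rT lecR.
rewrite rT ipuu lecR -sqr_nrm -[leRHS]sqr_sqrtr// ler_pXn2r ?nnegrE ?nrm_ge0 ?sqrtr_ge0//.
apply/ler_addgt0Pr => e e0.
have : closure (range d) u by rewrite dd.
move=> /closureP /(_ _ (divr_gt0 e0 (ltr0Sn R 1)))[_ [n _ <-] un].
have pu : nrm (gs n.+1 u) <= Num.sqrt (Re (ip u (T u))).
  rewrite -(@ler_pXn2r _ 2) ?nnegrE ?nrm_ge0 ?sqrtr_ge0// sqr_nrm sqr_sqrtr//.
  have /hT /(_ u) : range gs (gs n.+1) by exists n.+1.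
  by rewrite rT proj_ip ?lecR//; exact: gs_proj.
have := proj_contract (u - d n) (gs_proj n.+1); rewrite bopB gs_fix.
have := nrm_le_sub (d n) (gs n.+1 u); have := nrm_le_sub u (d n).
rewrite [nrm (d n - _)]nrm_distC; lra.
Qed.

End exhausting_projections.

Section intertwiners.
Variables (R : realType) (H : hilbert R) (phi : bop H H -> bop H H).
Hypothesis sepH : separable H.
Hypothesis phiP : normal_unital_star_endo phi.

Definition intertwiner (S : bop H H) := forall T u, phi T (S u) = S (T u).

Lemma separable_seq : exists d : nat -> H, closure (range d) = setT.
Proof.
have [D /countable_injP[f finj] dD] := sepH.
exists (fun n => xget 0 [set x | D x /\ f x = n]).
apply/seteqP; split=> // x _; apply/closureP => e e0.
have [||y [xy Dy]] := dD (ball x e%:C).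
- by exists x; apply: ballxx; rewrite ltcR.
- exact: ball_open.
exists y; last by move: xy; rewrite -ball_normE /= normE ltcR.
exists (f y) => //; case: xgetP => [z _ [Dz fzy]|/(_ y)[]//].
by apply: finj; rewrite ?inE.
Qed.

Lemma phi_adj (T S : bop H H) : is_adjoint T S -> forall u v, ip (phi T u) v = ip u (phi S v).
Proof. by move=> TS; exact: endo_adj phiP _ _ TS. Qed.

Lemma phiM T S u : phi (bcomp T S) u = phi T (phi S u).
Proof. by rewrite (endoM phiP). Qed.

Lemma phiD T S u : phi (badd T S) u = phi T u + phi S u.
Proof. by rewrite (endoD phiP). Qed.

Lemma phiZ a T u : phi (bscale a T) u = a *: phi T u.
Proof. by rewrite (endoZ phiP). Qed.

Lemma phi_proj p : is_proj p -> is_proj (phi p).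
Proof.
move=> [ps pp]; split; first exact: phi_adj.
by move=> u; rewrite -phiM; congr (phi _ _); exact: bopP.
Qed.

(** Since T |u><w| = |T u><w|, multiplicativity of [phi] makes u -> phi(|u><w|) eta intertwining. It
    is bounded because |w><u| |u><w| is |u|^2 times |w><w|. *)
Lemma rank_one_intertwiner (w eta : H) : exists S : bop H H,
  intertwiner S /\ forall u, S u = phi (rank_one u w) eta.
Proof.
have [||S SE] := @mk_bop _ _ _ (fun u => phi (rank_one u w) eta)
    (Num.sqrt (nrm eta * nrm (phi (rank_one w w) eta))).
- move=> a u v; rewrite -phiZ -phiD; congr (phi _ _).
  by apply: bopP => x; rewrite /= !rank_oneE scalerDr !scalerA mulrC.
- move=> u; set c := nrm eta * _; have c0 : 0 <= c by rewrite mulr_ge0 ?nrm_ge0.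
  rewrite -(@ler_pXn2r _ 2) ?nnegrE ?mulr_ge0 ?nrm_ge0 ?sqrtr_ge0//.
  rewrite sqr_nrm exprMn sqr_sqrtr// {1}/sqnorm.
  rewrite (phi_adj (rank_one_adj u w)) -phiM.
  have -> : bcomp (rank_one w u) (rank_one u w) = bscale (sqnorm u)%:C (rank_one w w).
    by apply: bopP => x; rewrite /= !rank_oneE ipZr ipuu scalerA mulrC.
  rewrite phiZ ipZr cReZ mulrC sqr_nrm ler_wpM2r ?sqnorm_ge0//.
  exact: le_trans (Re_le_cab _) (cauchy_schwarz _ _).
exists S; split=> // T u; rewrite !SE -phiM; congr (phi _ _).
by apply: bopP => x; rewrite /= !rank_oneE bopZ.
Qed.

(** If z is orthogonal to all these ranges, then [phi] of every rank-one operator kills z, and so do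
    the projections [phi (gs d n)]. These lie below [off_line z], and by normality so does their
    supremum phi(1) = 1, which is absurd at z. *)
Lemma intertwiner_total z :
  (forall S, intertwiner S -> forall u, ip (S u) z = 0) -> z = 0.
Proof.
move=> h; have rk0 w u : phi (rank_one w u) z = 0.
  apply: ip_eq0P => eta; rewrite -(phi_adj (rank_one_adj u w)).
  by have [S [iS SE]] := rank_one_intertwiner w eta; rewrite -SE h.
have [d dd] := separable_seq.
have g0 n : phi (gs d n) z = 0.
  elim: n => [|n IH] /=; first by rewrite phiZ scale0r.
  by rewrite phiD IH rk0 addr0.
have dir S1 S2 : range (gs d) S1 -> range (gs d) S2 ->
    exists S, [/\ range (gs d) S, bop_le S1 S & bop_le S2 S].
  move=> [n _ <-] [m _ <-]; exists (gs d (maxn n m)); split; first by exists (maxn n m).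
    exact/gs_le/leq_maxl.
  exact/gs_le/leq_maxr.
have [_ _ lub] : bop_sup (phi @` range (gs d)) (phi (bid H)).
  apply: (endo_normal phiP) => //; last exact: gs_sup.
    by exists (gs d 0), 0%N.
  by move=> _ [n _ <-]; exact: (gs_proj d n).1.
apply/eqP; apply/negP => /negP z0; have [pz oz] := off_line_proj z0.
have /(_ z) : bop_le (phi (bid H)) (off_line z).
  apply: lub pz.1 _ => _ [_ [n _ <-] <-]; apply: proj_le => //; first exact/phi_proj/gs_proj.
  move=> u; rewrite off_lineE; set c := _ * _.
  have -> : phi (gs d n) u = phi (gs d n) (u - c *: z).
    by rewrite bopB bopZ g0 scaler0 subr0.
  exact/proj_contract/phi_proj/gs_proj.
by rewrite (endo1 phiP) oz ip0r /= ipuu -[leRHS]/((0 : R)%:C) lecR leNgt sqnorm_gt0.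
Qed.

End intertwiners.

(** * CCR flows *)

Section exponential_estimates.
Variable R : realType.

Lemma cexp_line (z w : R[i]) :
  (forall t : R, cexp (t%:C * z) = cexp (t%:C * w)) -> z = w.
Proof.
move=> h; have reE : Re z = Re w.
  have := congr1 (@cab R) (h 1); rewrite !cab_cexp !cReZ !mul1r; exact: expR_inj.
apply: complex_eq => //; apply/subr0_eq/eqP; apply/negP => /negP c0.
(* The real parts agree, so with this t the two exponentials differ by the factor exp(i pi) = -1. *)
have := h (pi / (Im z - Im w)); set t := _ / _.
rewrite {1}(_ : t%:C * z = t%:C * w + t%:C * (z - w)); last by ring.
rewrite cexpD -[RHS]mulr1 => /(mulfI (cexp_neq0 _))/(congr1 (@complex.Re R)).
rewrite /cexp cReZ cImZ cReZ cReB cImB reE subrr mulr0 expR0 mul1r /=.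
by rewrite divfK// cospi => h1; have : (2 : R) = 0 by [lra]; move/eqP; rewrite pnatr_eq0.
Qed.

Lemma expR_taylor1 (s : R) : 0 <= s -> expR s - 1 <= s * expR s.
Proof.
move=> s0; have := expR_ge1Dx (- s); rewrite expRN => h.
have e0 := expR_gt0 s; have := ler_wpM2r (ltW e0) h.
by rewrite mulVf ?gt_eqF//; lra.
Qed.

Lemma expR_taylor2 (s : R) : 0 <= s -> expR s - 1 - s <= s ^+ 2 * expR s.
Proof.
move=> s0; have h := expR_taylor1 s0.
have : s * (expR s - 1) <= s * (s * expR s) by rewrite ler_wpM2l.
rewrite expr2 -mulrA; lra.
Qed.

End exponential_estimates.

Section exp_expansions.
Variables (R : realType) (H : hilbert R) (F : fock H) (W : H -> unitary F F).
Hypothesis Wweyl : is_weyl W.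
Local Notation e := (expvec F).

Lemma exp_sub0 u : sqnorm (e u - e 0) = expR (sqnorm u) - 1.
Proof.
rewrite sqnormB !(exp_sqnorm Wweyl) sqnorm0 expR0 (exp_ip Wweyl) ip0r cexp0 /=; ring.
Qed.

Lemma exp_sub0_le u : nrm (e u - e 0) <= nrm u * expR (sqnorm u / 2).
Proof.
rewrite -(@ler_pXn2r _ 2) ?nnegrE ?mulr_ge0 ?nrm_ge0 ?expR_ge0//.
rewrite sqr_nrm exp_sub0 exprMn sqr_nrm -expRM_natl.
have -> : 2%:R * (sqnorm u / 2) = sqnorm u by field.
exact/expR_taylor1/sqnorm_ge0.
Qed.

Lemma two_more_le u :
  nrm (e u - e 0 - one_particle F u) <= sqnorm u * expR (sqnorm u / 2).
Proof.
rewrite -(@ler_pXn2r _ 2) ?nnegrE ?mulr_ge0 ?nrm_ge0 ?sqnorm_ge0 ?expR_ge0//.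
rewrite sqr_nrm (two_more Wweyl) exprMn -expRM_natl.
have -> : 2%:R * (sqnorm u / 2) = sqnorm u by field.
exact/expR_taylor2/sqnorm_ge0.
Qed.

(** The expansion f(t) = A + t B + O(t^2) as t decreases to 0. *)
Definition first_order (f : R -> R[i]) (A B : R[i]) :=
  exists2 K : R, 0 <= K & forall t, 0 < t -> t <= 1 -> cab (f t - (A + t%:C * B)) <= K * t ^+ 2.

Lemma exp_first_order u g :
  first_order (fun t => ip (e (t%:C *: u)) g) (ip (e 0) g) (ip (one_particle F u) g).
Proof.
exists (sqnorm u * expR (sqnorm u / 2) * nrm g).
  by rewrite !mulr_ge0 ?sqnorm_ge0 ?nrm_ge0 ?expR_ge0.
move=> t t0 t1.
have -> : ip (e (t%:C *: u)) g - (ip (e 0) g + t%:C * ip (one_particle F u) g) =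
    ip (e (t%:C *: u) - e 0 - one_particle F (t%:C *: u)) g.
  by rewrite one_particleZ !ipBl ipZl conjc_real opprD addrA.
apply: le_trans (cauchy_schwarz _ _) _; rewrite mulrAC ler_wpM2r ?nrm_ge0//.
apply: le_trans (two_more_le _) _.
have tu : sqnorm (t%:C *: u) = t ^+ 2 * sqnorm u by rewrite sqnormZ cab_real ger0_norm ?ltW.
rewrite tu [leRHS]mulrC [leRHS]mulrA; apply: ler_wpM2l.
  by rewrite mulr_ge0 ?sqr_ge0 ?sqnorm_ge0.
rewrite ler_expR ler_pM2r//.
by rewrite ler_piMl ?sqnorm_ge0// expr_le1// ltW.
Qed.

(** The Leibniz rule. The difference of the two sides, multiplied by t, is a sum of error terms of
    order t^2 with total constant [L], so it is at most L t for every small t. *)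
Lemma first_order_mul f f1 f2 A A1 A2 B B1 B2 :
  first_order f A B -> first_order f1 A1 B1 -> first_order f2 A2 B2 ->
  A = A1 * A2 -> (forall t, f t = f1 t * f2 t) -> B = A1 * B2 + B1 * A2.
Proof.
move=> [K K0 h] [K1 K10 h1] [K2 K20 h2] AE fE.
apply/subr0_eq; set c := _ - _; apply: cab_eq0; apply: small_eq0; first exact: cab_ge0.
pose M1 := cab A1 + cab B1; pose M2 := cab A2 + cab B2 + K2.
pose L := K + K1 * M2 + M1 * K2 + cab B1 * cab B2.
have M10 : 0 <= M1 by rewrite addr_ge0 ?cab_ge0.
have M20 : 0 <= M2 by rewrite !addr_ge0 ?cab_ge0.
have L0 : 0 <= L by rewrite !addr_ge0// mulr_ge0// cab_ge0.
have key t : 0 < t -> t <= 1 -> cab c <= L * t.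
  move=> t0 t1; rewrite -(ler_pM2l t0) -{1}(gtr0_norm t0) -cab_real -cabM.
  have -> : t%:C * c = - (f t - (A + t%:C * B)) + (f1 t - (A1 + t%:C * B1)) * f2 t
      + (A1 + t%:C * B1) * (f2 t - (A2 + t%:C * B2)) + t%:C ^+ 2 * (B1 * B2).
    by rewrite fE /c AE; ring.
  have ct : cab t%:C = t by rewrite cab_real gtr0_norm.
  have c1 : cab (A1 + t%:C * B1) <= M1.
    apply: le_trans (cabD _ _) _; rewrite cabM ct lerD2l.
    by rewrite ler_piMl ?cab_ge0.
  have c2 : cab (f2 t) <= M2.
    rewrite -[f2 t](subrK (A2 + t%:C * B2)); apply: le_trans (cabD _ _) _.
    rewrite addrC lerD//; last first.
      apply: le_trans (h2 _ t0 t1) _; rewrite ler_piMr//.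
      by rewrite expr_le1// ltW.
    apply: le_trans (cabD _ _) _; rewrite cabM ct lerD2l.
    by rewrite ler_piMl ?cab_ge0.
  apply: le_trans (cabD _ _) _.
  apply: le_trans (lerD (le_trans (cabD _ _) (lerD (cabD _ _) (lexx _))) (lexx _)) _.
  have ct2 : cab (t%:C ^+ 2 * (B1 * B2)) = t ^+ 2 * (cab B1 * cab B2).
    by rewrite !cabM ct expr2.
  rewrite ct2 cabN (cabM (f1 t - _)) (cabM (A1 + _)).
  have q1 : cab (f1 t - (A1 + t%:C * B1)) * cab (f2 t) <= K1 * t ^+ 2 * M2.
    by rewrite ler_pM ?cab_ge0 ?h1.
  have q2 : cab (A1 + t%:C * B1) * cab (f2 t - (A2 + t%:C * B2)) <= M1 * (K2 * t ^+ 2).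
    by rewrite ler_pM ?cab_ge0 ?h2.
  have q3 := h t t0 t1.
  have -> : t * (L * t) = K * t ^+ 2 + K1 * t ^+ 2 * M2 + M1 * (K2 * t ^+ 2)
     + t ^+ 2 * (cab B1 * cab B2) by rewrite /L; ring.
  by rewrite lerD2r !lerD.
move=> r r0; have L1 : 0 < L + 1 by rewrite ltr_wpDl.
pose t := Num.min 1 (r / (L + 1)).
have t0 : 0 < t by rewrite lt_min ltr01 divr_gt0.
have t1 : t <= 1 by rewrite ge_min lexx.
have tr : t * (L + 1) <= r by rewrite -ler_pdivlMr// ge_min lexx orbT.
have := key _ t0 t1; nra.
Qed.

Lemma exp_inj (c c' : R[i]) a b : c != 0 -> c *: e a = c' *: e b -> a = b.
Proof.
move=> c0 h; have cc : c = c'.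
  have := congr1 (ip (e 0)) h; rewrite !ipZr !(exp_ip Wweyl) !ip0l cexp0 !mulr1.
  by [].
apply: ip_eqP => v; apply: cexp_line => t.
have := congr1 (ip (e (t%:C *: v))) h; rewrite -cc !ipZr !(exp_ip Wweyl) !ipZl conjc_real.
exact: mulfI.
Qed.

End exp_expansions.

Section flows.
Variables (R : realType) (d : nat) (P : set 'rV[R]_d).

(** Only the algebraic properties are kept, so that the record also covers the subcone
    [simplicial]. *)
Record is_cone := IsCone {
  cone0 : P 0 ;
  coneD : forall x y, P x -> P y -> P (x + y) ;
  coneZ : forall a x, 0 <= a -> P x -> P (a *: x) }.

Lemma closed_convex_cone_is_cone : closed_convex_cone P -> is_cone.
Proof.
move=> [_ cP P0 PZ]; split=> // x y Px Py.
have h : (0 : R) <= 2^-1 /\ (2^-1 : R) <= 1 by split; lra.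
have [h1 h2] := h; pose l : {i01 R} := Itv01 h1 h2.
have := cP (x : convex_lmodType _) (y : convex_lmodType _) l; rewrite !inE => /(_ Px Py).
move=> /(PZ 2 _ (ler0n _ 2)); rewrite /conv /= scalerDr !scalerA.
have e1 : 2 / 2 = 1 :> R by lra.
have e2 : 2 * unstable.onem 2^-1 = 1 :> R by rewrite /unstable.onem; lra.
by rewrite e1 e2 !scale1r.
Qed.

Hypothesis cP : is_cone.
Variables (H : hilbert R) (V : 'rV[R]_d -> bop H H) (F : fock H).

Record flow := Flow {
  falpha : 'rV[R]_d -> bop F F -> bop F F ;
  flowE : E0_semigroup P falpha ;
  fweyl : H -> unitary F F ;
  fweylP : is_weyl fweyl ;
  fweylV : forall x u, P x -> falpha x (fweyl u) = fweyl (V x u) }.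

Variable f : flow.
Local Notation alpha := (falpha f).
Local Notation W := (fweyl f).
Local Notation WP := (fweylP f).
Local Notation e := (expvec F).

Lemma flow_endo x : P x -> normal_unital_star_endo (alpha x).
Proof. by move=> Px; exact: (E0_endo (flowE f) Px). Qed.

Lemma weyl_mul u v xi :
  W u (W v xi) = cexp (- (0 +i* Im (ip u v))) *: W (u + v) xi.
Proof.
suff h : bcomp (W u) (W v) = bscale (cexp (- (0 +i* Im (ip u v)))) (W (u + v)).
  by have := congr1 (fun T : bop F F => T xi) h.
apply: (bop_total_eq (@exp_total _ _ F)) => w /=.
rewrite !WP bopZ WP !scalerA -!cexpD (addrA u v w); congr (cexp _ *: _).
rewrite !ipuu_half sqnormD ipDl ipDr.
rewrite [in LHS](_ : ip u v = (Re (ip u v))%:C + (0 +i* Im (ip u v))); last first.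
  by apply: complex_eq; rewrite /= ?addr0 ?add0r.
have -> : ((sqnorm u + sqnorm v + 2 * Re (ip u v)) / 2)%:C =
    (sqnorm u / 2)%:C + (sqnorm v / 2)%:C + (Re (ip u v))%:C.
  by rewrite -!real_complexD; congr (_%:C); field.
ring.
Qed.

(** [ccr_flow] does not state that V_x is isometric. The endomorphism preserves the phase in
    [weyl_mul], so V_x preserves imaginary parts of inner products; complex linearity, applied to i
    v, gives the real parts. *)
Lemma V_isom x : P x -> isom (V x).
Proof.
move=> Px; have im u v : Im (ip (V x u) (V x v)) = Im (ip u v).
  have h t : cexp (- (0 +i* Im (ip (V x (t%:C *: u)) (V x v)))) =
             cexp (- (0 +i* Im (ip (t%:C *: u) v))).
    apply/(mulIf (cexp_neq0 (- (sqnorm (V x (t%:C *: u) + V x v) / 2)%:C))).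
    have := weyl_mul (V x (t%:C *: u)) (V x v) (e 0).
    rewrite -!(fweylV f)// -(phiM (flow_endo Px)).
    have -> : bcomp (W (t%:C *: u)) (W v) =
        bscale (cexp (- (0 +i* Im (ip (t%:C *: u) v)))) (W (t%:C *: u + v)).
      by apply: bopP => xi; rewrite /= weyl_mul.
    rewrite (phiZ (flow_endo Px)) (fweylV f)// bopD.
    rewrite !WP !scalerA ip0r subr0 ipuu_half => h.
    by have := congr1 (ip (e 0)) h; rewrite !ipZr !(exp_ip WP) ip0l cexp0 !mulr1 => ->.
  have : (- (0 +i* Im (ip (V x u) (V x v)))) = (- (0 +i* Im (ip u v))).
    apply: cexp_line => t; have := h t; rewrite bopZ !ipZl conjc_real !cImZ.
    by congr (cexp _ = cexp _); apply: complex_eq; rewrite !(cReN, cImN, cReZ, cImZ) /=;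
      rewrite ?oppr0 ?mulr0 ?mulrN.
  by move/(congr1 (@complex.Im R)); rewrite !cImN /= => /oppr_inj.
move=> u v; apply: complex_eq; last exact: im.
have := im u ('i%C *: v); rewrite bopZ !ipZr !cImM /=; lra.
Qed.

Lemma VD x y u : P x -> P y -> V (x + y) u = V x (V y u).
Proof.
move=> Px Py; have := E0_add (flowE f) (W u) Px Py.
rewrite !(fweylV f)//; last exact: coneD.
move=> /(congr1 (fun T : bop F F => T (e 0))); rewrite !WP addr0 addr0.
by move=> /(exp_inj WP (cexp_neq0 _)).
Qed.

Lemma V0 u : V 0 u = u.
Proof.
have i0 := V_isom (cone0 cP); apply/subr0_eq; apply: nrm_eq0.
by rewrite -(isom_nrm _ i0) bopB -VD ?addr0 ?subrr ?nrm0//; exact: cone0.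
Qed.

(** Strong continuity at 0 comes from the weak continuity of the flow on W(u): the coefficient
    between e(0) and e(u) is exp(-|u|^2 / 2) times the exponential of the inner product of V_y u and
    u. *)
Lemma V_cont u (r : R) : 0 < r ->
  exists2 s : R, 0 < s & forall y, P y -> `|y| < s -> nrm (V y u - u) < r.
Proof.
move=> r0; have := @E0_cont _ _ P F alpha (flowE f) (W u) (e 0) (e u) 0.
 rewrite /continuous_at.
have <- : within P (nbhs (0 : 'rV[R]_d)) = nbhs (0 : subspace P) := nbhs_subspace_in (cone0 cP).
move=> /cvgrPdist_lt.
(* A coefficient within [ep] of its value at 0 forces Re (ip (V y u) u) > |u|^2 - dl, and then |V y
   u - u|^2 < 2 dl = r^2. *)
pose dl := r ^+ 2 / 2; have dl0 : 0 < dl by rewrite divr_gt0// exprn_gt0.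
pose ep := expR (sqnorm u / 2) * (1 - expR (- dl)).
have ep0 : 0 < ep by rewrite mulr_gt0 ?expR_gt0// subr_gt0 expR_lt1 oppr_lt0.
move=> /(_ ep%:C); rewrite ltcR => /(_ ep0)/nbhs_ballP[s /= s0 hs].
exists s => // y Py ys; have /hs/(_ Py) : ball 0 s y.
  by rewrite -ball_normE /= sub0r normrN.
have fE z : P z -> ip (alpha z (W u) (e 0)) (e u) =
    (expR (- (sqnorm u / 2)))%:C * cexp (ip (V z u) u).
  move=> Pz; rewrite (fweylV f)// WP addr0 ip0r subr0 ipZl (exp_ip WP) -cexpJ.
  rewrite ipuu_half -real_complexN conjc_real cexp_real.
  by rewrite {1}/sqnorm (V_isom Pz) -/(sqnorm u).
rewrite -[X in `|X|]/(ip (alpha 0 (W u) (e 0)) (e u) - ip (alpha y (W u) (e 0)) (e u)).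
rewrite (fE _ (cone0 cP)) (fE _ Py) V0 cabE ltcR -mulrBr cabM cab_real ger0_norm ?expR_ge0// => hy.
have : expR (- (sqnorm u / 2)) * (expR (sqnorm u) - expR (Re (ip (V y u) u))) < ep.
  apply: le_lt_trans hy; rewrite ler_wpM2l ?expR_ge0//.
  have := cabD (cexp (ip u u) - cexp (ip (V y u) u)) (cexp (ip (V y u) u)).
  by rewrite subrK !cab_cexp -/(sqnorm u); lra.
rewrite /ep.
have -> : expR (sqnorm u) = expR (sqnorm u / 2) * expR (sqnorm u / 2).
  by rewrite -expRD; congr expR; field.
rewrite mulrBr mulrA -expRD addNr expR0 mul1r mulrBr mulr1 -!expRD.
move=> h; have {h} : expR (sqnorm u / 2 - dl) < expR (- (sqnorm u / 2) + Re (ip (V y u) u)) by lra.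
rewrite ltr_expR => h.
rewrite -(@ltr_pXn2r _ 2) ?nnegrE ?nrm_ge0 ?ltW// sqr_nrm sqnormB.
rewrite -[sqnorm (V y u)]sqr_nrm (isom_nrm _ (V_isom Py)) sqr_nrm.
by move: h; rewrite /dl; lra.
Qed.

Definition kerV x u := forall w, ip (V x w) u = 0.

Lemma kerV_decomp x u : P x -> exists k w, kerV x k /\ u = k + V x w.
Proof.
move=> Px; exists (u - V x (adjb (V x) u)), (adjb (V x) u); rewrite subrK; split=> // w.
by rewrite ipBr (V_isom Px) (adjbP (V x)) subrr.
Qed.

Lemma kerV_lin x (a : R[i]) u v : kerV x u -> kerV x v -> kerV x (a *: u + v).
Proof. by move=> ku kv w; rewrite ipDr ipZr ku kv mulr0 addr0. Qed.

Lemma kerV0 x : kerV x 0. Proof. by move=> w; rewrite ip0r. Qed.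

Lemma kerVZ x (a : R[i]) u : kerV x u -> kerV x (a *: u).
Proof. by move=> ku; rewrite -[_ *: _]addr0; apply: kerV_lin (@kerV0 x). Qed.

Lemma kerVD x y u v : P x -> P y -> kerV x u -> kerV y v -> kerV (x + y) (u + V x v).
Proof. by move=> Px Py ku kv w; rewrite VD// ipDr ku (V_isom Px) kv addr0. Qed.

Lemma kerV_ip x u w : kerV x u -> ip u (V x w) = 0.
Proof. by move=> ku; rewrite ipC ku conjc0. Qed.

(** The intertwining relation tested on Weyl operators only. For x in P it is equivalent to
    [intertwiner (alpha x)], by [wint_alpha] and [intertwiner_wint]. *)
Definition wint x (S : bop F F) := forall u xi, S (W u xi) = W (V x u) (S xi).

Lemma wint_ip x S S' : wint x S -> wint x S' ->
  forall xi eta, ip (S' xi) (S eta) = ip (S' (e 0)) (S (e 0)) * ip xi eta.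
Proof.
move=> wS wS'; apply: (weyl_irreducible WP) => u xi eta.
by rewrite wS wS' (unitary_isom (W (V x u))).
Qed.

(** For each intertwiner S', the vectors alpha(T) S u and S T u have the same inner products with
    the range of S', because the adjoint of S' times S is a scalar. The ranges of all S' are
    total. *)
Lemma wint_alpha x S : P x -> wint x S -> intertwiner (alpha x) S.
Proof.
move=> Px wS T u; apply/subr0_eq.
apply: (intertwiner_total (E0_separable (flowE f)) (flow_endo Px)) => S' iS' xi.
have wS' : wint x S' by move=> v eta; rewrite -(fweylV f) ?iS'.
have aT := is_adjoint_sym (adjbP T).
rewrite ipBr -(phi_adj (flow_endo Px) aT) iS' (wint_ip wS wS') (wint_ip wS wS' xi).
by rewrite aT subrr.
Qed.

Lemma intertwiner_wint x S : P x -> intertwiner (alpha x) S -> wint x S.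
Proof. by move=> Px iS u xi; rewrite -(fweylV f)// iS. Qed.

Lemma wint_total x z : P x -> (forall S, wint x S -> forall u, ip (S u) z = 0) -> z = 0.
Proof.
move=> Px h; apply: (intertwiner_total (E0_separable (flowE f)) (flow_endo Px)) => S iS.
exact/h/intertwiner_wint.
Qed.

Lemma creation_exists x u : P x -> kerV x u ->
  exists S, wint x S /\ forall v, S (e v) = e (u + V x v).
Proof.
(* As u is orthogonal to the range of V_x, the map e(v) -> e(u + V_x v) multiplies inner products by
   exp(|u|^2); the factor [c] makes it isometric, hence extendable. *)
move=> Px ku; pose c : R := expR (- (sqnorm u / 2)).
have [v w||T iT TE] := @iso_ext _ F F _ e (fun v => c%:C *: e (u + V x v)).
- rewrite ipZl ipZr !(exp_ip WP) conjc_real ipDl !ipDr ku (kerV_ip _ ku) addr0 add0r.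
  rewrite cexpD ipuu cexp_real (V_isom Px) !mulrA -!real_complexM.
  have -> : c * c * expR (sqnorm u) = 1.
    by rewrite -!expRD (_ : _ + _ = 0) ?expR0//; field.
  by rewrite mul1r.
- exact: exp_total.
have SE v : bscale (c^-1)%:C T (e v) = e (u + V x v).
  by rewrite /= TE scalerA -real_complexM mulVf ?scale1r// gt_eqF// expR_gt0.
exists (bscale (c^-1)%:C T); split=> // v xi.
suff h : bcomp (bscale (c^-1)%:C T) (W v) = bcomp (W (V x v)) (bscale (c^-1)%:C T).
  by have := congr1 (fun B : bop F F => B xi) h.
apply: (bop_total_eq (@exp_total _ _ F)) => w.
rewrite -[LHS]/(bscale (c^-1)%:C T (W v (e w))) -[RHS]/(W _ (bscale (c^-1)%:C T (e w))).
by rewrite SE !WP bopZ SE ipDr ku add0r !(V_isom Px) bopD addrCA.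
Qed.

(** e(v + V_x v') is the image of e(v') under the creation intertwiner of v, and two intertwiners
    factor inner products by [wint_ip]. *)
Lemma wint_exp x S v v' g : P x -> wint x S -> kerV x v ->
  ip (e (v + V x v')) (S g) = ip (e v) (S (e 0)) * ip (e v') g.
Proof.
move=> Px wS kv; have [T [wT TE]] := creation_exists Px kv.
by rewrite -TE (wint_ip wS wT) TE bop0 addr0.
Qed.

(** The coefficient of t in [wint_exp] for t v and t v'. *)
Lemma wint_one x S v v' g : P x -> wint x S -> kerV x v ->
  ip (one_particle F (v + V x v')) (S g) =
  ip (e 0) (S (e 0)) * ip (one_particle F v') g + ip (one_particle F v) (S (e 0)) * ip (e 0) g.
Proof.
move=> Px wS kv; have key := first_order_mul (exp_first_order WP (v + V x v') (S g))
  (exp_first_order WP v (S (e 0))) (exp_first_order WP v' g).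
apply: key.
  by have := wint_exp 0 g Px wS (@kerV0 x); rewrite bop0 addr0.
by move=> t; rewrite scalerDr -bopZ wint_exp//; exact: kerVZ.
Qed.

Lemma wint_eq x S S' : P x -> wint x S -> wint x S' -> S (e 0) = S' (e 0) -> S = S'.
Proof.
move=> Px wS wS' h; apply: bopP => g; apply: (total_ip_eq (@exp_total _ _ F)) => v.
have [k [w [kk ->]]] := kerV_decomp v Px.
by rewrite !wint_exp// h.
Qed.

Lemma wint_comp x y S T : P x -> P y -> wint x S -> wint y T -> wint (x + y) (bcomp S T).
Proof. by move=> Px Py wS wT u xi /=; rewrite wT wS VD. Qed.

End flows.

(** * Divisible intertwiners create exponential vectors *)

Section products.
Variable R : realType.

(** Telescoping over the factors; bounds [M i] of at least 1 allow the full product of the bounds in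
    every term. *)
Lemma prod_dist n (x y : 'I_n -> R[i]) (M : 'I_n -> R) :
  (forall i, 1 <= M i) -> (forall i, cab (x i) <= M i) -> (forall i, cab (y i) <= M i) ->
  cab (\prod_i x i - \prod_i y i) <= (\sum_i cab (x i - y i)) * \prod_i M i.
Proof.
elim: n x y M => [|n IH] x y M M1 xM yM.
  by rewrite !big_ord0 subrr cab0 mul0r.
rewrite !big_ord_recl /=; set X := \prod_i _; set Y := \prod_i y _; set Q := \prod_i M _.
have {}IH : cab (X - Y) <= (\sum_i cab (x (lift ord0 i) - y (lift ord0 i))) * Q.
  by apply: IH.
have M0 i : 0 <= M i by rewrite (le_trans _ (M1 i)).
have XQ : cab X <= Q by rewrite cab_prod ler_prod// => i _; rewrite cab_ge0 xM.
have Q0 : 0 <= Q by rewrite prodr_ge0.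
have -> : x ord0 * X - y ord0 * Y = (x ord0 - y ord0) * X + y ord0 * (X - Y) by ring.
apply: le_trans (cabD _ _) _; rewrite !cabM mulrDl; apply: lerD.
  apply: ler_pM; rewrite ?cab_ge0//; apply: le_trans XQ _.
  by rewrite ler_peMl.
by rewrite mulrCA; apply: ler_pM; rewrite ?cab_ge0.
Qed.

Lemma sum_le_prod1D n (r : 'I_n -> R) : (forall i, 0 <= r i) ->
  1 + \sum_i r i <= \prod_i (1 + r i).
Proof.
elim: n r => [|n IH] r r0; first by rewrite !big_ord0 addr0.
rewrite !big_ord_recl /=; have := IH (fun i => r (lift ord0 i)) (fun i => r0 _).
have : 0 <= \sum_(i < n) r (lift ord0 i) by rewrite sumr_ge0.
set S := \sum_i _; set Q := \prod_i _ => S0 h; have := r0 ord0; nra.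
Qed.

Lemma prod_factor_bound n (x : 'I_n -> R[i]) (M : 'I_n -> R) i :
  (forall i, 1 <= M i) -> (forall i, cab (x i) <= M i) ->
  cab (\prod_i x i) <= cab (x i) * \prod_i M i.
Proof.
move=> M1 xM; rewrite (bigD1 i)//= cabM ler_wpM2l ?cab_ge0//.
rewrite cab_prod [leRHS](bigD1 i)//=.
have M0 j : 0 <= M j by rewrite (le_trans _ (M1 j)).
apply: (@le_trans _ _ (\prod_(j < n | j != i) M j)).
  by apply: ler_prod => j _; rewrite cab_ge0 xM.
by rewrite ler_peMl// prodr_ge0.
Qed.

Lemma factor_le_prod n (M : 'I_n -> R) i : (forall i, 1 <= M i) -> M i <= \prod_i M i.
Proof.
move=> M1; rewrite (bigD1 i)//= ler_peMr ?(le_trans _ (M1 i))//.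
elim/big_rec: _ => // j x _ x1; rewrite -[1]mulr1.
by apply: ler_pM => //; rewrite (le_trans _ x1).
Qed.

End products.

Section cexp_taylor.
Variables (R : realType) (H : hilbert R) (F : fock H) (W : H -> unitary F F).
Hypothesis Wweyl : is_weyl W.

(** The estimate is read off from Fock space: exp(z) - 1 - z is the inner product of the parts of
    e(u) and e(v) with at least two particles, for multiples u and v of [h] with inner product z and
    |u|^2 = |v|^2 = |z|. *)
Lemma cexp_taylor (h : H) (z : R[i]) : h != 0 ->
  cab (cexp z - 1 - z) <= cab z ^+ 2 * expR (cab z).
Proof.
move=> h0; have [->|z0] := eqVneq z 0.
  by rewrite cexp0 subrr subr0 cab0 expr0n mul0r.
have zp : 0 < cab z.
  by rewrite lt_neqAle cab_ge0 andbT eq_sym; apply: contra_neq z0 => /cab_eq0.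
have hp := nrm_gt0 h0; pose s := Num.sqrt (cab z).
have s0 : 0 < s by rewrite sqrtr_gt0.
have s2 : s ^+ 2 = cab z by rewrite sqr_sqrtr// ltW.
pose u := (s / nrm h)%:C *: h; pose v := (z * (s * nrm h)^-1%:C) *: h.
have uv : ip u v = z.
  rewrite ipZl ipZr conjc_real ipuu -sqr_nrm mulrCA -!mulrA -!real_complexM.
  rewrite (_ : _ * (_ * _) = 1) ?mulr1//; field.
  by rewrite !gt_eqF.
have nu : sqnorm u = cab z.
  rewrite sqnormZ cab_real ger0_norm ?divr_ge0 ?ltW//.
  by rewrite exprMn s2 exprVn sqr_nrm mulfVK// gt_eqF// sqnorm_gt0.
have nv : sqnorm v = cab z.
  rewrite sqnormZ cabM cab_real ger0_norm ?invr_ge0 ?mulr_ge0 ?(ltW s0) ?(ltW hp)//.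
  by rewrite -sqr_nrm -s2; field; rewrite !gt_eqF.
have -> : cexp z - 1 - z = ip (expvec F u - expvec F 0 - one_particle F u)
    (expvec F v - expvec F 0 - one_particle F v).
  rewrite !ipBl !ipBr !(exp_ip Wweyl) !exp_one [ip (one_particle F u) _]ipC exp_one.
  rewrite [ip (one_particle F u) (expvec F 0)]ipC exp_one one_one !ip0l !ip0r cexp0.
  by rewrite -ipC uv conjc0; ring.
apply: le_trans (cauchy_schwarz _ _) _.
have := two_more_le Wweyl u; have := two_more_le Wweyl v; rewrite nu nv => hv hu.
have := ler_pM (nrm_ge0 _) (nrm_ge0 _) hu hv; congr (_ <= _).
by rewrite mulrACA -expRD -splitr.
Qed.

End cexp_taylor.

Section divisible.
Variables (R : realType) (d : nat) (P : set 'rV[R]_d) (cP : is_cone P).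
Variables (H : hilbert R) (V : 'rV[R]_d -> bop H H) (F : fock H) (f : flow P V F).
Local Notation e := (expvec F).
Local Notation one := (one_particle F).
Local Notation WP := (fweylP f).

Fixpoint prodS (S : nat -> bop F F) n : bop F F :=
  if n is m.+1 then bcomp (S 0%N) (prodS (S \o succn) m) else bid F.

Section one_step.
Variables (y : 'rV[R]_d) (Py : P y).
Let A := adjb (V y).
Let Vy_iso := V_isom f Py.

Definition tailV k v := iter k A v.
(** The vector v is the sum of the V_y^i (pieceV i v) for i < k and of V_y^k (tailV k v), where the
    tails are iterates of the adjoint of V_y. Each piece is orthogonal to the range of V_y. *)
Definition pieceV k v := tailV k v - V y (A (tailV k v)).

Lemma adjVK u : A (V y u) = u.
Proof. by apply: ip_eqP => w; rewrite -(adjbP (V y)) Vy_iso. Qed.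

Lemma piece_ker k v : kerV V y (pieceV k v).
Proof. by move=> w; rewrite ipBr Vy_iso (adjbP (V y)) subrr. Qed.

Lemma adjV_contract u : nrm (A u) <= nrm u.
Proof.
have := cauchy_schwarz (A u) (A u); have -> : ip (A u) (A u) = ip (V y (A u)) u.
  by rewrite (adjbP (V y)).
move=> _; have h := cauchy_schwarz (V y (A u)) u.
rewrite (adjbP (V y)) ipuu cab_real ger0_norm ?sqnorm_ge0// -sqr_nrm (isom_nrm _ Vy_iso) in h.
have [->|/nrm_gt0 p] := eqVneq (A u) 0; first by rewrite nrm0 nrm_ge0.
by move: h; rewrite expr2 ler_pM2l.
Qed.

Lemma tailV_contract k v : nrm (tailV k v) <= nrm v.
Proof. by elim: k => //= k IH; apply: le_trans (adjV_contract _) IH. Qed.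

Lemma sqnorm_piece k v : sqnorm (pieceV k v) = sqnorm (tailV k v) - sqnorm (tailV k.+1 v).
Proof.
rewrite sqnormB -[sqnorm (V y _)]sqr_nrm (isom_nrm _ Vy_iso) sqr_nrm.
rewrite ipC cReJ (adjbP (V y)) -/(sqnorm (A (tailV k v))) /=; ring.
Qed.

Lemma sum_piece k v : \sum_(i < k) sqnorm (pieceV i v) = sqnorm v - sqnorm (tailV k v).
Proof.
elim: k => [|k IH]; first by rewrite big_ord0 subrr.
by rewrite big_ord_recr /= IH sqnorm_piece; ring.
Qed.

Lemma sum_piece_le k v : \sum_(i < k) sqnorm (pieceV i v) <= sqnorm v.
Proof. by rewrite sum_piece lerBlDr lerDl sqnorm_ge0. Qed.

(** The squared norm of a piece is a^2 - b^2 for the norms a, b of consecutive tails, and a - b <=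
    |V_y v - v| since tails contract. The bound is uniform in k. *)
Lemma piece_small k v : sqnorm (pieceV k v) <= 2 * nrm v * nrm (V y v - v).
Proof.
have t1 := tailV_contract k v; have t2 := tailV_contract k.+1 v.
have tB a b : tailV k (a - b) = tailV k a - tailV k b.
  by elim: (k) => //= m ->; rewrite bopB.
have h : nrm (tailV k v) <= nrm (tailV k.+1 v) + nrm (V y v - v).
  apply: le_trans (nrm_le_sub _ (tailV k.+1 v)) _; rewrite lerD2l.
  rewrite [tailV k.+1 v]iterSr -tB; apply: le_trans (tailV_contract _ _) _.
  by rewrite -{1}[v]adjVK -bopB adjV_contract.
rewrite sqnorm_piece -!sqr_nrm.
have := nrm_ge0 (tailV k v); have := nrm_ge0 (tailV k.+1 v); have := nrm_ge0 v.
have := nrm_ge0 (V y v - v); move: t1 t2 h.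
move: (nrm (tailV k v)) (nrm (tailV k.+1 v)) (nrm v) (nrm (V y v - v)) => a b c x.
move=> ac bc abx x0 c0 b0 a0; have [ab|ba] := lerP a b.
  have : a ^+ 2 <= b ^+ 2 by rewrite ler_pXn2r ?nnegrE.
  have : 0 <= 2 * c * x by rewrite !mulr_ge0.
  lra.
have -> : a ^+ 2 - b ^+ 2 = (a + b) * (a - b) by ring.
by apply: ler_pM; lra.
Qed.

Lemma piece_le k v : nrm (pieceV k v) <= nrm v.
Proof.
rewrite -(@ler_pXn2r _ 2) ?nnegrE ?nrm_ge0// !sqr_nrm sqnorm_piece.
have := sqnorm_ge0 (tailV k.+1 v).
have : sqnorm (tailV k v) <= sqnorm v.
  by rewrite -!sqr_nrm ler_pXn2r ?nnegrE ?nrm_ge0// tailV_contract.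
lra.
Qed.

Lemma prodS_exp S n v g : (forall i, (i < n)%N -> wint f y (S i)) ->
  ip (e v) (prodS S n g) = (\prod_(i < n) ip (e (pieceV i v)) (S i (e 0))) * ip (e (tailV n v)) g.
Proof.
elim: n S v => [|n IH] S v wS; first by rewrite big_ord0 mul1r.
rewrite big_ord_recl -mulrA /= -{1}[v](subrK (V y (A v))).
rewrite (wint_exp _ _ Py (wS 0%N (ltn0Sn _)) (piece_ker 0 v)); congr (_ * _).
rewrite IH; last by move=> i ni; exact: wS.
rewrite /tailV -iterSr; congr (_ * _); apply: eq_bigr => i _.
by rewrite /pieceV /tailV -iterSr.
Qed.

(** Iterating [wint_one] differentiates the product in [prodS_exp]; the result is written as a
    logarithmic derivative, with nonzero vacuum coefficients as denominators. *)
Lemma prodS_one S n v : (forall i, (i < n)%N -> wint f y (S i)) ->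
  (forall i, (i < n)%N -> ip (e 0) (S i (e 0)) != 0) ->
  ip (one v) (prodS S n (e 0)) = (\prod_(i < n) ip (e 0) (S i (e 0))) *
    \sum_(i < n) ip (one (pieceV i v)) (S i (e 0)) / ip (e 0) (S i (e 0)).
Proof.
elim: n S v => [|n IH] S v wS nS.
  by rewrite !big_ord0 mul1r ipC exp_one ip0l conjc0.
rewrite !big_ord_recl /= -{1}[v](subrK (V y (A v))).
rewrite (wint_one _ _ Py (wS 0%N (ltn0Sn _)) (piece_ker 0 v)).
rewrite IH; [|by move=> i ni; exact: wS|by move=> i ni; exact: nS].
have -> : ip (e 0) (prodS (S \o succn) n (e 0)) = \prod_(i < n) ip (e 0) (S i.+1 (e 0)).
  rewrite prodS_exp; last by move=> i ni; exact: wS.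
  have t0 k : tailV k 0 = 0 by elim: k => //= k; rewrite /tailV => ->; rewrite bop0.
  rewrite t0 (exp_ip WP) ip0l cexp0 mulr1; apply: eq_bigr => i _.
  by rewrite /pieceV t0 !bop0 subr0.
have -> : \sum_(i < n) ip (one (pieceV i (A v))) ((S \o succn) i (e 0)) /
    ip (e 0) ((S \o succn) i (e 0)) =
    \sum_(i < n) ip (one (pieceV (bump 0 i) v)) (S (bump 0 i) (e 0)) / ip (e 0) (S (bump 0 i) (e 0)).
  by apply: eq_bigr => i _; rewrite /pieceV /tailV -!iterSr.
have n0 := nS 0%N (ltn0Sn n).
rewrite [in RHS]mulrDr [X in _ = X + _]mulrCA -/(pieceV 0 v) /=.
set c := ip (e 0) (S 0%N (e 0)) in n0 *; set a := ip (one _) (S 0%N (e 0)).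
set s := \sum_(i < n) _; set q := \prod_(i < n) ip (e 0) (S (bump 0 i) (e 0)).
by field.
Qed.

Lemma wint_sqnorm S g : wint f y S -> sqnorm (S g) = sqnorm (S (e 0)) * sqnorm g.
Proof.
by move=> wS; rewrite {1}/sqnorm (wint_ip wS wS) !ipuu -real_complexM.
Qed.

Lemma prodS_nrm S n : (forall i, (i < n)%N -> wint f y (S i)) ->
  sqnorm (prodS S n (e 0)) = \prod_(i < n) sqnorm (S i (e 0)).
Proof.
elim: n S => [|n IH] S wS; first by rewrite big_ord0 (exp_sqnorm WP) sqnorm0 expR0.
rewrite big_ord_recl /= wint_sqnorm; last exact: (wS 0%N).
by congr (_ * _); rewrite IH// => i ni; exact: wS.
Qed.

End one_step.

(** Vacuum norms of intertwiners multiply, so the lower bound 1 keeps the norm of every single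
    factor below that of the product. *)
Definition divisible x (T : bop F F) := forall n, exists S : nat -> bop F F,
  [/\ forall i, (i < n.+1)%N -> wint f ((n.+1%:R)^-1 *: x) (S i),
      forall i, (i < n.+1)%N -> 1 <= nrm (S i (e 0))
    & T = prodS S n.+1].

Variables (x : 'rV[R]_d) (Px : P x).
Local Notation sub n := ((n.+1%:R : R)^-1 *: x).

Lemma Psub n : P (sub n).
Proof. by apply: coneZ => //; rewrite invr_ge0. Qed.

Lemma mesh_small v (r : R) : 0 < r -> exists n, forall k, nrm (pieceV (sub n) k v) <= r.
Proof.
move=> r0; have v1 : 0 < 2 * nrm v + 1 by have := nrm_ge0 v; lra.
have [s s0 hs] := V_cont cP f v (divr_gt0 (exprn_gt0 2 r0) v1).
have x1 : 0 < `|x| + 1 by rewrite ltr_wpDl.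
have [n hn] := natSinv_lt (divr_gt0 s0 x1).
exists n => k; rewrite -(@ler_pXn2r _ 2) ?nnegrE ?nrm_ge0 ?(ltW r0)// sqr_nrm.
apply: le_trans (piece_small (Psub n) k v) _.
have : nrm (V (sub n) v - v) < r ^+ 2 / (2 * nrm v + 1).
  apply: hs; first exact: Psub.
  rewrite normrZ ger0_norm ?invr_ge0//; have := hn n (leqnn n).
  rewrite ltr_pdivlMr// => h; apply: le_lt_trans h.
  by rewrite ler_wpM2l ?invr_ge0// lerDl.
rewrite ltr_pdivlMr// => /ltW h; apply: le_trans h; rewrite mulrC.
by rewrite ler_wpM2l ?nrm_ge0// lerDl.
Qed.

Variable T : bop F F.
Hypothesis divT : divisible x T.

Lemma divisible_nrm_ge1 : 1 <= nrm (T (e 0)).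
Proof.
have [S [wS S1 ->]] := divT 0; rewrite -(@ler_pXn2r _ 2) ?nnegrE ?nrm_ge0//.
rewrite expr1n sqr_nrm (prodS_nrm wS) big_ord1 -sqr_nrm.
by rewrite -[1](expr1n _ 2) ler_pXn2r ?nnegrE ?nrm_ge0// S1.
Qed.

Lemma piece0 y k : pieceV y k 0 = 0.
Proof.
have t0 : tailV y k 0 = 0 by rewrite /tailV; elim: k => //= k ->; rewrite bop0.
by rewrite /pieceV t0 !bop0 subr0.
Qed.

Lemma divisible_exp n S v : (forall i, (i < n.+1)%N -> wint f (sub n) (S i)) ->
  T = prodS S n.+1 -> ip (e v) (T (e 0)) = \prod_(i < n.+1) ip (e (pieceV (sub n) i v)) (S i (e 0)).
Proof. by move=> wS ->; rewrite (prodS_exp (Psub n))// (exp_ip WP) ip0r cexp0 mulr1. Qed.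

Lemma nrm_exp u : nrm (e u) = expR (sqnorm u / 2).
Proof.
apply/eqP; rewrite -(@eqrXn2 _ 2)// ?nrm_ge0 ?expR_ge0// sqr_nrm (exp_sqnorm WP).
by rewrite -expRM_natl; apply/eqP; congr expR; field.
Qed.

Lemma nrm_exp_ge1 u : 1 <= nrm (e u).
Proof. by rewrite nrm_exp -expR0 ler_expR divr_ge0 ?sqnorm_ge0. Qed.

(** Some coefficient p at an e(v) is nonzero. If one factor had vacuum coefficient 0, its
    coefficient at a short piece of v would be tiny, while the other factors are bounded
    independently of the subdivision; p would be too small. *)
Lemma divisible_vacuum : ip (e 0) (T (e 0)) != 0.
Proof.
have T1 := divisible_nrm_ge1; have [v pv] : exists v, ip (e v) (T (e 0)) != 0.
  apply: contrapT => h; move: T1; rewrite (@exp_total _ _ F (T (e 0))) ?nrm0 ?ler10// => v.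
  by apply/eqP; apply/negP => /negP pv; apply: h; exists v.
set p := ip _ _ in pv; have pp : 0 < cab p.
  by rewrite lt_neqAle cab_ge0 andbT eq_sym; apply: contra_neq pv => /cab_eq0.
pose B := expR (sqnorm v / 2) * nrm (T (e 0)).
have B0 : 0 < B by rewrite mulr_gt0 ?expR_gt0// (lt_le_trans _ T1).
(* With pieces of norm at most |p| / (2 B^2), a factor of zero vacuum coefficient contributes at
   most |p| / (2 B), whereas [pi] below demands at least |p| / B. *)
have [n small] := mesh_small v (divr_gt0 (divr_gt0 pp B0) (mulr_gt0 (ltr0Sn R 1) B0)).
have [S [wS S1 TE]] := divT n.
pose M i := nrm (e (pieceV (sub n) i v)) * nrm (S i (e 0)).
have M1 (i : 'I_n.+1) : 1 <= M i.
  by rewrite -[1]mulr1 ler_pM// ?nrm_exp_ge1 ?S1.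
have PS : \prod_(i < n.+1) nrm (S i (e 0)) = nrm (T (e 0)).
  apply/eqP; rewrite -(@eqrXn2 _ 2)// ?nrm_ge0 ?prodr_ge0//; last by move=> *; exact: nrm_ge0.
  rewrite TE sqr_nrm (prodS_nrm wS) -prodrXl; apply/eqP.
  by apply: eq_bigr => i _; rewrite sqr_nrm.
have PM : \prod_(i < n.+1) M i <= B.
  rewrite big_split /= PS ler_wpM2r ?nrm_ge0//.
  under eq_bigr do rewrite nrm_exp.
  rewrite -expR_sum ler_expR -mulr_suml ler_pM2r//; exact: (sum_piece_le (Psub n)).
rewrite (divisible_exp 0 wS TE); apply/prodf_neq0 => i _; rewrite piece0.
have pi : cab p <= cab (ip (e (pieceV (sub n) i v)) (S i (e 0))) * B.
  rewrite {1}/p (divisible_exp v wS TE).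
  apply: le_trans (@prod_factor_bound _ _ _ M i _ _) _ => //.
    by move=> j; exact: cauchy_schwarz.
  by rewrite ler_wpM2l ?cab_ge0.
apply/eqP => w0; move: pi; apply/negP; rewrite -ltNge -ltr_pdivlMr//.
have -> : ip (e (pieceV (sub n) i v)) (S i (e 0)) =
    ip (e (pieceV (sub n) i v) - e 0) (S i (e 0)) by rewrite ipBl w0 subr0.
apply: le_lt_trans (cauchy_schwarz _ _) _.
have h1 := exp_sub0_le WP (pieceV (sub n) i v).
have h2 : expR (sqnorm (pieceV (sub n) i v) / 2) <= expR (sqnorm v / 2).
  rewrite ler_expR ler_pM2r// -!sqr_nrm ler_pXn2r ?nnegrE ?nrm_ge0//.
  exact: (piece_le (Psub n)).
have h3 : nrm (S i (e 0)) <= nrm (T (e 0)).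
  by rewrite -PS; apply: (@factor_le_prod _ _ (fun i : 'I_n.+1 => nrm (S i (e 0)))) => j; exact: S1.
apply: (@le_lt_trans _ _ (cab p / B / (2 * B) * B)).
  rewrite /B mulrA; apply: ler_pM; rewrite ?nrm_ge0//.
  apply: le_trans h1 _; apply: ler_pM; rewrite ?nrm_ge0 ?expR_ge0//; exact: small.
have -> : cab p / B / (2 * B) * B = cab p / B / 2 by field; rewrite gt_eqF.
have : 0 < cab p / B by rewrite divr_gt0.
lra.
Qed.

Let w0 := divisible_vacuum.
Let G := (ip (e 0) (T (e 0)))^-1 *: T (e 0).

(** With factors [f_ i] of vacuum coefficient 1, the left side is the product of the [X i] and the
    exponent is the sum of the [a i]. Here X_i - exp(a_i) has order |v_i|^2 rho_i, and both the
    |v_i|^2 and the rho_i^2 have bounded sums, so a spare factor |v_i| <= m makes the total error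
    O(m). *)
Lemma divisible_char v : ip (e v) G = cexp (ip (one v) G).
Proof.
apply/subr0_eq; apply: cab_eq0; apply: small_eq0; first exact: cab_ge0.
move=> r r0; pose C := sqnorm G; have C0 : 0 <= C by exact: sqnorm_ge0.
pose r2 := sqnorm v; have r20 : 0 <= r2 by exact: sqnorm_ge0.
(* m K bounds the sum of the errors of the factors, and [M0] bounds the product of the [M i]; the
   error of the product is at most m K M0 < r. *)
pose K := expR (r2 / 2) * (r2 + C) + nrm v * C * expR (r2 + C).
pose M0 := expR ((r2 + C) / 2).
have K0 : 0 <= K by rewrite addr_ge0 ?mulr_ge0 ?expR_ge0 ?nrm_ge0 ?addr_ge0.
have KM : 0 < K * M0 + 1 by rewrite ltr_wpDl// mulr_ge0 ?expR_ge0.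
have [n small] := mesh_small v (divr_gt0 r0 KM).
set m := r / (K * M0 + 1) in small; have m0 : 0 < m by rewrite divr_gt0.
have [S [wS S1 TE]] := divT n.
pose vv (i : 'I_n.+1) := pieceV (sub n) i v.
pose w (i : 'I_n.+1) := ip (e 0) (S i (e 0)).
have wE : ip (e 0) (T (e 0)) = \prod_i w i.
  by rewrite (divisible_exp 0 wS TE); apply: eq_bigr => i _; rewrite piece0.
have wn i : w i != 0.
  by move: w0; rewrite wE => /prodf_neq0; apply.
pose f_ i := (w i)^-1 *: S i (e 0).
have f1 i : ip (e 0) (f_ i) = 1 by rewrite ipZr mulVf.
pose a i := ip (one (vv i)) (f_ i); pose X i := ip (e (vv i)) (f_ i).
have XE : ip (e v) G = \prod_i X i.
  rewrite ipZr (divisible_exp v wS TE) wE -prodfV -big_split /=.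
  by apply: eq_bigr => i _; rewrite /X ipZr.
have aE : ip (one v) G = \sum_i a i.
  rewrite ipZr {2}TE (prodS_one (Psub n))//; last first.
    by move=> i ni; exact: (wn (Ordinal ni)).
  rewrite wE (_ : \prod_(i < n.+1) ip (e 0) (S i (e 0)) = \prod_i w i)//.
  rewrite mulKf; last by apply/prodf_neq0 => i _; exact: wn.
  by apply: eq_bigr => i _; rewrite /a ipZr mulrC.
pose rho i := nrm (f_ i - e 0).
have rhoE i : sqnorm (f_ i) = 1 + rho i ^+ 2.
  rewrite sqr_nrm sqnormB (exp_sqnorm WP) sqnorm0 expR0 ipC f1 cReJ /=; ring.
(* Vacuum norms multiply, so the squared norm of G fixes the product of the 1 + rho_i^2, and hence
   bounds the sum of the rho_i^2 uniformly in n. *)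
have CE : C = \prod_i (1 + rho i ^+ 2).
  rewrite /C /G sqnormZ cabV wE cab_prod TE (prodS_nrm wS).
  rewrite -prodfV -prodrXl -big_split /=; apply: eq_bigr => i _.
  by rewrite -rhoE /f_ sqnormZ cabV.
have rhoC : \sum_i rho i ^+ 2 <= C.
  have := @sum_le_prod1D _ _ (fun i => rho i ^+ 2) (fun i => sqr_ge0 _); rewrite -CE; lra.
have sv : \sum_i nrm (vv i) ^+ 2 <= r2.
  have := sum_piece_le (Psub n) n.+1 v; congr (_ <= _).
  by apply: eq_bigr => i _; rewrite sqr_nrm.
pose M i := expR ((nrm (vv i) ^+ 2 + rho i ^+ 2) / 2).
have aM i : cab (a i) <= nrm (vv i) * rho i.
  have -> : a i = ip (one (vv i)) (f_ i - e 0).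
    by rewrite ipBr [ip _ (e 0)]ipC exp_one ip0l conjc0 subr0.
  apply: le_trans (cauchy_schwarz _ _) _; rewrite ler_wpM2r ?nrm_ge0//.
  by rewrite /nrm /sqnorm one_one.
have prodle i : nrm (vv i) * rho i <= (nrm (vv i) ^+ 2 + rho i ^+ 2) / 2.
  by have := sqr_ge0 (nrm (vv i) - rho i); rewrite sqrrB mulr2n; lra.
have nX i : cab (X i) <= M i.
  apply: le_trans (cauchy_schwarz _ _) _; rewrite /M mulrDl expRD nrm_exp sqr_nrm.
  rewrite ler_wpM2l ?expR_ge0// -(@ler_pXn2r _ 2) ?nnegrE ?nrm_ge0 ?expR_ge0//.
  rewrite sqr_nrm rhoE -expRM_natl (_ : 2%:R * _ = rho i ^+ 2); last by field.
  exact: expR_ge1Dx.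
have nY i : cab (cexp (a i)) <= M i.
  rewrite cab_cexp ler_expR; apply: le_trans (Re_le_cab _) _.
  exact: le_trans (aM i) (prodle i).
have M1 i : 1 <= M i.
  by rewrite -expR0 ler_expR divr_ge0// addr_ge0// sqr_ge0.
have dXY i : cab (X i - cexp (a i)) <=
    expR (r2 / 2) * (nrm (vv i) ^+ 2 * rho i) + nrm (vv i) ^+ 2 * rho i ^+ 2 * expR (r2 + C).
  have -> : X i - cexp (a i) = (X i - 1 - a i) - (cexp (a i) - 1 - a i) by ring.
  apply: le_trans (cabB _ _) _; apply: lerD.
    have -> : X i - 1 - a i = ip (e (vv i) - e 0 - one (vv i)) (f_ i - e 0).
      rewrite !ipBr !ipBl f1 (exp_ip WP) ip0r cexp0 (exp_ip WP) ip0r cexp0.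
      by rewrite [ip (one _) (e 0)]ipC exp_one ip0l conjc0; ring.
    apply: le_trans (cauchy_schwarz _ _) _; rewrite mulrA ler_wpM2r ?nrm_ge0//.
    apply: le_trans (two_more_le WP _) _; rewrite mulrC sqr_nrm ler_wpM2r ?sqnorm_ge0//.
    rewrite ler_expR ler_pM2r// /r2 -!sqr_nrm ler_pXn2r ?nnegrE ?nrm_ge0//.
    exact: (piece_le (Psub n)).
  have [v0|v0] := eqVneq (vv i) 0.
    have a0 : a i = 0.
      by apply: cab_eq0; apply/eqP; rewrite eq_le cab_ge0 andbT (le_trans (aM i))// v0 nrm0 mul0r.
    rewrite a0 cexp0 subrr subr0 cab0 !mulr_ge0 ?expR_ge0 ?sqr_ge0 ?nrm_ge0//.
  apply: le_trans (cexp_taylor WP _ v0) _; rewrite -exprMn; apply: ler_pM.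
  - exact: sqr_ge0.
  - exact: expR_ge0.
  - by rewrite ler_pXn2r ?nnegrE ?cab_ge0 ?mulr_ge0 ?nrm_ge0.
  rewrite ler_expR; apply: le_trans (aM i) _; apply: le_trans (prodle i) _.
  have : rho i ^+ 2 <= C.
    by apply: le_trans rhoC; rewrite (bigD1 i)//= lerDl sumr_ge0// => j _; exact: sqr_ge0.
  have : nrm (vv i) ^+ 2 <= r2.
    by apply: le_trans sv; rewrite (bigD1 i)//= lerDl sumr_ge0// => j _; exact: sqr_ge0.
  by move: C0 r20; lra.
have sumd : \sum_i cab (X i - cexp (a i)) <= m * K.
  apply: le_trans (ler_sum _ (fun i _ => dXY i)) _.
  rewrite big_split /= -mulr_sumr -mulr_suml /K mulrDr; apply: lerD.
    rewrite mulrCA; apply: ler_wpM2l; first exact: expR_ge0.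
    apply: (@le_trans _ _ (\sum_i m * ((nrm (vv i) ^+ 2 + rho i ^+ 2) / 2))).
      apply: ler_sum => i _; rewrite expr2 -mulrA; apply: ler_pM; rewrite ?mulr_ge0 ?nrm_ge0//.
      exact: small.
    rewrite -mulr_sumr -mulr_suml big_split /=; apply: ler_wpM2l; first exact: ltW.
    by move: C0 r20 sv rhoC; lra.
  rewrite mulrA; apply: ler_wpM2r; first exact: expR_ge0.
  rewrite mulrA; apply: (@le_trans _ _ (\sum_i m * nrm v * rho i ^+ 2)).
    apply: ler_sum => i _; apply: ler_wpM2r; first exact: sqr_ge0.
    rewrite expr2; apply: ler_pM; rewrite ?nrm_ge0//; first exact: small.
    exact: (piece_le (Psub n)).
  by rewrite -mulr_sumr ler_wpM2l// mulr_ge0 ?nrm_ge0// ltW.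
have prodM : \prod_i M i <= M0.
  rewrite /M -expR_sum ler_expR -mulr_suml ler_pM2r// big_split /=; exact: lerD.
rewrite XE aE (big_morph (@cexp R) (@cexpD R) (cexp0 R)).
apply: le_trans (prod_dist M1 nX nY) _.
apply: (@le_trans _ _ (m * K * M0)).
  apply: ler_pM => //; first by rewrite sumr_ge0// => i _; exact: cab_ge0.
  by rewrite prodr_ge0// => i _; exact: expR_ge0.
have : m * (K * M0 + 1) = r by rewrite /m divfK// gt_eqF.
by rewrite -mulrA; lra.
Qed.

Hypothesis wT : wint f x T.

(** The linear term in [divisible_char] is represented by a vector g, and totality of the
    exponential vectors gives G = e(g). *)
Lemma decomposable_exp : exists c w, [/\ c != 0, kerV V x w & T (e 0) = c *: e w].
Proof.
have [||g gP] := @riesz _ _ (fun v => ip G (one v)) (nrm G).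
- by move=> b u v; rewrite one_particleD one_particleZ ipDr ipZr.
- move=> u; apply: le_trans (cauchy_schwarz _ _) _.
  by rewrite ler_wpM2l ?nrm_ge0// /nrm /sqnorm one_one.
have Ge : G = e g.
  apply: (total_ip_eq (@exp_total _ _ F)) => v.
  by rewrite divisible_char (exp_ip WP) ipC gP -ipC.
exists (ip (e 0) (T (e 0))), g; split => //; last first.
  by rewrite -Ge /G scalerA mulfV ?scale1r.
(* By [wint_exp] with first argument 0, the coefficient of T e(0) at e(V_x (t u)) is its vacuum
   coefficient; hence exp(t ip (V x u) g) = 1 for all real t. *)
move=> u; apply: cexp_line => t; rewrite mulr0 cexp0.
have -> : t%:C * ip (V x u) g = ip (V x (t%:C *: u)) g by rewrite bopZ ipZl conjc_real.
rewrite -(exp_ip WP) -Ge ipZr -[V x _]add0r (wint_exp _ _ Px wT (kerV0 V x)).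
by rewrite (exp_ip WP) ip0r cexp0 mulr1 mulVf.
Qed.

End divisible.

(** * The one-particle isometry of a correspondence of intertwiners *)

Section creation_division.
Variables (R : realType) (d : nat) (P : set 'rV[R]_d) (cP : is_cone P).
Variables (H : hilbert R) (V : 'rV[R]_d -> bop H H) (F : fock H) (f : flow P V F).
Local Notation e := (expvec F).

Definition creates x u (S : bop F F) :=
  wint f x S /\ forall v, S (e v) = e (u + V x v).

Lemma creates_uniq x u S S' : creates x u S -> creates x u S' -> S = S'.
Proof.
move=> [_ h] [_ h']; apply: (bop_total_eq (@exp_total _ _ F)) => v.
by rewrite h h'.
Qed.

Lemma creates_comp x y u v S T : P x -> P y -> creates x u S -> creates y v T ->
  creates (x + y) (u + V x v) (bcomp S T).
Proof.
move=> Px Py [wS hS] [wT hT]; split; first exact: wint_comp.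
by move=> w /=; rewrite hT hS bopD (VD cP f)// addrA.
Qed.

Variables (y : 'rV[R]_d) (Py : P y).

Lemma PsubZ k : P (k%:R *: y).
Proof. exact: coneZ. Qed.

Lemma iterV k u : iter k (V y) u = V (k%:R *: y) u.
Proof.
elim: k => [|k IH]; first by rewrite scale0r (V0 cP f).
by rewrite iterS IH -(VD cP f _ Py (PsubZ k)) -{1}[y]scale1r -scalerDl -natr1 addrC.
Qed.

Lemma tailV_eq0 k u : kerV V (k%:R *: y) u -> tailV V y k u = 0.
Proof.
move=> ku; apply: ip_eq0P => w; rewrite -(ku w) -iterV.
elim: k w u {ku} => //= k IH w u.
by rewrite -(adjbP (V y)) IH -iterSr.
Qed.

Lemma prodS_creates S k u : (forall i, (i < k)%N -> creates y (pieceV V y i u) (S i)) ->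
  forall v, prodS S k (e v) = e (u - iter k (V y) (tailV V y k u) + iter k (V y) v).
Proof.
elim: k S u => [|k IH] S u hS v; first by rewrite /= subrr add0r.
rewrite /= (IH _ (adjb (V y) u)); last first.
  by move=> i ki; have := hS i.+1 ki; rewrite /pieceV /tailV iterSr.
rewrite (hS 0%N (ltn0Sn _)).2 /pieceV /= !bopD bopN /tailV -iterSr /=.
by congr e; rewrite !addrA subrK.
Qed.

Lemma wint_prodS S k : (forall i, (i < k.+1)%N -> wint f y (S i)) ->
  wint f (k.+1%:R *: y) (prodS S k.+1).
Proof.
elim: k S => [|k IH] S wS.
  by rewrite scale1r => u xi /=; rewrite (wS 0%N (ltn0Sn _)).
have -> : k.+2%:R *: y = y + k.+1%:R *: y by rewrite -nat1r scalerDl scale1r.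
apply: (wint_comp cP Py (PsubZ _) (wS 0%N (ltn0Sn _))); apply: IH => i ki; exact: wS.
Qed.

End creation_division.

Section theta.
Variables (R : realType) (d : nat) (P : set 'rV[R]_d) (cP : is_cone P).
Variables (H1 H2 : hilbert R) (V1 : 'rV[R]_d -> bop H1 H1) (V2 : 'rV[R]_d -> bop H2 H2).
Variables (F1 : fock H1) (F2 : fock H2) (f1 : flow P V1 F1) (f2 : flow P V2 F2).
Variable theta : 'rV[R]_d -> bop F1 F1 -> bop F2 F2.
Hypothesis theta_wint : forall x S, P x -> wint f1 x S -> wint f2 x (theta x S).
Hypothesis thetaM : forall x y S T, P x -> P y -> wint f1 x S -> wint f1 y T ->
  theta (x + y) (bcomp S T) = bcomp (theta x S) (theta y T).
Hypothesis theta_ip : forall x S S', P x -> wint f1 x S -> wint f1 x S' ->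
  ip (theta x S' (expvec F2 0)) (theta x S (expvec F2 0)) =
  ip (S' (expvec F1 0)) (S (expvec F1 0)).
Local Notation e1 := (expvec F1).
Local Notation e2 := (expvec F2).
Local Notation WP1 := (fweylP f1).
Local Notation WP2 := (fweylP f2).

Lemma theta_prodS y S k : P y -> (forall i, (i < k.+1)%N -> wint f1 y (S i)) ->
  theta (k.+1%:R *: y) (prodS S k.+1) = prodS (fun i => theta y (S i)) k.+1.
Proof.
move=> Py; elim: k S => [|k IH] S wS.
  rewrite scale1r /=; have -> : bcomp (S 0%N) (bid F1) = S 0%N by exact: bopP.
  exact: bopP.
have -> : k.+2%:R *: y = y + k.+1%:R *: y by rewrite -nat1r scalerDl scale1r.
rewrite -[prodS S k.+2]/(bcomp (S 0%N) (prodS (S \o succn) k.+1)).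
rewrite (thetaM Py (PsubZ cP Py _) (wS 0%N (ltn0Sn _))); last first.
  by apply: (wint_prodS cP Py) => i ki; exact: wS.
by rewrite IH// => i ki; exact: wS.
Qed.

(** The creation intertwiner of u is the product of those of its n + 1 pieces along x / (n + 1).
    Their images have vacuum norm at least 1, since [theta] preserves it and exponential vectors
    have norm at least 1. *)
Lemma theta_divisible x u S : P x -> kerV V1 x u -> creates f1 x u S ->
  divisible f2 x (theta x S).
Proof.
move=> Px ku cS n; set y := n.+1%:R^-1 *: x.
have Py : P y by exact: Psub.
have yx : n.+1%:R *: y = x by rewrite scalerA mulfV ?scale1r// pnatr_eq0.
have [s sP] := choice (fun i => creation_exists f1 Py (piece_ker f1 Py i u)).
have sC i : creates f1 y (pieceV V1 y i u) (s i) by exact: sP.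
have SE : S = prodS s n.+1.
  apply: (bop_total_eq (@exp_total _ _ F1)) => v.
  rewrite cS.2 (prodS_creates (f := f1) (y := y) (u := u))//.
  rewrite (tailV_eq0 cP f1 Py) ?yx// (iterV cP f1 Py) yx.
  by rewrite (iterV cP f1 Py) yx bop0 subr0.
exists (fun i => theta y (s i)); split.
- by move=> i _; apply: theta_wint => //; exact: (sC i).1.
- move=> i _; rewrite -(@ler_pXn2r _ 2) ?nnegrE ?nrm_ge0// expr1n sqr_nrm /sqnorm.
  rewrite (theta_ip Py (sC i).1 (sC i).1); have [_ ->] := sC i.
  by rewrite (exp_ip WP1) bop0 addr0 ipuu cexp_real /= -expR0 ler_expR sqnorm_ge0.
rewrite SE -[in LHS]yx theta_prodS// => i _; exact: (sC i).1.
Qed.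

Definition matches x u w := kerV V2 x w /\ exists c S,
  [/\ c != 0, creates f1 x u S & theta x S (e2 0) = c *: e2 w].

Lemma matches_exists x u : P x -> kerV V1 x u -> exists w, matches x u w.
Proof.
move=> Px ku; have [S cS] := creation_exists f1 Px ku.
have [c [w [c0 kw cw]]] := decomposable_exp cP Px (theta_divisible Px ku cS) (theta_wint Px cS.1).
by exists w; split=> //; exists c, S.
Qed.

Lemma matches_add x y u v w z t : P x -> P y -> matches x u w -> matches y v z ->
  matches (x + y) (u + V1 x v) t -> t = w + V2 x z.
Proof.
move=> Px Py [kw [c [S [c0 cS hS]]]] [kz [c' [T [c0' cT hT]]]] [kt [c'' [S' [c0'' cS' hS']]]].
have S'E : S' = bcomp S T by exact: (creates_uniq cS' (creates_comp cP Px Py cS cT)).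
move: hS'; rewrite S'E (thetaM Px Py cS.1 cT.1) /= hT bopZ.
have [B [wB BE]] := creation_exists f2 Px kw.
have -> : theta x S = bscale c B.
  apply: (wint_eq Px (theta_wint Px cS.1)).
    by move=> a xi /=; rewrite wB bopZ.
  by rewrite hS /= BE bop0 addr0.
rewrite /= BE scalerA => /esym h; exact: (exp_inj WP2 c0'' h).
Qed.

(** The scalars c, c', b are unknown. In the product of the (u, v) and (0, 0) coefficients divided
    by the (u, 0) and (0, v) ones they cancel, and the exponents combine to ip (w - z) (w' - z). *)
Lemma matches_gram x u v w w' z : P x -> kerV V1 x u -> kerV V1 x v ->
  matches x u w -> matches x v w' -> matches x 0 z ->
  cexp (ip (w - z) (w' - z)) = cexp (ip u v).
Proof.
move=> Px ku kv [kw [c [S [c0 cS hS]]]] [kw' [c' [S' [c0' cS' hS']]]] [kz [b [T [b0 cT hT]]]].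
have G a t a' t' S1 S2 p q : creates f1 x p S1 -> creates f1 x q S2 ->
    theta x S1 (e2 0) = a *: e2 t -> theta x S2 (e2 0) = a' *: e2 t' ->
    conjc a * a' * cexp (ip t t') = cexp (ip p q).
  move=> c1 c2 h1 h2; have := theta_ip Px c2.1 c1.1.
  by rewrite h1 h2 c1.2 c2.2 ipZl ipZr (exp_ip WP2) (exp_ip WP1) !bop0 !addr0 mulrA.
have h1 := G _ _ _ _ _ _ _ _ cS cS' hS hS'; have h2 := G _ _ _ _ _ _ _ _ cT cT hT hT.
have h3 := G _ _ _ _ _ _ _ _ cS cT hS hT; have h4 := G _ _ _ _ _ _ _ _ cT cS' hT hS'.
rewrite !ip0l ?ip0r cexp0 in h2 h3 h4.
have -> : ip (w - z) (w' - z) = (ip w w' + ip z z) + - (ip w z + ip z w').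
  by rewrite !ipBl !ipBr; ring.
apply: (mulIf (cexp_neq0 (ip w z + ip z w'))).
have K0 : conjc c * c' * (conjc b * b) != 0.
  by rewrite !mulf_neq0// conjc_eq0.
apply: (mulfI K0); rewrite -!cexpD subrK addrC.
rewrite !cexpD.
transitivity ((conjc c * c' * cexp (ip w w')) * (conjc b * b * cexp (ip z z))); first by ring.
rewrite h1 h2 mulr1.
transitivity (cexp (ip u v) * ((conjc c * b * cexp (ip w z)) * (conjc b * c' * cexp (ip z w')))); last by ring.
by rewrite h3 h4 !mulr1.
Qed.

Hypothesis pure1 : forall h, (forall x k, P x -> kerV V1 x k -> ip k h = 0) -> h = 0.

Lemma theta_isometry : exists U : bop H1 H2, [/\ isom U,
  forall x u, P x -> U (V1 x u) = V2 x (U u) &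
  forall x k, P x -> kerV V1 x k -> kerV V2 x (U k)].
Proof.
have pick (p : 'rV[R]_d * H1) : exists w, P p.1 -> kerV V1 p.1 p.2 -> matches p.1 p.2 w.
  have [[Px ku]|no] := pselect (P p.1 /\ kerV V1 p.1 p.2).
    by have [w hw] := matches_exists Px ku; exists w.
  by exists 0 => Px ku; case: no.
have [w0 wP0] := choice pick; pose w x u := w0 (x, u).
have wP x u : P x -> kerV V1 x u -> matches x u (w x u) by exact: (wP0 (x, u)).
(* The vector [w x 0] is the displacement of the vacuum at x; only differences from it can depend
   linearly on u. *)
pose dl x u := w x u - w x 0.
have dlE x u v : P x -> kerV V1 x u -> kerV V1 x v ->
    cexp (ip (dl x u) (dl x v)) = cexp (ip u v).
  by move=> Px ku kv; apply: (matches_gram Px ku kv) => //; apply: wP => //; exact: kerV0.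
have dlRe x u v : P x -> kerV V1 x u -> kerV V1 x v ->
    Re (ip (dl x u) (dl x v)) = Re (ip u v).
  move=> Px ku kv; apply: expR_inj; rewrite -!cab_cexp; congr cab; exact: dlE.
(* Moduli of exponentials give the real parts of inner products, and these suffice to expand |dl(t
   u) - t dl(u)|^2 to 0. Real homogeneity then feeds [cexp_line] in [dlip]. *)
have dlZ x u (t : R) : P x -> kerV V1 x u -> dl x (t%:C *: u) = t%:C *: dl x u.
  move=> Px ku; have kt := kerVZ t%:C ku; apply/subr0_eq/sqnorm_eq0.
  rewrite sqnormB sqnormZ ipZr cReZ dlRe// {1 2}/sqnorm !dlRe// !ipZl ipZr conjc_real.
  by rewrite !cReZ cab_real real_normK ?num_real//; ring.
have dlip x u v : P x -> kerV V1 x u -> kerV V1 x v -> ip (dl x u) (dl x v) = ip u v.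
  move=> Px ku kv; apply: cexp_line => t.
  have := dlE x (t%:C *: u) v Px (kerVZ t%:C ku) kv.
  by rewrite dlZ// !ipZl conjc_real.
have dlD x y u v : P x -> P y -> kerV V1 x u -> kerV V1 y v ->
    dl (x + y) (u + V1 x v) = dl x u + V2 x (dl y v).
  move=> Px Py ku kv; have Pxy := coneD cP Px Py.
  have h a b : kerV V1 x a -> kerV V1 y b -> w (x + y) (a + V1 x b) = w x a + V2 x (w y b).
    move=> ka kb; apply: (matches_add Px Py (wP _ _ Px ka) (wP _ _ Py kb)).
    exact: (wP _ _ Pxy (kerVD cP f1 Px Py ka kb)).
  rewrite /dl h//.
  have -> : w (x + y) 0 = w x 0 + V2 x (w y 0).
    by rewrite -h ?bop0 ?addr0//; exact: kerV0.
  by rewrite bopB opprD addrACA.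
have dl0 x : dl x 0 = 0 by rewrite /dl subrr.
(* Enlarging x does not change [dl x u]; so vectors taken at different x can be compared at x + y,
   and the maps for all x glue to one isometry. *)
have dlmono x y u : P x -> P y -> kerV V1 x u -> dl (x + y) u = dl x u.
  move=> Px Py ku; have := dlD x y u 0 Px Py ku (kerV0 V1 y).
  by rewrite bop0 addr0 dl0 bop0 addr0.
have kmono x y u : P x -> P y -> kerV V1 x u -> kerV V1 (x + y) u.
  by move=> Px Py ku; have := kerVD cP f1 Px Py ku (kerV0 V1 y); rewrite bop0 addr0.
pose I := {p : 'rV[R]_d * H1 | P p.1 /\ kerV V1 p.1 p.2}.
have [||U iU UE] := @iso_ext _ H1 H2 I (fun p => (sval p).2) (fun p => dl (sval p).1 (sval p).2).
- move=> [[x u] [/= Px ku]] [[y v] [/= Py kv]].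
  rewrite -(dlmono x y u)// -(dlmono y x v)// addrC dlip//.
  + exact: coneD.
  + by rewrite addrC; exact: kmono.
  + exact: kmono.
- by move=> h hh; apply: pure1 => x k Px kk; exact: (hh (exist _ (x, k) (conj Px kk))).
have Uk x u : P x -> kerV V1 x u -> U u = dl x u.
  by move=> Px ku; exact: (UE (exist _ (x, u) (conj Px ku))).
exists U; split=> //.
  move=> x u Px; suff h : bcomp U (V1 x) = bcomp (V2 x) U.
    by have := congr1 (fun T : bop H1 H2 => T u) h.
  apply: (@bop_total_eq _ _ _ I (fun p => (sval p).2)).
    by move=> h hh; apply: pure1 => y k Py kk; exact: (hh (exist _ (y, k) (conj Py kk))).
  move=> [[y v] [/= Py kv]]; rewrite -[V1 x v]add0r.
  rewrite (Uk (x + y)) ?(Uk y)//; [|exact: coneD|apply: (kerVD cP f1) => //; exact: kerV0].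
  by rewrite dlD ?dl0 ?add0r//; exact: kerV0.
move=> x k Px kk; rewrite (Uk x)// /dl -scaleN1r addrC.
apply: kerV_lin; [exact: (wP x 0 Px (kerV0 V1 x)).1|exact: (wP x k Px kk).1].
Qed.

End theta.

(** * Translation invariance of Lebesgue measure *)

Section measure_preserving.
Import HBSimple HBNNSimple.
Local Open Scope ereal_scope.
Context d (T : measurableType d) (R : realType) (mu : {measure set T -> \bar R}).
Variables (tau sigma : T -> T).
Hypothesis mtau : measurable_fun setT tau.
Hypothesis msigma : measurable_fun setT sigma.
Hypothesis tauK : cancel tau sigma.
Hypothesis sigmaK : cancel sigma tau.
Hypothesis ptau : forall X, measurable X -> mu (tau @^-1` X) = mu X.

Lemma measure_preserving_inv X : measurable X -> mu (sigma @^-1` X) = mu X.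
Proof.
move=> mX; rewrite -ptau; last by rewrite -[_ @^-1` _]setTI; exact: msigma.
by congr (mu _); apply/seteqP; split=> t /=; rewrite tauK.
Qed.

Lemma nnsfun_comp_exists (t : T -> T) (h : {nnsfun T >-> R}) : measurable_fun setT t ->
  exists g : {nnsfun T >-> R}, g =1 (h \o t).
Proof.
move=> mt; pose g := h \o t.
have mg : measurable_fun setT g by apply: measurableT_comp.
have fg : finite_set (range g).
  by apply: sub_finite_set (fimfunP h) => _ [x _ <-]; exists (t x).
have g0 x : (0 <= g x)%R by exact: fun_ge0.
pose gg : {nnsfun T >-> R} := HB.pack g (isMeasurableFun.Build _ _ _ _ g mg)
  (FiniteImage.Build _ _ g fg) (isNonNegFun.Build _ _ g g0).
by exists gg.
Qed.

Lemma sintegral_preserving (g h : {nnsfun T >-> R}) (t : T -> T) :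
  (forall X, measurable X -> mu (t @^-1` X) = mu X) -> g =1 (h \o t) ->
  sintegral mu g = sintegral mu h.
Proof.
move=> pt gh; rewrite /sintegral; apply: eq_fsbigr => x _; congr (_ * _).
have -> : (g : T -> R) = h \o t by exact/funext.
by rewrite -[RHS]pt// -[_ @^-1` _]setTI; exact: measurable_funPT.
Qed.

(** The integral is a difference of suprema over simple functions, and composition with [tau] and
    [sigma] matches the two families of simple functions. The function f is arbitrary. *)
Lemma integral_measure_preserving D (f : T -> \bar R) :
  \int[mu]_(x in tau @^-1` D) f (tau x) = \int[mu]_(x in D) f x.
Proof.
have key (g g' : T -> \bar R) : (forall x, g' x = g (tau x)) ->
    ereal_sup [set sintegral mu h | h in [set h : {nnsfun T >-> R} | forall x, (h x)%:E <= g' x]] =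
    ereal_sup [set sintegral mu h | h in [set h : {nnsfun T >-> R} | forall x, (h x)%:E <= g x]].
  move=> gg'; congr ereal_sup; apply/seteqP; split=> _ [h hg <-].
    have [k kE] := nnsfun_comp_exists h msigma; exists k.
      by move=> x; rewrite kE /= -{2}(sigmaK x) -gg'; exact: hg.
    exact: sintegral_preserving measure_preserving_inv kE.
  have [k kE] := nnsfun_comp_exists h mtau; exists k.
    by move=> x; rewrite /= kE gg'; exact: hg.
  exact: sintegral_preserving ptau kE.
rewrite /integral /=.
have rE : ((fun x => f (tau x)) \_ (tau @^-1` D)) = (f \_ D) \o tau.
  apply/funext => x; rewrite /patch /=.
  by have -> : (x \in tau @^-1` D) = (tau x \in D) by apply/idP/idP; rewrite !inE.
have rEx x : ((fun x => f (tau x)) \_ (tau @^-1` D)) x = (f \_ D) (tau x).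
  by have := congr1 (fun k => k x) rE.
have h1 := key ((f \_ D)^\+) (((fun x => f (tau x)) \_ (tau @^-1` D))^\+).
have h2 := key ((f \_ D)^\-) (((fun x => f (tau x)) \_ (tau @^-1` D))^\-).
rewrite h1; last by move=> x; rewrite unlock rEx.
rewrite h2; last by move=> x; rewrite unlock rEx.
by [].
Qed.

End measure_preserving.

Section lebesgue_translation.
Local Open Scope ereal_scope.
Variable R : realType.
Local Notation RT := (measurableTypeR R).
Local Notation lam := (@lebesgue_measure R).

Lemma measurable_addr (a : R) : measurable_fun setT (fun x : RT => (x + a)%R : RT).
Proof. exact: (@measurable_realfun.measurable_funD _ _ _ setT id (cst a)). Qed.

Lemma lebesgue_translation (a : R) (X : set RT) : measurable X ->
  lam ((fun x => x + a)%R @^-1` X) = lam X.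
Proof.
move=> mX; pose f (x : RT) : RT := (x + a)%R.
have mf : measurable_fun setT f := measurable_addr a.
pose ff : {mfun RT >-> RT} := HB.pack f (isMeasurableFun.Build _ _ _ _ f mf).
apply/esym; apply: (lebesgue_measure_unique (mu := pushforward lam ff)) mX.
move=> _ [[p q] _ <-]; rewrite /=.
have fE : f @^-1` `]p, q]%classic = `](p - a)%R, (q - a)%R]%classic.
  apply/seteqP; split=> x /=; rewrite /f !in_itv /= => /andP[? ?];
    by apply/andP; split; lra.
rewrite -[RHS]/(lam (f @^-1` `]p, q]%classic)) fE.
rewrite !lebesgue_measure_itv /= !lte_fin ltrD2r; case: ifP => // _.
by rewrite -!EFinB; congr (_%:E); ring.
Qed.

Definition ttrans n (x : 'rV[R]_n) (t : n.-tuple RT) : n.-tuple RT :=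
  [tuple (tnth t i + x ord0 i)%R | i < n].

Lemma measurable_ttrans n (x : 'rV[R]_n) : measurable_fun setT (ttrans x).
Proof.
apply/measurable_fun_tnthP => i.
have -> : (tnth (T := RT))^~ i \o ttrans x = (fun t => tnth t i + x ord0 i)%R.
  by apply/funext => t /=; rewrite tnth_mktuple.
by apply: measurable_realfun.measurable_funD => //; exact: measurable_tnth.
Qed.

Lemma ttransK n (x : 'rV[R]_n) : cancel (ttrans x) (ttrans (- x)).
Proof.
by move=> t; apply: eq_from_tnth => i; rewrite !tnth_mktuple mxE addrK.
Qed.

Lemma ttransNK n (x : 'rV[R]_n) : cancel (ttrans (- x)) (ttrans x).
Proof.
by move=> t; apply: eq_from_tnth => i; rewrite !tnth_mktuple mxE subrK.
Qed.

(** Induction by slices: the translation moves the slices by the inductive hypothesis and their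
    parameter by one-dimensional invariance. *)
Lemma lebesgue_tuple_translation n (x : 'rV[R]_n) X : measurable X ->
  lebesgue_tuple n (ttrans x @^-1` X) = lebesgue_tuple n X.
Proof.
elim: n x X => [|n IH] x X mX.
  by congr (lebesgue_tuple 0 _); apply/seteqP; split=> t /=; rewrite [ttrans x t]tuple0 [t]tuple0.
rewrite /= /lebesgue_succ /pushforward /=.
pose x' : 'rV[R]_n := \row_i x ord0 (lift ord0 i).
have tE p : ttrans x (tcons p) = tcons ((p.1 + x ord0 ord0)%R, ttrans x' p.2).
  apply: eq_from_tnth => i; rewrite tnth_mktuple.
  have [j ->|->] := unliftP ord0 i; last by rewrite /tcons !tnth0.
  by rewrite /tcons !tnthS tnth_mktuple mxE.
have mtc (Y : set (n.+1.-tuple RT)) : measurable Y -> measurable (@tcons R n @^-1` Y).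
  by move=> mY; rewrite -[X in measurable X]setTI; exact: measurable_tcons.
set Y := @tcons R n @^-1` X; have mY : measurable Y by exact: mtc.
have -> : @tcons R n @^-1` (ttrans x @^-1` X) =
    [set p : RT * n.-tuple RT | Y ((p.1 + x ord0 ord0)%R, ttrans x' p.2)].
  by apply/seteqP; split=> p /=; rewrite tE.
rewrite /product_measure1 /=.
rewrite -[RHS](integral_measure_preserving (tau := fun a : RT => (a + x ord0 ord0)%R)
   (sigma := fun a : RT => (a - x ord0 ord0)%R)).
- apply: eq_integral => a _ /=.
  have mxs : measurable (xsection Y (a + x ord0 ord0)%R) by exact: measurable_xsection.
  rewrite -[RHS](IH x' _ mxs).
  by congr (lebesgue_tuple n _).
- exact: measurable_addr.
- exact: measurable_addr.
- by move=> a; rewrite addrK.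
- by move=> a; rewrite subrK.
- by move=> Z mZ; exact: lebesgue_translation.
Qed.

Lemma lebesgue_tupleT_gt0 n : 0 < lebesgue_tuple n setT :> \bar R.
Proof.
elim: n => [|n IH]; first by rewrite /= diracT lte_fin.
rewrite /= /lebesgue_succ /pushforward /= preimage_setT -setXTT product_measure1E//.
rewrite mule_gt0//; apply: lt_le_trans (_ : lam `[0%R, 1%R]%classic <= _).
  by rewrite lebesgue_measure_itv /= lte_fin ltr01 sube0 lte_fin ltr01.
by apply: le_measure => //; rewrite inE; [exact: measurable_itv|exact: measurableT].
Qed.

End lebesgue_translation.

(** * Borel sets and square-integrable functions *)

Section borel_sets.
Variables (R : realType) (d : nat).
Implicit Types (X Y A : set 'rV[R]_d) (x : 'rV[R]_d).
Local Notation RT := (measurableTypeR R).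
Local Notation rowt := (@rowt R d).

Lemma borelI X Y : borel X -> borel Y -> borel (X `&` Y).
Proof. exact: measurableI. Qed.

Lemma borelU X Y : borel X -> borel Y -> borel (X `|` Y).
Proof. exact: measurableU. Qed.

Lemma borelC X : borel X -> borel (~` X).
Proof. exact: measurableC. Qed.

Lemma borelT : borel [set: 'rV[R]_d]. Proof. exact: measurableT. Qed.
Lemma borel0 : borel (@set0 'rV[R]_d). Proof. exact: measurable0. Qed.

(** Borel sets are pulled back from the product sigma-algebra, so an open set is written as a
    countable union of cubes [B p] with rational centres and half-widths 1 / (n + 1). *)
Lemma open_borel X : open X -> borel X.
Proof.
move=> oX; pose B (p : 'rV[rat]_d * nat) : set 'rV[R]_d :=
  [set y | forall i, `|ratr (p.1 ord0 i) - y ord0 i| < p.2.+1%:R^-1].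
pose U p := if pselect (B p `<=` X) then B p else set0.
have -> : X = \bigcup_p U p.
  apply/seteqP; split=> [x Xx|x [p _]]; last by rewrite /U; case: pselect => // h /h.
  have /nbhs_ballP[e /= e0 eX] : nbhs x X by exact: open_nbhs_nbhs.
  have [n hn] := natSinv_lt (divr_gt0 e0 (ltr0Sn R 1)).
  have pick i : exists q : rat, `|ratr q - x ord0 i| < n.+1%:R^-1.
    have [q] := @rat_in_itvoo R (x ord0 i - n.+1%:R^-1) (x ord0 i + n.+1%:R^-1)
      (ltac:(by rewrite ltrD2l gtrN// invr_gt0)).
    rewrite in_itv /= => /andP[q1 q2]; exists q.
    by rewrite ltr_norml; move: (n.+1%:R^-1) q1 q2 => r ? ?; apply/andP; split; lra.
  have [q qP] := choice pick.
  exists (\row_i q i, n) => //; rewrite /U; case: pselect => [_ i /=|[]]; first by rewrite mxE.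
  move=> y yB; apply: eX; rewrite mx_norm_ball /ball_ /=.
  rewrite (_ : `|x - y| < e)//; apply: le_lt_trans (_ : n.+1%:R^-1 + n.+1%:R^-1 < e); last first.
    by have := hn n (leqnn n); move: (n.+1%:R^-1) => r; lra.
  have hxy i : `|x ord0 i - y ord0 i| <= n.+1%:R^-1 + n.+1%:R^-1.
    have := qP i; have := yB i; rewrite /= mxE => h1 h2.
    have -> : x ord0 i - y ord0 i = (ratr (q i) - y ord0 i) - (ratr (q i) - x ord0 i) by ring.
    by apply: le_trans (ler_normB _ _) _; rewrite lerD ?ltW.
  rewrite /Num.Def.normr /= mx_normrE; apply/bigmax_leP; split=> [|[i j] _ /=].
    by rewrite addr_ge0// invr_ge0.
  by rewrite (ord1 i) !mxE; exact: hxy.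
rewrite /borel preimage_bigcup; apply: countable_bigcupT_measurable; first exact: countableP.
move=> p; rewrite /U; case: pselect => [pX|pX] /=; last by rewrite preimage_set0.
have -> : rowt @^-1` B p = \bigcap_(i in [set: 'I_d]) [set t | `|ratr (p.1 ord0 i) - tnth t i| < p.2.+1%:R^-1].
  apply/seteqP; split=> t /= h.
    by move=> i _ /=; have := h i; rewrite mxE.
  by move=> i; have := h i I; rewrite mxE.
apply: fin_bigcap_measurable => // i _.
have -> : [set t : d.-tuple RT | `|ratr (p.1 ord0 i) - tnth t i| < p.2.+1%:R^-1] =
  (fun t => tnth t i) @^-1` (ball (ratr (p.1 ord0 i) : R) (p.2.+1%:R^-1)).
  by apply/seteqP; split=> t /=; rewrite -ball_normE.
rewrite -[X in measurable X]setTI; apply: measurable_tnth => //.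
exact: measurable_realfun.open_measurable (ball_open _ _).
Qed.

Lemma closed_borel X : closed X -> borel X.
Proof. by move=> cX; have := borelC (open_borel (closed_openC cX)); rewrite setCK. Qed.

Lemma rowt_ttrans x t : rowt (ttrans x t) = rowt t + x.
Proof. by apply/rowP => i; rewrite !mxE tnth_mktuple [x _ _](_ : _ = x 0 i)// ord1. Qed.

Lemma mem_translate A x y : translate A x y <-> A (y - x).
Proof.
split; first by move=> [a Aa <-]; rewrite addrK.
by move=> h; exists (y - x) => //; rewrite subrK.
Qed.

Lemma borel_comp_sub X x : borel X -> borel [set y | X (y - x)].
Proof.
move=> bX; rewrite /borel.
have -> : rowt @^-1` [set y | X (y - x)] = ttrans (- x) @^-1` (rowt @^-1` X).
  by apply/seteqP; split=> t /=; rewrite rowt_ttrans.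
by rewrite -[X in measurable X]setTI; exact: measurable_ttrans.
Qed.

Lemma borel_translate A x : borel A -> borel (translate A x).
Proof.
move=> bA; have -> : translate A x = [set y | A (y - x)].
  by apply/seteqP; split=> y /mem_translate.
exact: borel_comp_sub.
Qed.

Lemma leb_int_translate A x (f : 'rV[R]_d -> \bar R) :
  leb_int (translate A x) (fun y => f (y - x)) = leb_int A f.
Proof.
rewrite /leb_int -[LHS](integral_measure_preserving (tau := ttrans x) (sigma := ttrans (- x))).
- have -> : ttrans x @^-1` (rowt @^-1` translate A x) = rowt @^-1` A.
    by apply/seteqP; split=> t /=; rewrite rowt_ttrans mem_translate addrK.
  by apply: eq_integral => t _; rewrite rowt_ttrans addrK.
- exact: measurable_ttrans.
- exact: measurable_ttrans.
- exact: ttransK.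
- exact: ttransNK.
- by move=> X mX; exact: lebesgue_tuple_translation.
Qed.

Lemma leb_intC_translate A x (f : 'rV[R]_d -> R[i]) :
  leb_intC (translate A x) (fun y => f (y - x)) = leb_intC A f.
Proof.
by rewrite /leb_intC (leb_int_translate A x (fun y => (Re (f y))%:E))
  (leb_int_translate A x (fun y => (Im (f y))%:E)).
Qed.

Lemma leb_int_eq A (f g : 'rV[R]_d -> \bar R) : (forall y, A y -> f y = g y) ->
  leb_int A f = leb_int A g.
Proof. by move=> fg; apply: eq_integral => t; rewrite inE => /fg. Qed.

Lemma leb_int0 A (f : 'rV[R]_d -> \bar R) : (forall y, A y -> f y = 0%E) -> leb_int A f = 0%E.
Proof. by move=> f0; apply: integral0_eq => t /f0. Qed.

Lemma leb_int_mkcond A (f : 'rV[R]_d -> \bar R) :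
  leb_int A f = leb_int setT (fun y => if y \in A then f y else 0%E).
Proof.
rewrite /leb_int integral_mkcond preimage_setT; apply: eq_integral => t _.
rewrite /patch; have -> : (t \in rowt @^-1` A) = (rowt t \in A) by apply/idP/idP; rewrite !inE.
by [].
Qed.

Lemma leb_intC_eq A (f g : 'rV[R]_d -> R[i]) : (forall y, A y -> f y = g y) ->
  leb_intC A f = leb_intC A g.
Proof.
by move=> fg; rewrite /leb_intC; congr (fine _ +i* fine _); apply: leb_int_eq => y /fg ->.
Qed.

End borel_sets.

Section square_integrable.
Variables (R : realType) (d : nat) (K : hilbert R).
Implicit Types (X Y A : set 'rV[R]_d) (x : 'rV[R]_d) (f g : 'rV[R]_d -> K).
Local Notation rowt := (@rowt R d).

Definition borel_fun f := forall Q : set K, open Q -> borel (f @^-1` Q).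

(** [sq_integrable A] says nothing about values outside A; extension by 0 gives a globally Borel
    function, which can be translated freely. *)
Definition cut X f : 'rV[R]_d -> K := fun y => if y \in X then f y else 0.

Lemma cut_in X f y : X y -> cut X f y = f y.
Proof. by rewrite /cut => Xy; rewrite mem_set. Qed.

Lemma cut_out X f y : ~ X y -> cut X f y = 0.
Proof. by rewrite /cut => Xy; rewrite memNset. Qed.

Lemma cut_borel X f : (forall Q : set K, open Q -> borel (X `&` f @^-1` Q)) -> borel X ->
  borel_fun (cut X f).
Proof.
move=> mf bX Q oQ; have [Q0|Q0] := pselect (Q 0).
  have -> : cut X f @^-1` Q = (X `&` f @^-1` Q) `|` ~` X.
    apply/seteqP; split=> y /=.
      by have [Xy|Xy] := pselect (X y); [rewrite cut_in//; left|right].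
    by case=> [[Xy fO]|Xy]; [rewrite cut_in|rewrite cut_out].
  by apply: borelU; [exact: mf|exact: borelC].
have -> : cut X f @^-1` Q = X `&` f @^-1` Q.
  apply/seteqP; split=> y /=.
    by have [Xy|Xy] := pselect (X y); [rewrite cut_in|rewrite cut_out].
  by case=> Xy fO; rewrite cut_in.
exact: mf.
Qed.

Lemma measurable_lipschitz f (phi : K -> R) (L : R) : borel_fun f ->
  (forall u v, `|phi u - phi v| <= L * nrm (u - v)) ->
  measurable_fun setT (fun t => phi (f (rowt t))).
Proof.
move=> mf hL; apply: (measurability _ (RGenOInfty.measurableE R)) => _ [_ [a ->] <-].
rewrite setTI; suff oU : open [set u : K | a < phi u].
  have -> : (fun t => phi (f (rowt t))) @^-1` `]a, +oo[%classic =
     rowt @^-1` (f @^-1` [set u | a < phi u]).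
    by apply/seteqP; split=> t /=; rewrite in_itv /= andbT.
  exact: mf.
rewrite openE => u /= au; apply/nbhs_ballP.
have L1 : 0 < `|L| + 1 by rewrite ltr_wpDl.
exists ((phi u - a) / (`|L| + 1))%:C => /=; first by rewrite ltcR divr_gt0// subr_gt0.
move=> v; rewrite -ball_normE /= normE ltcR ltr_pdivlMr// => h.
have h1 : L * nrm (u - v) <= nrm (u - v) * (`|L| + 1).
  rewrite mulrC ler_wpM2l ?nrm_ge0//; apply: le_trans (ler_norm _) _; by rewrite lerDl.
have := hL u v; have := ler_norm (phi u - phi v); lra.
Qed.

Lemma nrm_lipschitz (u v : K) : `|nrm u - nrm v| <= 1 * nrm (u - v).
Proof.
rewrite mul1r ler_norml; have h1 := nrm_le_sub u v; have h2 := nrm_le_sub v u.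
by rewrite [nrm (v - u)]nrm_distC in h2; apply/andP; split; lra.
Qed.

Lemma ip_lipschitz (w u v : K) : cab (ip w u - ip w v) <= nrm w * nrm (u - v).
Proof. by rewrite -ipBr; exact: cauchy_schwarz. Qed.

Lemma measurable_sqnorm f : borel_fun f ->
  measurable_fun setT (fun t => (sqnorm (f (rowt t)))%:E).
Proof.
move=> mf; apply/measurable_EFinP.
have -> : (fun t => sqnorm (f (rowt t))) = (fun t => nrm (f (rowt t)) ^+ 2).
  by apply/funext => t; rewrite sqr_nrm.
apply: measurable_realfun.measurable_funX.
exact: (measurable_lipschitz (phi := @nrm R K) mf nrm_lipschitz).
Qed.

Lemma measurable_Re_ip w f : borel_fun f ->
  measurable_fun setT (fun t => Re (ip w (f (rowt t)))).
Proof.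
move=> mf; apply: (measurable_lipschitz (phi := fun u => Re (ip w u)) mf) => u v.
by rewrite -cReB; apply: le_trans (normRe_le _) (ip_lipschitz _ _ _).
Qed.

Lemma measurable_Im_ip w f : borel_fun f ->
  measurable_fun setT (fun t => Im (ip w (f (rowt t)))).
Proof.
move=> mf; apply: (measurable_lipschitz (phi := fun u => Im (ip w u)) mf) => u v.
by rewrite -cImB; apply: le_trans (normIm_le _) (ip_lipschitz _ _ _).
Qed.

Lemma sqnorm_cut X f y : (sqnorm (cut X f y))%:E = if y \in X then (sqnorm (f y))%:E else 0%E.
Proof. by rewrite /cut; case: ifP => // _; rewrite sqnorm0. Qed.

Lemma sq_cut A f : borel A -> sq_integrable A f -> sq_integrable setT (cut A f).
Proof.
move=> bA [mf fi]; split.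
  by move=> Q oQ; rewrite setTI; exact: cut_borel.
by under [X in leb_int _ X]funext => y do rewrite sqnorm_cut; rewrite -leb_int_mkcond.
Qed.

Lemma sq_borel_fun f : sq_integrable setT f -> borel_fun f.
Proof. by move=> [mf _] Q oQ; have := mf Q oQ; rewrite setTI. Qed.

Lemma leb_int_le A f g : borel A -> borel_fun f -> borel_fun g ->
  (forall y, A y -> sqnorm (f y) <= sqnorm (g y)) ->
  (leb_int A (fun y => (sqnorm (f y))%:E) <= leb_int A (fun y => (sqnorm (g y))%:E))%E.
Proof.
move=> bA mf mg fg; apply: ge0_le_integral => //.
- by move=> t _; rewrite lee_fin sqnorm_ge0.
- by apply: measurable_funTS; exact: measurable_sqnorm.
- by apply: measurable_funTS; exact: measurable_sqnorm.
- by move=> t At; rewrite lee_fin fg.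
Qed.

Lemma sq_cutT X f : borel X -> sq_integrable setT f -> sq_integrable setT (cut X f).
Proof.
move=> bX hf; have mf := sq_borel_fun hf.
have mc : borel_fun (cut X f) by apply: cut_borel => // Q oQ; apply: borelI => //; exact: mf.
split; first by move=> Q oQ; rewrite setTI; exact: mc.
apply: le_lt_trans hf.2; apply: leb_int_le => //; first exact: borelT.
move=> y _; rewrite /cut; case: ifP => // _; rewrite sqnorm0; exact: sqnorm_ge0.
Qed.

Lemma sqT_sq A f : borel A -> sq_integrable setT f -> sq_integrable A f.
Proof.
move=> bA hf; have mf := sq_borel_fun hf; split.
  by move=> Q oQ; apply: borelI => //; exact: mf.
have := (sq_cutT bA hf).2; rewrite [X in (_ < _)%E -> (X < _)%E]leb_int_mkcond.
by under [X in leb_int _ X]funext => y do rewrite sqnorm_cut.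
Qed.

Lemma sq_shiftT x f : sq_integrable setT f -> sq_integrable setT (fun y => f (y - x)).
Proof.
move=> hf; have mf := sq_borel_fun hf; split.
  move=> Q oQ; rewrite setTI.
  by apply: (@borel_comp_sub _ _ (f @^-1` Q)); exact: mf.
have -> : [set: 'rV[R]_d] = translate setT x.
  by apply/seteqP; split=> y // _; apply/mem_translate.
by rewrite (leb_int_translate setT x (fun y => (sqnorm (f y))%:E)); exact: hf.2.
Qed.

Lemma sq_eq A f g : (forall y, A y -> f y = g y) -> sq_integrable A f -> sq_integrable A g.
Proof.
move=> fg [mf fi]; split.
  move=> Q oQ; have <- : A `&` f @^-1` Q = A `&` g @^-1` Q.
    by apply/seteqP; split=> y /= [Ay]; rewrite fg.
  exact: mf.
by rewrite -(leb_int_eq (f := fun y => (sqnorm (f y))%:E))// => y Ay; rewrite fg.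
Qed.

Lemma sq0 A : borel A -> sq_integrable A (fun=> 0 : K).
Proof.
move=> bA; split; last by rewrite leb_int0// => y _; rewrite sqnorm0.
move=> Q oQ; have [Q0|Q0] := pselect (Q 0).
  have -> : A `&` (fun=> 0 : K) @^-1` Q = A by apply/seteqP; split=> y //= [].
  exact: bA.
have -> : A `&` (fun=> 0 : K) @^-1` Q = set0 by apply/seteqP; split=> y //= [].
exact: borel0.
Qed.

End square_integrable.

(** * Supports in L^2 spaces *)

Section supports.
Variables (R : realType) (d : nat) (A : set 'rV[R]_d) (K : hilbert R) (E : L2 A K).
Hypothesis bA : borel A.
Implicit Types (X Y : set 'rV[R]_d) (f g : 'rV[R]_d -> K) (h k : E).
Local Notation cls := (L2_class E).

Lemma cls_sqnorm f : sq_integrable A f ->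
  sqnorm (cls f) = fine (leb_int A (fun y => (sqnorm (f y))%:E)).
Proof. by move=> hf; rewrite {1}/sqnorm L2_ip. Qed.

Lemma cls_eq0 f : (forall y, A y -> f y = 0) -> cls f = 0.
Proof.
move=> f0; apply: sqnorm_eq0; rewrite cls_sqnorm ?leb_int0//.
  by move=> y Ay; rewrite f0// sqnorm0.
by apply: sq_eq (sq0 K bA) => y /f0.
Qed.

Lemma cls_eq f g : sq_integrable A f -> (forall y, A y -> f y = g y) -> cls f = cls g.
Proof.
move=> hf fg; have hg := sq_eq fg hf.
have := cls_eq0 (f := fun y => -1 *: f y + g y); rewrite L2_lin// scaleN1r addrC.
by move=> h; apply/esym/subr0_eq/h => y /fg ->; rewrite scaleN1r addNr.
Qed.

(** The representative vanishes everywhere off X and A, not just almost everywhere, and is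
    square-integrable on the whole space; thus V_x acts on it by plain translation. *)
Definition supp X h := exists f, [/\ sq_integrable setT f,
  forall y, ~ (A y /\ X y) -> f y = 0 & cls f = h].

Lemma supp_cls X f : sq_integrable A f -> (forall y, A y -> ~ X y -> f y = 0) -> supp X (cls f).
Proof.
move=> hf f0; exists (cut A f); split; first exact: sq_cut.
  move=> y ny; have [Ay|Ay] := pselect (A y); last by rewrite cut_out.
  by rewrite cut_in// f0// => Xy; exact: ny.
by apply/esym/cls_eq => // y Ay; rewrite cut_in.
Qed.

Lemma suppT h : supp setT h.
Proof. by have [f hf <-] := L2_surj h; apply: supp_cls => // y _ []. Qed.

Lemma supp_sub X Y h : (forall y, A y -> X y -> Y y) -> supp X h -> supp Y h.
Proof.
move=> XY [f [hf f0 <-]]; exists f; split=> // y ny; apply: f0 => -[Ay Xy].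
by apply: ny; split=> //; exact: XY.
Qed.

Lemma supp_split X Y h : borel Y -> supp X h -> exists h1 h2,
  [/\ h = h1 + h2, supp (X `&` Y) h1 & supp (X `\` Y) h2].
Proof.
move=> bY [f [hf f0 <-]].
have h1 : sq_integrable A (cut Y f) by apply: sqT_sq => //; exact: sq_cutT.
have h2 : sq_integrable A (cut (~` Y) f).
  by apply: sqT_sq => //; apply: sq_cutT => //; exact: borelC.
exists (cls (cut Y f)), (cls (cut (~` Y) f)); split.
- rewrite -[X in X + _]scale1r -L2_lin//; apply: cls_eq; first exact: sqT_sq.
  move=> y _; rewrite scale1r; have [Yy|Yy] := pselect (Y y).
    by rewrite cut_in// cut_out ?addr0//; apply.
  by rewrite cut_out// cut_in// add0r.
- apply: supp_cls => // y Ay nXY; have [Yy|Yy] := pselect (Y y); last by rewrite cut_out.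
  by rewrite cut_in// f0// => -[_ Xy]; apply: nXY.
- apply: supp_cls => // y Ay nXY; have [Yy|Yy] := pselect (Y y); first by rewrite cut_out//; apply.
  by rewrite cut_in// f0// => -[_ Xy]; apply: nXY.
Qed.

Lemma supp_orth X Y h k : supp X h -> supp Y k -> (forall y, A y -> X y -> Y y -> False) ->
  ip h k = 0.
Proof.
move=> [f [hf f0 <-]] [g [hg g0 <-]] XY; rewrite L2_ip; [|exact: sqT_sq|exact: sqT_sq].
have fg0 y : ip (f y) (g y) = 0.
  have [[Ay Xy]|n] := pselect (A y /\ X y); last by rewrite f0// ip0l.
  by rewrite g0 ?ip0r// => -[_ Yy]; exact: XY Ay Xy Yy.
rewrite /leb_intC !leb_int0//= => y _; by rewrite fg0.
Qed.

Definition ball0 n : set 'rV[R]_d := [set y | `|y| < n.+1%:R].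

Let annulus n : set 'rV[R]_d := ball0 n `\` (if n is m.+1 then ball0 m else set0).

Lemma borel_ball0 n : borel (ball0 n).
Proof.
have -> : ball0 n = ball 0 n.+1%:R.
  by apply/seteqP; split=> y; rewrite -ball_normE /= sub0r normrN.
by apply: open_borel; apply: ball_open; rewrite ltr0n.
Qed.

Lemma borel_annulus n : borel (annulus n).
Proof.
apply: borelI; first exact: borel_ball0.
by apply: borelC; case: n => [|n]; [exact: borel0|exact: borel_ball0].
Qed.

Lemma annulus_cover : \bigcup_n annulus n = setT.
Proof.
apply/seteqP; split=> // y _.
have ex : exists n, `|y| < n.+1%:R.
  exists (Num.truncn `|y|); exact: truncnS_gt.
pose n := ex_minn ex; exists n => //; rewrite /n; case: ex_minnP => -[|m] hm hmin; split=> //.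
by move=> /hmin; rewrite ltnn.
Qed.

Lemma annulus_disjoint : trivIset setT annulus.
Proof.
apply/trivIsetP => i j _ _; wlog ij : i j / (i < j)%N.
  move=> wl; rewrite neq_ltn => /orP[ij|ji]; first by apply: wl => //; rewrite ltn_eqF.
  by rewrite setIC; apply: wl => //; rewrite ltn_eqF.
move=> _; apply/seteqP; split=> // y [[yi _]]; case: j ij => // j; rewrite ltnS => ij [_ /= yj].
apply: yj; apply: lt_le_trans yi _.
by rewrite ler_nat.
Qed.

(** Pairing h with its own restriction to each annulus shows that its norm vanishes there; countable
    additivity over the disjoint annuli finishes. *)
Lemma supp_bounded h : (forall n k, supp (ball0 n) k -> ip k h = 0) -> h = 0.
Proof.
move=> h0; have [f [hf f0 fh]] := suppT h.
have hc n : sq_integrable setT (cut (annulus n) f) by apply: sq_cutT => //; exact: borel_annulus.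
have i0 n : leb_int (A `&` annulus n) (fun y => (sqnorm (f y))%:E) = 0%E.
  have : ip (cls (cut (annulus n) f)) h = 0.
    apply: (h0 n); apply: supp_cls; first exact: sqT_sq.
    by move=> y _ ny; rewrite cut_out// => -[].
  rewrite -fh L2_ip; [|exact: sqT_sq|exact: sqT_sq] => /(congr1 (@complex.Re R)) /=.
  have -> : leb_int A (fun y => (Re (ip (cut (annulus n) f y) (f y)))%:E) =
      leb_int A (fun y => (sqnorm (cut (annulus n) f y))%:E).
    apply: leb_int_eq => y _; rewrite /cut; case: ifP => // _.
    by rewrite ip0l sqnorm0.
  have -> : leb_int (A `&` annulus n) (fun y => (sqnorm (f y))%:E) =
      leb_int A (fun y => (sqnorm (cut (annulus n) f y))%:E).
    rewrite leb_int_mkcond [RHS]leb_int_mkcond; apply: leb_int_eq => y _.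
    rewrite sqnorm_cut in_setI; case: (y \in A); case: (y \in annulus n) => //.
  have := (sqT_sq bA (hc n)).2; set I := leb_int _ _ => Ifin I0.
  have I_ge0 : (0 <= I)%E by apply: integral_ge0 => t _; rewrite lee_fin sqnorm_ge0.
  by rewrite -[LHS]fineK ?I0// ge0_fin_numE.
apply: sqnorm_eq0; rewrite -fh cls_sqnorm; last exact: sqT_sq.
suff -> : leb_int A (fun y => (sqnorm (f y))%:E) = 0%E by [].
have AE : @rowt R d @^-1` A = \bigcup_n (@rowt R d @^-1` (A `&` annulus n)).
  rewrite -preimage_bigcup; congr (_ @^-1` _); rewrite -setI_bigcupr.
  by rewrite annulus_cover setIT.
rewrite /leb_int AE ge0_integral_bigcup.
- by rewrite eseries0// => n _ _; exact: i0.
- by move=> n; apply: borelI => //; exact: borel_annulus.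
- by apply: measurable_funTS; apply: measurable_sqnorm; exact: sq_borel_fun.
- by move=> t _; rewrite lee_fin sqnorm_ge0.
- apply/trivIsetP => i j _ _ ij; move/trivIsetP : annulus_disjoint => /(_ i j I I ij) h1.
  apply/seteqP; split=> // t [[_ ti] [_ tj]].
  by have : (annulus i `&` annulus j) (rowt t) by []; rewrite h1.
Qed.

End supports.

(** * Interior points of a spanning cone and a compactness principle *)

Section cones.
Variables (R : realType) (d : nat) (P : set 'rV[R]_d) (cP : is_cone P).
Hypothesis spanP : spanning_cone P.

Lemma coord_le (y : 'rV[R]_d) i : `|y ord0 i| <= `|y|.
Proof.
rewrite {2}/Num.Def.normr /= mx_normrE; exact: (le_bigmax_cond _ (fun ij => `|y ij.1 ij.2|) (j := (ord0, i))).
Qed.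

Lemma cone_sub w : exists s t, [/\ P s, P t & w = s - t].
Proof.
have : [set: 'rV[R]_d] w by []; rewrite -spanP => -[s Ps [t Pt <-]].
by exists s, t.
Qed.

Lemma cone_sum I (r : seq I) (F : I -> 'rV[R]_d) : (forall i, P (F i)) -> P (\sum_(i <- r) F i).
Proof.
move=> PF; elim/big_ind : _ => // [|x y]; [exact: cone0|exact: coneD].
Qed.

(** Each basis vector is a difference s_i - t_i in P, and p is the sum of all s_i + t_i. For |y| <=
    r the coefficients r + y_i and r - y_i are nonnegative, so P contains the ball of radius r
    around r p. *)
Lemma cone_interior : exists2 p, P p & forall r y, 0 <= r -> `|y| <= r -> P (r *: p + y).
Proof.
have pick (i : 'I_d) : exists st : 'rV[R]_d * 'rV[R]_d, [/\ P st.1, P st.2 & delta_mx ord0 i = st.1 - st.2].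
  by have [s [t [Ps Pt e]]] := cone_sub (delta_mx ord0 i); exists (s, t).
have [st stP] := choice pick.
exists (\sum_i ((st i).1 + (st i).2)).
  by apply: cone_sum => i; have [? ? _] := stP i; exact: coneD.
move=> r y r0 yr; rewrite [y]row_sum_delta scaler_sumr -big_split /=.
apply: cone_sum => i; have [Ps Pt ->] := stP i.
have : `|y 0 i| <= r by apply: le_trans yr; exact: coord_le.
rewrite ler_norml => /andP[h1 h2].
have -> : r *: ((st i).1 + (st i).2) + y 0 i *: ((st i).1 - (st i).2) =
    (r + y 0 i) *: (st i).1 + (r - y 0 i) *: (st i).2.
  by rewrite scalerDr scalerBr !scalerDl scaleNr addrACA.
by apply: coneD => //; apply: coneZ => //; lra.
Qed.

(** Compactness as an induction principle. Unions are required with balls only, because splitting a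
    support needs one of the two sets to be Borel. *)
Lemma compact_local (Q : set 'rV[R]_d -> Prop) n :
  Q set0 -> (forall X Y, X `<=` Y -> Q Y -> Q X) ->
  (forall x e Y, 0 < e -> Q (ball x e) -> Q Y -> Q (ball x e `|` Y)) ->
  (forall x, exists2 e : R, 0 < e & Q (ball x e)) ->
  Q (ball0 n).
Proof.
move=> Q0 Qsub QU Qloc.
have pick x : exists e : R, 0 < e /\ Q (ball x e) by have [e e0 h] := Qloc x; exists e.
have [e eP] := choice pick.
pose K : set 'rV[R]_d := [set v | `|v| <= n.+1%:R].
have cK : compact K.
  apply: bounded_closed_compact.
    by exists n.+1%:R; split; [exact: num_real|move=> M hM y /= h; exact: le_trans h (ltW hM)].
  apply: (@closed_comp _ _ (fun v : 'rV[R]_d => `|v|) [set r : R | r <= n.+1%:R]); last exact: closed_le.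
  by move=> x _; exact: norm_continuous.
move: cK; rewrite compact_cover => /(_ _ setT (fun x => ball x (e x)))[||D _ KD].
- by move=> x _; exact: ball_open.
- by move=> x _; exists x => //; apply: ballxx; exact: (eP x).1.
pose s : seq 'rV[R]_d := finmap.enum_fset D.
pose B (x : 'rV[R]_d) : set 'rV[R]_d := ball x (e x).
have sub : ball0 n `<=` \big[setU/set0]_(x <- s) B x.
  move=> y yn; have [x /= xD yx] := KD y (ltW yn).
  by rewrite -bigcup_seq; exists x.
apply: (Qsub _ _ sub); elim: (s) => [|x t IH]; first by rewrite big_nil.
rewrite big_cons; apply: QU => //; first exact: (eP x).1.
exact: (eP x).2.
Qed.

End cones.

(** * Modules are determined by intertwiners *)

Section module_supports.
Variables (R : realType) (d : nat) (P : set 'rV[R]_d) (cP : is_cone P).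
Hypothesis spanP : spanning_cone P.
Variables (A : set 'rV[R]_d) (mA : P_module P A) (K : hilbert R) (E : L2 A K).
Variables (V : 'rV[R]_d -> bop E E) (rV : module_representation P V).
Local Notation cls := (L2_class E).

Lemma module_borel : borel A.
Proof. by case: mA => cA _ _ _; exact: closed_borel. Qed.

Lemma moduleD a x : A a -> P x -> A (a + x).
Proof. by case: mA => _ _ _ h Aa Px; apply: (h x Px); exists a. Qed.

Lemma V_shift x f : P x -> sq_integrable setT f -> (forall y, ~ A y -> f y = 0) ->
  V x (cls f) = cls (fun y => f (y - x)).
Proof.
move=> Px hf f0; have hfA := sqT_sq module_borel hf.
rewrite rV//; have e : Defs.shift A x f = fun y => f (y - x).
  apply/funext => y; rewrite /Defs.shift; case: ifPn => // /negP ny.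
  by rewrite f0// => /mem_set.
by rewrite e.
Qed.

Lemma V_supp X x h : P x -> supp X h -> supp (translate X x `&` translate A x) (V x h).
Proof.
move=> Px [f [hf f0 <-]]; rewrite V_shift//; last by move=> y ny; apply: f0 => -[].
apply: (supp_cls E module_borel); first exact: (sqT_sq module_borel (sq_shiftT x hf)).
by move=> y _ ny; apply: f0 => -[Ay Xy]; apply: ny; split; apply/mem_translate.
Qed.

(** A translation by s - t, possibly outside P, is realised as V_s followed by the inverse of V_t,
    on functions whose translated support stays in A. *)
Lemma V_transport X h s t : P s -> P t -> supp X h ->
  (forall y, A y -> X y -> A (y + (s - t))) ->
  exists2 h', supp (translate X (s - t)) h' & V t h' = V s h.
Proof.
move=> Ps Pt [f [hf f0 <-]] sub; exists (cls (fun y => f (y - (s - t)))).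
  apply: (supp_cls E module_borel); first exact: (sqT_sq module_borel (sq_shiftT _ hf)).
  by move=> y _ ny; apply: f0 => -[Ay Xy]; apply: ny; apply/mem_translate.
rewrite !V_shift//.
- by congr cls; apply/funext => y; rewrite opprB addrA addrNK.
- by move=> y ny; apply: f0 => -[].
- exact: sq_shiftT.
- by move=> y ny; apply: f0 => -[Ay Xy]; apply: ny; rewrite -[y](subrK (s - t)); exact: sub.
Qed.

(** Fix b outside A. If y - r p were in A with r large, b would lie in (y - r p) + P and hence in A.
    This is where properness of modules enters. *)
Lemma module_escape n : exists2 x, P x & forall y, `|y| < n.+1%:R -> ~ A (y - x).
Proof.
have [b nb] : exists b, ~ A b.
  apply: contrapT => no; case: mA => _ + _ _; apply; apply/seteqP; split=> // b _.
  by apply: contrapT => nb; apply: no; exists b.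
have [p Pp pP] := cone_interior cP spanP; pose r := `|b| + n.+1%:R.
exists (r *: p); first by apply: coneZ => //; rewrite addr_ge0.
move=> y yn Ay; apply: nb; rewrite -[b](subrKC (y - r *: p)); apply: moduleD => //.
have -> : b - (y - r *: p) = r *: p + (b - y) by rewrite opprB addrCA.
apply: pP; first by rewrite addr_ge0.
by apply: le_trans (ler_normB _ _) _; rewrite lerD2l (ltW yn).
Qed.

Lemma module_pure h : (forall x k, P x -> kerV V x k -> ip k h = 0) -> h = 0.
Proof.
move=> h0; apply: (supp_bounded module_borel) => n k kn.
have [x Px xn] := module_escape n; apply: (h0 x) => // w.
apply: (supp_orth module_borel (V_supp Px (suppT module_borel w)) kn).
by move=> y _ [_ /mem_translate Ay] /xn.
Qed.

Lemma supp_setU (X Y : set 'rV[R]_d) (h : E) : borel X -> supp (X `|` Y) h -> exists h1 h2,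
  [/\ h = h1 + h2, supp X h1 & supp Y h2].
Proof.
move=> bX /(supp_split module_borel bX)[h1 [h2 [-> s1 s2]]]; exists h1, h2; split=> //.
  by apply: supp_sub s1 => y _ [].
by apply: supp_sub s2 => y _ [[]].
Qed.

Lemma supp0_eq0 (h : E) : supp set0 h -> h = 0.
Proof.
by move=> [f [hf f0 <-]]; apply: (cls_eq0 E module_borel) => y _; apply: f0 => -[].
Qed.

End module_supports.

Section localization.
Variables (R : realType) (d : nat) (P : set 'rV[R]_d) (cP : is_cone P).
Variables (A1 A2 : set 'rV[R]_d) (mA1 : P_module P A1) (mA2 : P_module P A2).
Variables (K1 K2 : hilbert R) (E1 : L2 A1 K1) (E2 : L2 A2 K2).
Let bA1 := module_borel mA1.
Let bA2 := module_borel mA2.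

Definition matrix_point (T : bop E1 E2) (y y' : 'rV[R]_d) := forall e : R, 0 < e ->
  exists f g, [/\ supp (ball y e) f, supp (ball y' e) g & ip g (T f) <> 0].

(** Otherwise every pair of points has neighbourhoods between which T has no matrix coefficient;
    compactness, in the second variable and then in the first, spreads this to all bounded supports
    and gives T = 0. *)
Lemma localize (T : bop E1 E2) h : T h <> 0 -> exists y y', matrix_point T y y'.
Proof.
move=> Th; apply: contrapT => no.
have loc y y' : exists2 e : R, 0 < e & forall f g, supp (ball y e) f -> supp (ball y' e) g ->
    ip g (T f) = 0.
  apply: contrapT => no'; apply: no; exists y, y' => e e0.
  apply: contrapT => no; apply: no'; exists e => // f g sf sg.
  by apply: contrapT => fg; apply: no; exists f, g.
have bb (x : 'rV[R]_d) e : 0 < e -> borel (ball x e).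
  by move=> e0; apply: open_borel; exact: ball_open.
have loc2 m y : exists2 e : R, 0 < e & forall f g, supp (ball y e) f -> supp (ball0 m) g ->
    ip g (T f) = 0.
  apply: (compact_local (Q := fun Y => exists2 e : R, 0 < e & forall f g, supp (ball y e) f ->
    supp Y g -> ip g (T f) = 0)).
  - by exists 1 => // f g _ /(supp0_eq0 mA2) ->; rewrite ip0l.
  - move=> X Y XY [e e0 h0]; exists e => // f g sf sg; apply: h0 => //.
    by apply: supp_sub sg => z _ /XY.
  - move=> x e Y e0 [r r0 h0] [s s0 k0]; exists (Num.min r s); first by rewrite lt_min r0.
    move=> f g sf /(supp_setU mA2 (bb x e e0))[g1 [g2 [-> s1 s2]]].
    rewrite ipDl (h0 f)//; first rewrite (k0 f)// ?addr0//.
      by apply: supp_sub sf => z _; apply: le_ball; rewrite ge_min lexx orbT.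
    by apply: supp_sub sf => z _; apply: le_ball; rewrite ge_min lexx.
  - by move=> x; have [e e0 h0] := loc y x; exists e => //; exists e.
have loc3 n m f g : supp (ball0 n) f -> supp (ball0 m) g -> ip g (T f) = 0.
  apply: (compact_local (Q := fun X => forall f g, supp X f -> supp (ball0 m) g -> ip g (T f) = 0)).
  - by move=> f0 g0 /(supp0_eq0 mA1) -> _; rewrite bop0 ip0r.
  - by move=> X Y XY h0 f0 g0 sf; apply: h0; apply: supp_sub sf => z _ /XY.
  - move=> x e Y e0 h0 k0 f0 g0 /(supp_setU mA1 (bb x e e0))[f1 [f2 [-> s1 s2]]] sg.
    by rewrite bopD ipDr h0// k0// addr0.
  - by move=> x; have [e e0 h0] := loc2 m x; exists e.
apply: Th; apply: ip_eq0P => w; rewrite ipC adjbP; suff -> : adjb T w = 0 by rewrite ip0r conjc0.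
apply: (supp_bounded bA1) => n f sf; rewrite -adjbP ipC; suff -> : T f = 0 by rewrite ip0r conjc0.
by apply: (supp_bounded bA2) => m g sg; exact: loc3 sf sg.
Qed.

Variables (V1 : 'rV[R]_d -> bop E1 E1) (V2 : 'rV[R]_d -> bop E2 E2).
Hypotheses (rV1 : module_representation P V1) (rV2 : module_representation P V2).
Hypothesis V2_isom : forall x, P x -> isom (V2 x).
Hypothesis spanP : spanning_cone P.

(* If a + z is not in A2, then translating f close to a moves the support of
   T f off A2 - z near a, although T f has a nonzero part there. *)
Lemma module_translate (T : bop E1 E2) y y' : matrix_point T y y' ->
  (forall x u, P x -> T (V1 x u) = V2 x (T u)) -> forall a, A1 a -> A2 (a + (y' - y)).
Proof.
move=> mT TV a Aa; apply: contrapT => na.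
have oA : open (~` A2) by apply: closed_openC; case: mA2.
have [r /= r0 rA] : exists2 r : R, 0 < r & ball (a + (y' - y)) r `<=` ~` A2.
  by have /nbhs_ballP[r /= r0 h] := open_nbhs_nbhs (conj oA na); exists r.
have [p Pp pP] := cone_interior cP spanP.
(* The support may move by e within a ball and by e |p| along p, and e + e |p| = r. *)
pose e := r / (1 + `|p|).
have np : 0 < 1 + `|p| by apply: ltr_pwDl.
have e0 : 0 < e by rewrite divr_gt0.
have [f [g [sf sg]]] := mT e e0; apply.
(* This translation carries the ball around y into a + P, since e p absorbs the radius e; so f can
   be transported inside A1. *)
have [s [t [Ps Pt w]]] := cone_sub spanP (a + e *: p - y).
have [|f' sf' Ef] := V_transport mA1 rV1 Ps Pt sf.
  move=> q Aq; rewrite -ball_normE /= => hq; rewrite -w.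
  have -> : q + (a + e *: p - y) = a + (e *: p + (q - y)).
    by apply/rowP => i; rewrite !mxE; move: (e * p 0 i) => ?; lra.
  apply: (moduleD mA1) => //; apply: pP; first exact: ltW.
  by rewrite distrC ltW.
have E : V2 s (T f) = V2 t (T f') by rewrite -!TV// Ef.
rewrite -(V2_isom Ps) E; apply: (supp_orth (module_borel mA2) (V_supp mA2 rV2 Ps sg)
  (V_supp mA2 rV2 Pt (suppT (module_borel mA2) _))).
move=> q _ [/mem_translate hq _] [_ /mem_translate Aq]; apply: rA Aq.
move: hq; rewrite -!ball_normE /= => hq.
have -> : a + (y' - y) - (q - t) = (y' - (q - s)) - e *: p.
  apply/rowP => i; have := congr1 (fun v : 'rV[R]_d => v 0 i) w; rewrite !mxE.
  by move: (a 0 i) (y 0 i) (y' 0 i) (q 0 i) (s 0 i) (t 0 i) (e * p 0 i) => *; lra.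
apply: le_lt_trans (ler_normB _ _) _; rewrite normrZ (gtr0_norm e0).
have -> : r = e + e * `|p| by rewrite -[X in X + _]mulr1 -mulrDr divfK ?gt_eqF.
by rewrite ltrD2r.
Qed.

End localization.

Section intertwined_modules.
Variables (R : realType) (d : nat) (P : set 'rV[R]_d) (cP : is_cone P).
Hypothesis spanP : spanning_cone P.
Variables (A1 A2 : set 'rV[R]_d) (mA1 : P_module P A1) (mA2 : P_module P A2).
Variables (K1 K2 : hilbert R) (E1 : L2 A1 K1) (E2 : L2 A2 K2).
Variables (V1 : 'rV[R]_d -> bop E1 E1) (V2 : 'rV[R]_d -> bop E2 E2).
Hypotheses (rV1 : module_representation P V1) (rV2 : module_representation P V2).
Hypotheses (iV1 : forall x, P x -> isom (V1 x)) (iV2 : forall x, P x -> isom (V2 x)).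

Lemma intertwined_modules_translate (U : bop E1 E2) (u : E1) : isom U ->
  (forall x u, P x -> U (V1 x u) = V2 x (U u)) ->
  (forall x k, P x -> kerV V1 x k -> kerV V2 x (U k)) -> u <> 0 ->
  exists z, translate A1 z = A2.
Proof.
move=> iU UV kU u0; have [|y [y' mU]] := localize mA1 mA2 (T := U) (h := u).
  by move=> Uu; apply: u0; apply: nrm_eq0; rewrite -(isom_nrm u iU) Uu nrm0.
have mU' : matrix_point (adjb U) y' y.
  move=> e e0; have [f [g [sf sg fg]]] := mU e e0; exists g, f; split=> // h.
  by apply: fg; rewrite ipC adjbP h conjc0.
have UV' x w : P x -> adjb U (V2 x w) = V1 x (adjb U w).
  move=> Px; apply: ip_eqP => v; rewrite -adjbP.
  (* The adjoint intertwines because U respects the splitting of v: it maps the part orthogonal to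
     the range of V1_x to vectors orthogonal to the range of V2_x. *)
  have -> : v = (v - V1 x (adjb (V1 x) v)) + V1 x (adjb (V1 x) v) by rewrite subrK.
  set k := v - _; have kk : kerV V1 x k.
    by move=> q; rewrite ipBr (iV1 Px) (adjbP (V1 x)) subrr.
  clearbody k; rewrite bopD !ipDl UV// (iV2 Px) (iV1 Px) (kerV_ip _ (kU _ _ Px kk)) (kerV_ip _ kk).
  by rewrite (adjbP U).
exists (y' - y); apply/seteqP; split=> [b [a Aa <-]|b Ab].
  exact: (module_translate cP mA1 mA2 rV1 rV2 iV2 spanP mU UV).
apply/mem_translate; rewrite opprB.
exact: (module_translate cP mA2 mA1 rV2 rV1 iV1 spanP mU' UV').
Qed.

End intertwined_modules.

(** * Invariance of the multiplicity *)

Section multiplicity.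
Variables (R : realType) (d : nat) (P : set 'rV[R]_d) (cP : is_cone P).
Hypothesis spanP : spanning_cone P.

Lemma cone_upper_bound (s : seq 'rV[R]_d) : exists2 x, P x & forall r, r \in s -> P (x - r).
Proof.
elim: s => [|r s [x Px xs]]; first by exists 0 => //; exact: cone0.
have [a [b [Pa Pb ->]]] := cone_sub spanP r.
exists (x + a); first exact: coneD.
move=> t; rewrite in_cons => /orP[/eqP->|ts]; first last.
  by rewrite addrAC; apply: coneD => //; exact: xs.
suff -> : x + a - (a - b) = x + b by exact: coneD.
by apply/rowP => i; rewrite !mxE; lra.
Qed.

Lemma sqnorm_sum_orth (H : hilbert R) (I : finType) (u : I -> H) :
  (forall i j, i != j -> ip (u i) (u j) = 0) -> sqnorm (\sum_i u i) = \sum_i sqnorm (u i).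
Proof.
move=> u0; rewrite /sqnorm ip_suml Re_sum; apply: eq_bigr => i _; congr (Re _).
by rewrite ip_sumr (bigD1 i)//= big1 ?addr0// => j ji; rewrite u0// eq_sym.
Qed.

Variables (H1 H2 : hilbert R) (V1 : 'rV[R]_d -> bop H1 H1) (V2 : 'rV[R]_d -> bop H2 H2).
Variables (A1 A2 : set 'rV[R]_d) (A10 : A1 0) (A20 : A2 0).
Hypotheses (A1D : forall a x, A1 a -> P x -> A1 (a + x)) (A2D : forall a x, A2 a -> P x -> A2 (a + x)).
Variables (n : nat) (f1 : 'I_n.+1 -> 'rV[R]_d -> H1) (f2 : 'I_n -> 'rV[R]_d -> H2).
Variable kap : 'rV[R]_d -> 'rV[R]_d -> R.
Hypotheses (kapD : forall q r x, kap (q + x) (r + x) = kap q r) (kap_gt0 : 0 < kap 0 0).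
Hypothesis f1_ip : forall i j q r, A1 q -> A1 r ->
  ip (f1 i q) (f1 j r) = (i == j)%:R * (kap q r)%:C.
Hypothesis f2_ip : forall i j q r, A2 q -> A2 r ->
  ip (f2 i q) (f2 j r) = (i == j)%:R * (kap q r)%:C.
Hypothesis V1_f1 : forall x i q, P x -> A1 q -> V1 x (f1 i q) = f1 i (q + x).
Hypothesis V2_f2 : forall x i q, P x -> A2 q -> V2 x (f2 i q) = f2 i (q + x).
Hypothesis V2_isom : forall x, P x -> isom (V2 x).
Hypothesis f2_total : forall h, (forall i q, A2 q -> ip (f2 i q) h = 0) -> h = 0.
Variable U : bop H1 H2.
Hypotheses (U_isom : isom U) (UV : forall x u, P x -> U (V1 x u) = V2 x (U u)).

Let approx (h : H2) (e : R) : 0 < e -> exists s : 'I_n -> seq (R[i] * 'rV[R]_d),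
  (forall l t, t \in s l -> A2 t.2) /\
  sqnorm (h - \sum_l \sum_(t <- s l) t.1 *: f2 l t.2) < e.
Proof.
move=> e0; pose f (p : 'I_n * {r : 'rV[R]_d | A2 r}) := f2 p.1 (sval p.2).
have tf : total f.
  by move=> u u0; apply: f2_total => i q Aq; exact: (u0 (i, exist _ q Aq)).
have : [set: H2] h by []; rewrite -(total_dense tf) closureP => /(_ (Num.sqrt e)).
rewrite sqrtr_gt0 => /(_ e0) [_ [N [c [v [vr ->]]]] hlt].
have pick m : exists p, f p = v m by have [p _ pv] := vr m; exists p.
have [p pP] := choice pick.
exists (fun l => [seq (c m, sval (p m).2) | m <- enum 'I_N & (p m).1 == l]); split.
  by move=> l t /mapP[m _ ->]; exact: (svalP (p m).2).
rewrite -sqr_nrm -[ltRHS]sqr_sqrtr ?ltW// ltr_pXn2r ?nnegrE ?nrm_ge0 ?sqrtr_ge0//.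
rewrite (_ : \sum_(l < n) _ = \sum_i c i *: v i)//.
rewrite (partition_big (fun m => (p m).1) predT)//=; apply: eq_bigr => l _.
rewrite big_map big_filter big_enum_cond; apply: eq_big => [m|m /eqP pl]; first by [].
by rewrite -pP /f pl.
Qed.

(* Writing U f_i as a limit of sums of translates of the n vectors of the
   second family and moving all of these to one point x, the n + 1 orthonormal
   vectors U f_i are paired with n orthogonal vectors only. *)
Lemma multiplicity_contradiction : False.
Proof.
(* The counting below yields k0 <= (n + 1) e, and this e makes the right side k0 - e. *)
pose k0 := kap 0 0; pose e := k0 / n.+2%:R.
have e0 : 0 < e by rewrite divr_gt0// ltr0n.
have [s sP] := choice (fun i => approx (U (f1 i 0)) e0).
have [x Px xs] := cone_upper_bound (flatten [seq [seq t.2 | t <- s p.1 p.2] | p <- enum {: 'I_n.+1 * 'I_n}]).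
have {}xs i l t : t \in s i l -> P (x - t.2).
  move=> ts; apply: xs; apply/flattenP; exists [seq t.2 | t <- s i l]; last exact: map_f.
  by apply/mapP; exists (i, l); rewrite ?mem_enum.
have A2s i l t : t \in s i l -> A2 t.2 by move=> ts; apply: (sP i).1 ts.
have P1 r : P r -> A1 r by move=> Pr; rewrite -[r]add0r; exact: A1D.
have P2 r : P r -> A2 r by move=> Pr; rewrite -[r]add0r; exact: A2D.
pose g i l := \sum_(t <- s i l) t.1 *: f2 l t.2.
(* Applying V2_(x - t.2) to both sides of an inner product moves f2 at t.2 to x and f1 at 0 to x -
   t.2; the coefficient changes sides, hence the conjugate. *)
pose h i l := \sum_(t <- s i l) conjc t.1 *: f1 i (x - t.2).
have gh i l : ip (g i l) (U (f1 i 0)) = ip (f2 l x) (U (h i l)).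
  rewrite /g /h ip_suml bop_sum ip_sumr; apply: eq_big_seq => t ts.
  rewrite ipZl bopZ ipZr; congr (_ * _).
  have Pt := xs _ _ _ ts; rewrite -(V2_isom Pt) -UV// V2_f2 ?V1_f1//; last exact: A2s ts.
  by rewrite add0r addrC subrK.
have norm_gh i l : sqnorm (h i l) = sqnorm (g i l).
  rewrite /sqnorm /g /h !ip_suml !Re_sum.
  under eq_bigr do rewrite ip_sumr Re_sum.
  under [RHS]eq_bigr do rewrite ip_sumr Re_sum.
  rewrite [RHS]exchange_big; apply: eq_big_seq => t ts; apply: eq_big_seq => t' ts'.
  have [At At'] := (A2s _ _ _ ts, A2s _ _ _ ts').
  have [Bt Bt'] := (P1 _ (xs _ _ _ ts), P1 _ (xs _ _ _ ts')).
  rewrite !ipZl !ipZr f1_ip// f2_ip//.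
  (* Reflection through x reverses differences, so the arguments swap; this compensates the
     conjugation of the coefficients. *)
  have -> : kap (x - t.2) (x - t'.2) = kap t'.2 t.2.
    rewrite -[RHS](kapD _ _ (x - t.2 - t'.2)); congr (kap _ _).
      by rewrite subrKC.
    by rewrite addrA subrKC.
  by rewrite !eqxx conjcK mulrCA.
have gg i : sqnorm (\sum_l g i l) = \sum_l sqnorm (g i l).
  apply: sqnorm_sum_orth => l l' ll'; rewrite /g ip_suml big1_seq// => t /andP[_ ts].
  rewrite ip_sumr big1_seq// => t' /andP[_ ts'].
  by rewrite ipZl ipZr f2_ip ?(negbTE ll') ?mul0r ?mulr0//; apply: A2s; eassumption.
have hh l : sqnorm (\sum_i h i l) = \sum_i sqnorm (h i l).
  apply: sqnorm_sum_orth => i i' ii'; rewrite /h ip_suml big1_seq// => t /andP[_ ts].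
  rewrite ip_sumr big1_seq// => t' /andP[_ ts'].
  by rewrite ipZl ipZr f1_ip ?(negbTE ii') ?mul0r ?mulr0//; apply/P1/xs; eassumption.
have U1 i : sqnorm (U (f1 i 0)) = k0 by rewrite /sqnorm U_isom f1_ip// eqxx mul1r.
have F2 l : sqnorm (f2 l x) = k0.
  by rewrite /sqnorm f2_ip ?eqxx ?mul1r; [|exact: P2..]; rewrite -[x]add0r kapD.
have lower i : k0 + sqnorm (\sum_l g i l) - 2 * Re (ip (U (f1 i 0)) (\sum_l g i l)) < e.
  by have := (sP i).2; rewrite sqnormB U1.
have upper l : 2 * Re (ip (f2 l x) (U (\sum_i h i l))) <= k0 + sqnorm (\sum_i h i l).
  have := sqnorm_ge0 (f2 l x - U (\sum_i h i l)).
  by rewrite sqnormB F2 {1}/sqnorm U_isom -/(sqnorm _) subr_ge0.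
have E1 : \sum_i 2 * Re (ip (U (f1 i 0)) (\sum_l g i l)) =
    \sum_l 2 * Re (ip (f2 l x) (U (\sum_i h i l))).
  rewrite -!mulr_sumr; congr (_ * _).
  under eq_bigr => i _ do rewrite ipC cReJ ip_suml Re_sum.
  under [RHS]eq_bigr => l _ do rewrite bop_sum ip_sumr Re_sum.
  by rewrite exchange_big; apply: eq_bigr => l _; apply: eq_bigr => i _; rewrite gh.
have E2 : \sum_i sqnorm (\sum_l g i l) = \sum_l sqnorm (\sum_i h i l).
  under eq_bigr => i _ do rewrite gg.
  under [RHS]eq_bigr => l _ do rewrite hh.
  by rewrite exchange_big; apply: eq_bigr => l _; apply: eq_bigr => i _; rewrite norm_gh.
have S1 : \sum_(i < n.+1) (k0 + sqnorm (\sum_l g i l) - 2 * Re (ip (U (f1 i 0)) (\sum_l g i l)))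
    <= \sum_(i < n.+1) e by apply: ler_sum => i _; exact: (ltW (lower i)).
have S2 : \sum_l 2 * Re (ip (f2 l x) (U (\sum_i h i l))) <= \sum_l (k0 + sqnorm (\sum_i h i l)).
  by apply: ler_sum => l _; exact: upper.
(* The n + 1 bounds [lower] and the n bounds [upper] share the same cross term and the same total
   norm; eliminating both leaves one copy of k0. *)
move: S1 S2; rewrite !sumrB !big_split /= E1 E2 !sumr_const !card_ord => S1 S2.
have : k0 <= e *+ n.+1 by move: S1; rewrite [k0 *+ n.+1]mulrS; lra.
have -> : e *+ n.+1 = k0 - e.
  have -> : k0 = e *+ n.+2 by rewrite -mulr_natr divfK// pnatr_eq0.
  by rewrite [in RHS]mulrSr addrK.
lra.
Qed.

End multiplicity.

(** * An exponential function on a simplicial subcone *)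

Section exponential_integrals.
Variable R : realType.
Local Notation RT := (measurableTypeR R).
Local Notation lam := (@lebesgue_measure R).
Local Open Scope ereal_scope.

Lemma integral_exp_abs_lty : \int[lam]_x (expR (- `|x|))%:E < +oo.
Proof.
rewrite ge0_symfun_integralT; first last.
- by move=> x /=; rewrite normrN.
- move=> x; apply: continuous_comp; last exact: continuous_expR.
  by apply: continuousN; exact: norm_continuous.
- by move=> x; exact: expR_ge0.
rewrite lte_mul_pinfty//.
have m0 : measurable [set x : R | (0 <= x)%R] by rewrite -set_itvcy; exact: measurable_itv.
apply: (@le_lt_trans _ _ 1); last exact: ltry.
rewrite -(@integral_exponential_pdf R 1 ltr01).
apply: (@le_trans _ _ (\int[lam]_(x in [set x : R | (0 <= x)%R]) (exponential_pdf 1 x)%:E)).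
  rewrite le_eqVlt; apply/orP; left; apply/eqP/eq_integral => x; rewrite inE /= => x0.
  by rewrite exponential_pdfE// mul1r mulN1r ger0_norm.
apply: ge0_subset_integral => //.
- by apply/measurable_EFinP; exact: measurable_exponential_pdf.
- by move=> x _; rewrite lee_fin exponential_pdf_ge0.
Qed.

Lemma measurable_exp_abs_tuple n :
  measurable_fun setT (fun t : n.-tuple RT => expR (- \sum_(i < n) `|tnth t i|)).
Proof.
apply: measurableT_comp => //; apply: measurableT_comp => //.
apply: measurable_sum => i; apply: measurableT_comp => //; exact: measurable_tnth.
Qed.

Lemma integral_exp_abs_tuple_lty n :
  \int[@lebesgue_tuple R n]_t (expR (- \sum_(i < n) `|tnth t i|))%:E < +oo.
Proof.
elim: n => [|n IH].
  rewrite /= integral_dirac//; last by apply/measurable_EFinP; exact: measurable_exp_abs_tuple.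
  by rewrite diracT mul1e ltry.
rewrite /= ge0_integral_pushforward//; first last.
- by apply/measurable_EFinP; exact: (@measurable_exp_abs_tuple n.+1).
- exact: measurable_tcons.
rewrite preimage_setT fubini_tonelli1; first last.
- by move=> p; rewrite lee_fin expR_ge0.
- apply: measurableT_comp (@measurable_tcons R n).
  by apply/measurable_EFinP; exact: (@measurable_exp_abs_tuple n.+1).
set I := \int[_]_t _ in IH.
have I0 : 0 <= I by apply: integral_ge0 => t _; rewrite lee_fin expR_ge0.
have FE x : fubini_F (lebesgue_tuple n) ((fun t : n.+1.-tuple RT =>
    (expR (- \sum_(i < n.+1) `|tnth t i|))%:E) \o @tcons R n) x = (expR (- `|x|))%:E * I.
  rewrite /fubini_F -ge0_integralZl//.
  - apply: eq_integral => t _ /=; rewrite -EFinM -expRD; congr (expR _)%:E.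
    rewrite big_ord_recl opprD /tcons tnth0; congr (_ - _)%R.
    by apply: eq_bigr => i _; rewrite tnthS.
  - by apply/measurable_EFinP; exact: measurable_exp_abs_tuple.
under eq_integral do rewrite FE.
have Ifin : I \is a fin_num by rewrite ge0_fin_numE.
rewrite -(fineK Ifin) ge0_integralZr//.
- by rewrite muleC lte_mul_pinfty ?integral_exp_abs_lty// lee_fin fine_ge0.
- apply/measurable_EFinP; apply: measurableT_comp => //; apply: measurableT_comp => //.
- by rewrite lee_fin fine_ge0.
Qed.

End exponential_integrals.

Section simplicial_cone.
Variables (R : realType) (d : nat) (P : set 'rV[R]_d) (cP : is_cone P).
Hypothesis spanP : spanning_cone P.

(** The rows r p + delta_j lie in P by [cone_interior]. The matrix is a rank-one perturbation of the
    identity, inverted by the Sherman-Morrison formula when 1 + r s is nonzero. *)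
Lemma simplicial_subcone : exists B C : 'M[R]_d, [/\ B *m C = 1%:M, C *m B = 1%:M &
  forall z : 'rV[R]_d, (forall j, 0 <= z ord0 j) -> P (z *m B)].
Proof.
have [p Pp pP] := cone_interior cP spanP.
pose s := \sum_i p ord0 i.
(* r = 1 works unless s = -1, and then r = 2 gives 1 + 2 s = -1. *)
have [r r1 rs] : exists2 r : R, 1 <= r & 1 + r * s != 0.
  have [s0|s0] := eqVneq (1 + s) 0; last by exists 1 => //; rewrite mul1r.
  exists 2; first by rewrite ler1n.
  by have -> : 1 + 2 * s = -1 by lra.
pose J : 'M[R]_d := const_mx 1 *m (r *: p).
have JJ : J *m J = (r * s) *: J.
  apply/matrixP => i j; rewrite /J mulmxA -(mulmxA _ (r *: p)).
  rewrite (_ : (r *: p) *m const_mx 1 = (r * s)%:M).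
    by rewrite mul_mx_scalar -scalemxAl.
  apply/matrixP => i' j'; rewrite !ord1 !mxE eqxx mulr1n mulr_sumr.
  by apply: eq_bigr => k _; rewrite !mxE mulr1.
pose k := (1 + r * s)^-1.
have BC : (1%:M + J) *m (1%:M - k *: J) = 1%:M.
  rewrite mulmxBr mulmx1 mulmxDl mul1mx -scalemxAr JJ scalerA -addrA.
  have -> : J - (k *: J + (k * (r * s)) *: J) = 0.
    have k1 : k + k * (r * s) = 1 by rewrite -{1}[k]mulr1 -mulrDr mulVf.
    by rewrite -scalerDl k1 scale1r subrr.
  by rewrite addr0.
exists (1%:M + J), (1%:M - k *: J); split=> //; first exact: mulmx1C.
move=> z z0; rewrite mulmx_sum_row; apply: cone_sum => // j; apply: coneZ => //.
have -> : row j (1%:M + J) = r *: p + delta_mx ord0 j.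
  apply/rowP => i; rewrite !mxE big_ord1 !mxE mul1r addrC eqxx.
  by rewrite [j == i]eq_sym.
apply: pP; first exact: le_trans r1.
apply: le_trans r1; rewrite {1}/Num.Def.normr /= mx_normrE; apply/bigmax_leP; split=> // -[a b] _ /=.
by rewrite mxE; case: (_ && _); rewrite ?normr1 ?normr0.
Qed.

End simplicial_cone.

Section exponential_profile.
Variables (R : realType) (d : nat) (B C : 'M[R]_d).
Hypotheses (BC : B *m C = 1%:M) (CB : C *m B = 1%:M).
Implicit Types (x y a : 'rV[R]_d).
Local Notation RT := (measurableTypeR R).
Local Notation rowt := (@rowt R d).

Definition simplicial : set 'rV[R]_d := [set y | forall j, 0 <= (y *m C) ord0 j].

(** A linear functional; its factor is large enough for it to dominate the sum of the |y_i| on the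
    cone, which makes the profile square-integrable. *)
Definition slope y := (\sum_j \sum_i `|B j i|) * \sum_j (y *m C) ord0 j.

Definition profile y := if y \in simplicial then expR (- slope y) else 0.

Lemma slopeD x y : slope (x + y) = slope x + slope y.
Proof.
by rewrite /slope mulmxDl -mulrDr -big_split /=; congr (_ * _); apply: eq_bigr => j _; rewrite mxE.
Qed.

Lemma simplicialD x y : simplicial x -> simplicial y -> simplicial (x + y).
Proof. by move=> hx hy j; rewrite mulmxDl mxE addr_ge0. Qed.

Lemma simplicial_cone : is_cone simplicial.
Proof.
split.
- by move=> j; rewrite mul0mx mxE.
- exact: simplicialD.
- by move=> a y a0 hy j; rewrite -scalemxAl mxE mulr_ge0.
Qed.

Lemma simplicial_spanning : spanning_cone simplicial.
Proof.
apply/seteqP; split=> // y _; pose z := y *m C.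
exists ((\row_j Num.max (z ord0 j) 0) *m B).
  by move=> j; rewrite -mulmxA BC mulmx1 mxE le_max lexx orbT.
exists ((\row_j Num.max (- z ord0 j) 0) *m B).
  by move=> j; rewrite -mulmxA BC mulmx1 mxE le_max lexx orbT.
rewrite -mulmxBl -[RHS]mulmx1 -CB mulmxA; congr (_ *m _); apply/rowP => j; rewrite !mxE -/z.
have -> : \sum_j0 y ord0 j0 * C j0 j = z ord0 j by rewrite mxE.
by case: (lerP 0 (z ord0 j)) => h; case: (lerP 0 (- z ord0 j)) => h'; rewrite /Order.max; do ?case: ifP; lra.
Qed.

Lemma profile_in y : simplicial y -> profile y = expR (- slope y).
Proof. by move=> hy; rewrite /profile mem_set. Qed.

Lemma profile_out y : ~ simplicial y -> profile y = 0.
Proof. by move=> hy; rewrite /profile memNset. Qed.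

Lemma profile_ge0 y : 0 <= profile y.
Proof. by rewrite /profile; case: ifP => // _; exact: expR_ge0. Qed.

(** The reason for an exponential: where two translates of the profile are both nonzero, they are
    proportional. *)
Lemma profile_shift y a : simplicial (y - a) -> profile (y - a) = expR (slope a) * expR (- slope y).
Proof.
move=> ya; rewrite profile_in// -expRD; congr expR.
by have := slopeD (y - a) a; rewrite subrK => ->; lra.
Qed.

Lemma sum_norm_slope y : simplicial y -> \sum_i `|y ord0 i| <= slope y.
Proof.
move=> hy; have yE : y = (y *m C) *m B by rewrite -mulmxA CB mulmx1.
pose z := y *m C; apply: (@le_trans _ _ (\sum_i \sum_j z ord0 j * `|B j i|)).
  apply: ler_sum => i _; rewrite yE mxE; apply: le_trans (ler_norm_sum _ _ _) _.
  by apply: ler_sum => j _; rewrite normrM ger0_norm//; exact: hy.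
rewrite exchange_big /slope mulr_sumr /=; apply: ler_sum => j _.
rewrite -mulr_sumr mulrC ler_wpM2r ?(hy j)//.
by rewrite [leRHS](bigD1 j)//= lerDl sumr_ge0// => k _; exact: sumr_ge0.
Qed.

Lemma measurable_coord j : measurable_fun setT (fun t : d.-tuple RT => (rowt t *m C) ord0 j).
Proof.
have -> : (fun t : d.-tuple RT => (rowt t *m C) ord0 j) = fun t => \sum_i tnth t i * C i j.
  by apply/funext => t; rewrite mxE; apply: eq_bigr => i _; rewrite mxE.
apply: measurable_sum => i; apply: measurable_realfun.measurable_funM => //; exact: measurable_tnth.
Qed.

Lemma measurable_slope : measurable_fun setT (fun t : d.-tuple RT => slope (rowt t)).
Proof.
apply: measurable_realfun.measurable_funM => //.
by apply: measurable_sum => j; exact: measurable_coord.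
Qed.

Lemma borel_simplicial : borel simplicial.
Proof.
have -> : simplicial = \bigcap_(j in [set: 'I_d]) [set y | 0 <= (y *m C) ord0 j].
  by apply/seteqP; split=> y hy j; [move=> _|]; exact: hy.
rewrite /borel preimage_bigcap; apply: fin_bigcap_measurable => // j _.
have := @measurable_coord j measurableT _ (measurable_itv `[0, +oo[%R); rewrite setTI.
by congr measurable; apply/seteqP; split=> t /=; rewrite in_itv /= andbT.
Qed.

Lemma measurable_profile : measurable_fun setT (fun t : d.-tuple RT => profile (rowt t)).
Proof.
apply: measurable_fun_ifT => //.
- apply: (measurable_fun_bool true); rewrite setTI.
  have -> : (fun t => rowt t \in simplicial) @^-1` [set true] = rowt @^-1` simplicial.
    by apply/seteqP; split=> t /=; [move/set_mem|move/mem_set].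
  exact: borel_simplicial.
- by apply: measurableT_comp => //; apply: measurableT_comp => //; exact: measurable_slope.
Qed.

Lemma profile_sq_le y : profile y ^+ 2 <= expR (- \sum_i `|y ord0 i|).
Proof.
have [hy|hy] := pselect (simplicial y); last by rewrite profile_out// expr0n expR_ge0.
rewrite profile_in// expr2 -expRD ler_expR; have := sum_norm_slope hy.
have : 0 <= \sum_i `|y ord0 i| by exact: sumr_ge0.
lra.
Qed.

Lemma profile_sq_lty : (leb_int setT (fun y => (profile y ^+ 2)%:E) < +oo)%E.
Proof.
apply: le_lt_trans (@integral_exp_abs_tuple_lty R d); rewrite /leb_int preimage_setT.
apply: ge0_le_integral => //.
- by move=> t _; rewrite lee_fin sqr_ge0.
- by apply/measurable_EFinP/measurable_funX; exact: measurable_profile.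
- by apply/measurable_EFinP; exact: measurable_exp_abs_tuple.
- move=> t _; rewrite lee_fin; apply: le_trans (profile_sq_le _) _.
  by under eq_bigr do rewrite mxE.
Qed.

Variable K : hilbert R.

Lemma open_line (Q : set K) v : open Q -> open [set s : R | Q (s%:C *: v)].
Proof.
move=> oQ; rewrite openE => s Qs.
have /nbhs_ballP[e /= e0 eB] := open_nbhs_nbhs (conj oQ Qs).
have [e1 eE] := gt0_complex e0; have nv : 0 < 1 + nrm v by rewrite ltr_pwDl// nrm_ge0.
apply/nbhs_ballP; exists (Re e / (1 + nrm v)); first by rewrite /= divr_gt0.
move=> t; rewrite -ball_normE /= => st; apply: eB; rewrite -ball_normE /= normE eE ltcR.
rewrite -scalerBl -real_complexB nrmZ cab_real; move: st; rewrite ltr_pdivlMr//.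
by apply: le_lt_trans; rewrite mulrDr mulr1 lerDr.
Qed.

Lemma sq_profile v : sq_integrable setT (fun y => (profile y)%:C *: v : K).
Proof.
split=> [Q oQ|].
  rewrite setTI; have := @measurable_profile measurableT _ (open_measurable (open_line (v := v) oQ)).
  by rewrite setTI.
have -> : (fun y => (sqnorm ((profile y)%:C *: v))%:E) = fun y => ((sqnorm v)%:E * (profile y ^+ 2)%:E)%E.
  by apply/funext => y; rewrite sqnormZ cab_real ger0_norm ?profile_ge0// -EFinM mulrC.
rewrite /leb_int preimage_setT ge0_integralZl//.
- rewrite lte_mul_pinfty// ?lee_fin ?sqnorm_ge0//.
  by have := profile_sq_lty; rewrite /leb_int preimage_setT.
- by apply/measurable_EFinP/measurable_funX; exact: measurable_profile.
- by move=> t _; rewrite lee_fin sqr_ge0.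
- by rewrite lee_fin sqnorm_ge0.
Qed.

End exponential_profile.

(** * Orthants generate the Borel sets, and orthogonality to the profiles *)

Section orthants.
Variables (R : realType) (d : nat) (B C : 'M[R]_d).
Hypotheses (BC : B *m C = 1%:M) (CB : C *m B = 1%:M).
Implicit Types (x y a b : 'rV[R]_d).
Local Notation RT := (measurableTypeR R).
Local Notation rowt := (@rowt R d).
Local Notation mu := (@lebesgue_tuple R d).
Local Notation S := (simplicial C).

Definition orthants : set (set (d.-tuple RT)) := range (fun a => rowt @^-1` translate S a).

Lemma mem_orthant a t : (rowt @^-1` translate S a) t <->
  forall j, (a *m C) ord0 j <= (rowt t *m C) ord0 j.
Proof.
rewrite /= mem_translate /simplicial /= mulmxBl; split=> h j; have := h j; rewrite !mxE subr_ge0//.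
Qed.

Definition corner a b : 'rV[R]_d := (\row_j Num.max ((a *m C) ord0 j) ((b *m C) ord0 j)) *m B.

Lemma orthantI a b : rowt @^-1` translate S a `&` rowt @^-1` translate S b =
  rowt @^-1` translate S (corner a b).
Proof.
apply/seteqP; split=> t.
  move=> [/mem_orthant ha /mem_orthant hb]; apply/mem_orthant => j.
  by rewrite -mulmxA BC mulmx1 mxE ge_max ha hb.
move=> /mem_orthant h; split; apply/mem_orthant => j; have := h j;
  by rewrite -mulmxA BC mulmx1 mxE ge_max => /andP[].
Qed.

Lemma measurable_orthants : @measurable _ (d.-tuple RT) = <<s orthants >>.
Proof.
apply/seteqP; split; last first.
  apply: smallest_sub; first exact: sigma_algebra_measurable.
  move=> _ [a _ <-]; exact: (borel_translate a (borel_simplicial C)).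
pose T := g_sigma_algebraType orthants.
have mcoord j : measurable_fun [set: T] (fun t : T => (rowt t *m C) ord0 j).
  apply: (measurability (@RGenCInfty.G R)); first exact: RGenCInfty.measurableE.
  move=> _ [_ [x ->] <-]; rewrite setTI.
  (* A half-space in coordinate j is the union of the orthants whose other coordinates are bounded
     below by -n. *)
  pose a (n : nat) : 'rV[R]_d := (\row_k (if k == j then x else - n%:R)) *m B.
  have -> : (fun t : T => (rowt t *m C) ord0 j) @^-1` `[x, +oo[%classic =
      \bigcup_n (rowt @^-1` translate S (a n)).
    apply/seteqP; split=> t.
      rewrite /= in_itv /= andbT => xt.
      exists (Num.truncn `|rowt t *m C|).+1 => //; apply/mem_orthant => k.
      rewrite -mulmxA BC mulmx1 mxE; case: eqP => [->//|_].
      rewrite lerNl; apply: le_trans (ler_norm _) _; rewrite normrN.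
      apply: le_trans (coord_le _ _) _; apply: ltW; exact: truncnS_gt.
    move=> [n _ /mem_orthant /(_ j)]; rewrite -mulmxA BC mulmx1 mxE eqxx /= in_itv /= andbT.
    by [].
  apply: bigcup_measurable => n _; apply: sub_sigma_algebra; by exists (a n).
have mid : measurable_fun [set: T] (fun t : T => (t : d.-tuple RT)).
  apply/measurable_fun_tnthP => i.
  have -> : (tnth (T := RT))^~ i \o (fun t : T => (t : d.-tuple RT)) =
      fun t : T => \sum_j (rowt t *m C) ord0 j * B j i.
    apply/funext => t /=; have -> : tnth t i = rowt t ord0 i by rewrite mxE.
    by rewrite -[in LHS](mulmx1 (rowt t)) -CB mulmxA mxE.
  apply: measurable_sum => j; exact: measurable_realfun.measurable_funM.
by move=> X mX; have := mid measurableT X mX; rewrite setTI.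
Qed.

(** On a smaller orthant c + S the profile at a is a multiple of the profile at c, so p_a u has
    integral 0 over every orthant meet a + S. Orthants form a pi-system generating the Borel sets,
    hence p_a u = 0 almost everywhere, and p_a is positive on a + S. *)
Lemma profile_orth_ae (u : 'rV[R]_d -> R) a :
  measurable_fun setT (fun t => u (rowt t)) ->
  (leb_int setT (fun y => (u y ^+ 2)%:E) < +oo)%E ->
  (forall b, S (b - a) -> fine (leb_int setT (fun y => (profile B C (y - b) * u y)%:E)) = 0) ->
  {ae mu, forall t, S (rowt t - a) -> u (rowt t) = 0}.
Proof.
move=> mu_ usq u0; pose p b (t : d.-tuple RT) := profile B C (rowt t - b).
have mp b : measurable_fun setT (p b).
  have -> : p b = (fun t => profile B C (rowt t)) \o ttrans (- b).
    by apply/funext => t; rewrite /p /= rowt_ttrans.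
  by apply: measurableT_comp; [exact: measurable_profile|exact: measurable_ttrans].
have mpu b : measurable_fun setT (fun t => (p b t * u (rowt t))%:E).
  by apply/measurable_EFinP/measurable_realfun.measurable_funM.
have psq b : (\int[mu]_t ((p b t) ^+ 2)%:E < +oo)%E.
  have := profile_sq_lty CB; rewrite -(leb_int_translate setT b).
  rewrite /leb_int (_ : rowt @^-1` _ = setT)//.
  by apply/seteqP; split=> // t _; apply/mem_translate.
have ipu b : mu.-integrable setT (fun t => (p b t * u (rowt t))%:E).
  apply/integrableP; split; first exact: mpu.
  apply: (@le_lt_trans _ _ (\int[mu]_t ((p b t ^+ 2)%:E + (u (rowt t) ^+ 2)%:E))%E).
    apply: ge0_le_integral => //.
    - by apply: measurableT_comp => //; exact: mpu.
    - by apply: emeasurable_funD; apply/measurable_EFinP/measurable_funX.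
    - move=> t _; rewrite -EFinD lee_fin normrM.
      rewrite -[p b t ^+ 2]real_normK ?num_real// -[u _ ^+ 2]real_normK ?num_real//.
      have := sqr_ge0 (`|p b t| - `|u (rowt t)|); have := sqr_ge0 (`|p b t| + `|u (rowt t)|).
      by rewrite !expr2; nra.
  rewrite ge0_integralD//; first last.
  - by apply/measurable_EFinP/measurable_funX.
  - by move=> t _; rewrite lee_fin sqr_ge0.
  - by apply/measurable_EFinP/measurable_funX.
  - by move=> t _; rewrite lee_fin sqr_ge0.
  by rewrite lte_add_pinfty//; have := usq; rewrite /leb_int preimage_setT.
have ipu0 b : S (b - a) -> (\int[mu]_t (p b t * u (rowt t))%:E = 0)%E.
  move=> Sb; rewrite -[LHS]fineK; last exact: integrable_fin_num (ipu b).
  by have := u0 b Sb; rewrite /leb_int preimage_setT => ->.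
pose g t := (p a t * u (rowt t))%:E.
have Pg X : <<s orthants >> X -> (\int[mu]_(t in X) g t = 0)%E.
  apply: (dynkin_induction (P := fun X => (\int[mu]_(t in X) g t = 0)%E)).
  - exact: measurable_orthants.
  - by move=> _ _ [b _ <-] [c _ <-]; exists (corner b c) => //; rewrite orthantI.
  - by apply: ipu0; rewrite subrr; exact: cone0 (simplicial_cone C).
  - move=> _ [b _ <-]; set c := corner b a.
    have Sc : S (c - a) by move=> j; rewrite mulmxBl -mulmxA BC mulmx1 !mxE subr_ge0 le_max lexx orbT.
    rewrite integral_mkcond -(mule0 (expR (slope B C a - slope B C c))%:E) -(ipu0 c Sc).
    rewrite -integralZl//; apply: eq_integral => t _; rewrite patchE /g /p -EFinM.
    have ct : (rowt @^-1` translate S c) t <-> (rowt @^-1` translate S b) t /\ (rowt @^-1` translate S a) t.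
      by rewrite -orthantI.
    case: ifPn => [/set_mem tb|/negP tb].
      have [/mem_translate ta|ta] := pselect ((rowt @^-1` translate S a) t).
        rewrite profile_shift// profile_shift//; last by apply/mem_translate/ct; split=> //; exact/mem_translate.
        have e1 : expR (slope B C a) = expR (slope B C a - slope B C c) * expR (slope B C c).
          by rewrite -expRD subrK.
        by rewrite e1 !mulrA.
      rewrite profile_out; last by move=> h; apply/ta/mem_translate.
      rewrite profile_out; first by rewrite !mul0r mulr0.
      by move=> /mem_translate/ct[_].
    rewrite profile_out ?mul0r ?mulr0//.
    by move=> /mem_translate/ct[h _]; apply: tb; exact: mem_set.
  - move=> Z mZ Z0; have := ipu0 a; rewrite subrr => /(_ (cone0 (simplicial_cone C))).
    rewrite -(setUv Z) integral_setU_EFin//; first last.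
    - by rewrite disj_set2E setICr.
    - by rewrite setUv; apply/measurable_EFinP; exact: mpu.
    - exact: measurableC.
    by rewrite Z0 add0e.
  - move=> F mF tF F0; rewrite integral_bigcup//; first by rewrite eseries0.
    by apply: integrableS (ipu a) => //; exact: bigcupT_measurable.
have : ae_eq mu setT g (cst 0%E).
  apply: integral_ae_eq => //; first exact: ipu.
  by move=> X _ mX; rewrite integral_cst// mul0e; apply: Pg; rewrite -measurable_orthants.
apply: filterS => t /(_ I) gt0 St; move: gt0; rewrite /g /p profile_in//= => -[] /eqP.
by rewrite mulf_eq0 gt_eqF ?expR_gt0//= => /eqP.
Qed.

End orthants.

Section profile_vectors.
Variables (R : realType) (d : nat) (B C : 'M[R]_d).
Hypotheses (BC : B *m C = 1%:M) (CB : C *m B = 1%:M).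
Implicit Types (x y q r a : 'rV[R]_d).
Local Notation RT := (measurableTypeR R).
Local Notation rowt := (@rowt R d).
Local Notation mu := (@lebesgue_tuple R d).
Local Notation S := (simplicial C).

Definition profile_gram q r : R :=
  fine (leb_int setT (fun y => (profile B C (y - q) * profile B C (y - r))%:E)).

Lemma translateT x : translate setT x = [set: 'rV[R]_d].
Proof. by apply/seteqP; split=> // y _; apply/mem_translate. Qed.

Lemma profile_gramD q r x : profile_gram (q + x) (r + x) = profile_gram q r.
Proof.
rewrite /profile_gram -[in RHS](leb_int_translate setT x) translateT; congr (fine (leb_int _ _)).
by apply/funext => y; rewrite !opprD !addrA ![y - _ - x]addrAC.
Qed.

(** Otherwise the translates of S by -n p, whose union is the whole space, would all be null; p has
    all its cone coordinates equal to 1. *)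
Lemma simplicial_not_null : ~ mu.-negligible (rowt @^-1` S).
Proof.
move=> S0; pose p : 'rV[R]_d := const_mx 1 *m B.
have S0n n : mu.-negligible (rowt @^-1` translate S (- (n%:R *: p))).
  have [N [mN N0 SN]] := S0; exists (ttrans (n%:R *: p) @^-1` N); split.
  - by rewrite -[X in measurable X]setTI; exact: measurable_ttrans.
  - by rewrite lebesgue_tuple_translation.
  - move=> t /= /mem_translate; rewrite opprK => ht; apply: SN.
    by rewrite /= rowt_ttrans.
have := negligible_bigcup S0n; rewrite (_ : \bigcup_n _ = setT).
  move=> /(measure_negligible measurableT) h; have := lebesgue_tupleT_gt0 R d.
  by rewrite h ltxx.
apply/seteqP; split=> // t _; exists (Num.truncn `|rowt t *m C|).+1 => //=.
apply/mem_translate => j; rewrite opprK mulmxDl -scalemxAl /p -mulmxA BC mulmx1 !mxE mulr1.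
rewrite -lerBlDl sub0r; apply: le_trans (ler_norm _) _; rewrite normrN.
have := coord_le (rowt t *m C) j; rewrite mxE => h; apply: le_trans h _.
apply: ltW; exact: truncnS_gt.
Qed.

Lemma profile_gram_gt0 : 0 < profile_gram 0 0.
Proof.
have pE : profile_gram 0 0 = fine (\int[mu]_t `|(profile B C (rowt t) ^+ 2)%:E|)%E.
  rewrite /profile_gram /leb_int preimage_setT; congr fine; apply: eq_integral => t _.
  by rewrite subr0 -expr2 gee0_abs// lee_fin sqr_ge0.
have mp2 : measurable_fun setT (fun t => (profile B C (rowt t) ^+ 2)%:E).
  by apply/measurable_EFinP/measurable_funX; exact: measurable_profile.
have I0 : (0 <= \int[mu]_t `|(profile B C (rowt t) ^+ 2)%:E|)%E by exact: integral_ge0.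
have Ifin : (\int[mu]_t `|(profile B C (rowt t) ^+ 2)%:E| \is a fin_num)%E.
  rewrite ge0_fin_numE//; have := profile_sq_lty CB; rewrite /leb_int preimage_setT.
  by apply: le_lt_trans; rewrite le_eqVlt; apply/orP; left; apply/eqP/eq_integral => t _; rewrite gee0_abs// lee_fin sqr_ge0.
rewrite pE lt_def fine_ge0// andbT; apply/eqP => I00; apply: simplicial_not_null.
have : (\int[mu]_t `|(profile B C (rowt t) ^+ 2)%:E| = 0)%E by rewrite -(fineK Ifin) I00.
move=> /(ae_eq_integral_abs _ measurableT mp2)[N [mN N0 SN]].
exists N; split=> // t St; apply: SN => /= /(_ I) [] /eqP.
by rewrite profile_in// expf_eq0/= gt_eqF ?expR_gt0.
Qed.

Variables (P A : set 'rV[R]_d) (K : hilbert R) (E : L2 A K).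
Hypotheses (SP : S `<=` P) (mA : P_module P A).
Let bA := module_borel mA.

Definition pvec r (v : K) : E := L2_class E (fun y => (profile B C (y - r))%:C *: v).

Lemma pvec_sq r v : sq_integrable setT (fun y => (profile B C (y - r))%:C *: v : K).
Proof. exact: (sq_shiftT r (sq_profile CB v)). Qed.

Lemma pvec_out r y : A r -> ~ A y -> profile B C (y - r) = 0.
Proof.
move=> Ar nAy; apply: profile_out => Sy; apply: nAy; rewrite -[y](subrKC r).
exact: (moduleD mA Ar (SP Sy)).
Qed.

(** For q in A the translate q + S stays inside A, so the integral over A is one over the whole
    space and depends on q - r only. *)
Lemma pvec_ip q r v w (b : bool) : A q -> A r -> ip v w = b%:R ->
  ip (pvec q v) (pvec r w) = b%:R * (profile_gram q r)%:C.
Proof.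
move=> Aq Ar vw; rewrite L2_ip; [|exact: (sqT_sq bA (pvec_sq _ _))..].
have e y : ip ((profile B C (y - q))%:C *: v) ((profile B C (y - r))%:C *: w) =
    ((profile B C (y - q) * profile B C (y - r)) * b%:R)%:C.
  by rewrite ipZl ipZr vw conjc_real mulrA -real_complexn -!real_complexM.
rewrite /leb_intC; under [X in leb_int A X]funext do rewrite e.
under [X in _ +i* fine (leb_int A X)]funext do rewrite e /=.
rewrite [leb_int A (fun=> 0%:E)]leb_int0//=; case: b vw e => _ _; last first.
  by rewrite mul0r leb_int0// => y _; rewrite mulr0.
rewrite mul1r; congr (_ +i* _); congr fine; rewrite [LHS]leb_int_mkcond.
apply: leb_int_eq => y _; case: ifPn => [_|/negP nAy]; first by rewrite mulr1.
by rewrite (pvec_out Aq) ?mul0r// => Ay; apply: nAy; exact: mem_set.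
Qed.

Variables (V : 'rV[R]_d -> bop E E) (rV : module_representation P V).

Lemma V_pvec x r v : P x -> A r -> V x (pvec r v) = pvec (r + x) v.
Proof.
move=> Px Ar; rewrite /pvec (V_shift mA rV Px (pvec_sq r v)).
  by congr (L2_class E); apply/funext => y; rewrite opprD addrA addrAC.
by move=> y nAy; rewrite (pvec_out Ar nAy) scale0r.
Qed.

End profile_vectors.

Section totality.
Variables (R : realType) (d : nat) (B C : 'M[R]_d).
Hypotheses (BC : B *m C = 1%:M) (CB : C *m B = 1%:M).
Implicit Types (x y q r a b : 'rV[R]_d).
Local Notation RT := (measurableTypeR R).
Local Notation rowt := (@rowt R d).
Local Notation mu := (@lebesgue_tuple R d).
Local Notation S := (simplicial C).
Variables (P A : set 'rV[R]_d) (K : hilbert R) (E : L2 A K).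
Hypotheses (SP : S `<=` P) (mA : P_module P A).
Let bA := module_borel mA.
Local Notation pvec := (pvec B C E).
Variables (k : option nat) (e : nat -> K).
Hypothesis e_span : closure (lspan [set e i | i in [set i | lt_dim i k]]) = setT.
Implicit Type h : E.

Lemma pvec_supp b v : A b -> supp (translate S b) (pvec b v).
Proof.
move=> Ab; apply: (supp_cls _ bA); first exact: (sqT_sq bA (pvec_sq CB _ _)).
move=> y Ay nS; rewrite profile_out ?scale0r// => Sy; apply: nS; exact/mem_translate.
Qed.

(** [phi] is the real or the imaginary part; the two are treated separately to reduce to real-valued
    functions. *)
Lemma re_orth_ae (f : 'rV[R]_d -> K) (phi : R[i] -> R) a i :
  sq_integrable setT f -> (forall y, ~ A y -> f y = 0) ->
  (forall w : K, measurable_fun setT (fun t => phi (ip w (f (rowt t))))) ->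
  (forall z, `|phi z| <= cab z) ->
  (forall b, S (b - a) ->
    fine (leb_int A (fun y => (profile B C (y - b) * phi (ip (e i) (f y)))%:E)) = 0) ->
  {ae mu, forall t, S (rowt t - a) -> phi (ip (e i) (f (rowt t))) = 0}.
Proof.
move=> hf f0 mphi lephi h0; have phi0 : phi 0 = 0.
  by apply/eqP; rewrite -normr_le0; apply: le_trans (lephi 0) _; rewrite cab0.
apply: (@profile_orth_ae _ _ B C BC CB (fun y => phi (ip (e i) (f y)))).
- exact: mphi.
- apply: le_lt_trans (_ : _ <= leb_int setT (fun y => (sqnorm (e i))%:E * (sqnorm (f y))%:E))%E _.
    apply: ge0_le_integral.
    + exact: borelT.
    + by move=> t _; rewrite lee_fin sqr_ge0.
    + apply: measurable_funTS; apply/measurable_EFinP/measurable_funX; exact: mphi.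
    + apply: measurable_funTS; apply: emeasurable_funM => //.
      by apply: measurable_sqnorm; exact: sq_borel_fun.
    + move=> t _; rewrite -EFinM lee_fin -!sqr_nrm -exprMn -[leLHS]real_normK ?num_real//.
      rewrite ler_pXn2r// ?nnegrE ?mulr_ge0 ?nrm_ge0//.
      exact: le_trans (lephi _) (cauchy_schwarz _ _).
  rewrite /leb_int ge0_integralZl//.
  + by rewrite lte_mul_pinfty ?lee_fin ?sqnorm_ge0//; exact: hf.2.
  + exact: borelT.
  + by apply: measurable_funTS; apply: measurable_sqnorm; exact: sq_borel_fun.
  + by move=> t _; rewrite lee_fin sqnorm_ge0.
  + by rewrite lee_fin sqnorm_ge0.
- move=> b Sb; rewrite -[RHS](h0 b Sb) [in RHS]leb_int_mkcond; congr (fine (leb_int _ _)).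
  apply/funext => y; case: ifPn => // /negP nAy.
  by rewrite f0 ?ip0r ?phi0 ?mulr0// => Ay; apply: nAy; exact: mem_set.
Qed.

Lemma orthant_orth_eq0 h a : supp (translate S a) h -> A a ->
  (forall b i, S (b - a) -> lt_dim i k -> ip (pvec b (e i)) h = 0) -> h = 0.
Proof.
move=> [f [hf f0 fh]] Aa h0; have fA y : ~ A y -> f y = 0 by move=> nA; apply: f0 => -[].
have hfA := sqT_sq bA hf.
have ipE b i : ip (pvec b (e i)) h = leb_intC A (fun y => (profile B C (y - b))%:C * ip (e i) (f y)).
  rewrite -fh L2_ip//; last exact: (sqT_sq bA (pvec_sq CB _ _)).
  by apply: leb_intC_eq => y _; rewrite ipZl conjc_real.
have aeR i : {ae mu, forall t, lt_dim i k -> S (rowt t - a) -> Re (ip (e i) (f (rowt t))) = 0}.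
  case: (boolP (lt_dim i k)) => [ik|]; last by move=> _; apply: aeW.
  have := re_orth_ae (phi := fun z => Re z) (a := a) (i := i) hf fA.
  move=> /(_ (fun w => measurable_Re_ip w (sq_borel_fun hf)) (@normRe_le R)) hae.
  have : {ae mu, forall t, S (rowt t - a) -> Re (ip (e i) (f (rowt t))) = 0}.
    apply: hae => b Sb; have := h0 b i Sb ik; rewrite ipE => /(congr1 (fun z => Re z)) /= <-.
    by congr (fine (leb_int _ _)); apply/funext => y; rewrite cReM /= mul0r subr0.
  by apply: filterS => t ht _.
have aeI i : {ae mu, forall t, lt_dim i k -> S (rowt t - a) -> Im (ip (e i) (f (rowt t))) = 0}.
  case: (boolP (lt_dim i k)) => [ik|]; last by move=> _; apply: aeW.
  have := re_orth_ae (phi := fun z => Im z) (a := a) (i := i) hf fA.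
  move=> /(_ (fun w => measurable_Im_ip w (sq_borel_fun hf)) (@normIm_le R)) hae.
  have : {ae mu, forall t, S (rowt t - a) -> Im (ip (e i) (f (rowt t))) = 0}.
    apply: hae => b Sb; have := h0 b i Sb ik; rewrite ipE => /(congr1 (fun z => Im z)) /= <-.
    by congr (fine (leb_int _ _)); apply/funext => y; rewrite cImM /= mul0r addr0.
  by apply: filterS => t ht _.
have ae0 : {ae mu, forall t, setT t -> (sqnorm (f (rowt t)))%:E = cst 0%E t}.
  have := ae_foralln aeR; have := ae_foralln aeI; apply: filterS2 => t hI hR _ /=.
  have [St|nS] := pselect (S (rowt t - a)); last first.
    rewrite f0 ?sqnorm0// => -[_ /mem_translate]; exact: nS.
  suff -> : f (rowt t) = 0 by rewrite sqnorm0.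
  apply: ip_eq0P => w; apply: ip_lspan0 (_ : closure (lspan [set e i | i in [set i | lt_dim i k]]) w).
    by move=> _ [i /= ik <-]; apply: complex_eq; [exact: hR|exact: hI].
  by rewrite e_span.
apply: sqnorm_eq0; rewrite -fh cls_sqnorm//.
have -> : leb_int A (fun y => (sqnorm (f y))%:E) = leb_int setT (fun y => (sqnorm (f y))%:E).
  rewrite leb_int_mkcond; congr leb_int; apply/funext => y; case: ifPn => // /negP nAy.
  by rewrite fA ?sqnorm0// => Ay; apply: nAy; exact: mem_set.
rewrite /leb_int preimage_setT (ae_eq_integral (cst 0%E))//; first by rewrite integral0.
by apply: measurable_sqnorm; exact: sq_borel_fun.
Qed.

Variables (V : 'rV[R]_d -> bop E E) (rV : module_representation P V).
Hypothesis V_cont0 : forall u (r : R), 0 < r ->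
  exists2 s : R, 0 < s & forall y, P y -> `|y| < s -> nrm (V y u - u) < r.

(* The part of h in an orthant a + S with a in A vanishes. A small q in the
   interior of S moves each small piece of A into such an orthant, so V_q h is
   orthogonal to h. *)
Lemma pvec_total h : (forall r i, A r -> lt_dim i k -> ip (pvec r (e i)) h = 0) -> h = 0.
Proof.
move=> h0; have orthant0 a u : A a -> supp (translate S a) u -> ip u h = 0.
  move=> Aa su; have bS : borel (translate S a) by apply: borel_translate; exact: borel_simplicial.
  have [h1 [h2 [hE s1 s2]]] := supp_split bA bS (suppT bA h).
  have {}s1 : supp (translate S a) h1 by apply: supp_sub s1 => y _ [].
  have h20 b v : S (b - a) -> ip (pvec b v) h2 = 0.
    move=> Sb; have Ab : A b by rewrite -[b](subrKC a); exact: (moduleD mA Aa (SP Sb)).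
    apply: (supp_orth bA (pvec_supp v Ab) s2) => y _ /mem_translate Sy [_]; apply.
    apply/mem_translate; rewrite -(subrKA b) addrC; exact: simplicialD.
  have h10 : h1 = 0.
    apply: (orthant_orth_eq0 s1 Aa) => b i Sb ik.
    have Ab : A b by rewrite -[b](subrKC a); exact: (moduleD mA Aa (SP Sb)).
    by have := h0 b i Ab ik; rewrite hE ipDr h20// addr0.
  rewrite hE h10 add0r; apply: (supp_orth bA su s2) => y _ Sy [_]; exact.
have [p Sp pS] := cone_interior (simplicial_cone C) (simplicial_spanning BC CB).
have moved (r : R) u : 0 < r -> ip (V (r *: p) u) h = 0.
  move=> r0; have r20 : 0 < r / 2 by rewrite divr_gt0.
  have Pq : P (r *: p) by apply: SP; exact: (coneZ (simplicial_cone C) (ltW r0) Sp).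
  have loc n v : supp (ball0 n) v -> ip (V (r *: p) v) h = 0.
    apply: (compact_local (Q := fun X => forall v : E, supp X v -> ip (V (r *: p) v) h = 0)).
    - by move=> v0 /(supp0_eq0 mA) ->; rewrite bop0 ip0l.
    - by move=> X Y XY hY v0 sv; apply: hY; apply: supp_sub sv => z _ /XY.
    - move=> x s Y s0 hX hY v0 sv; have bX : borel (ball x s) by apply: open_borel; exact: ball_open.
      have [v1 [v2 [-> s1 s2]]] := supp_setU mA bX sv.
      by rewrite bopD ipDl hX// hY// addr0.
    - move=> x; exists (r / 2) => // v0 sv.
      have [[a [Aa xa]]|no] := pselect (exists a, A a /\ ball x (r / 2) a); last first.
        suff -> : v0 = 0 by rewrite bop0 ip0l.
        by apply: (supp0_eq0 mA); apply: supp_sub sv => y Ay xy; apply: no; exists y.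
      apply: (orthant0 a) => //; apply: supp_sub (V_supp mA rV Pq sv) => y _ [/mem_translate xy _].
      apply/mem_translate; have -> : y - a = r *: p + (y - r *: p - a) by rewrite addrA subrKC.
      apply: pS; first exact: (ltW r0).
      have : ball a r (y - r *: p) by exact: ball_splitr xa xy.
      by rewrite -ball_normE /= distrC => /ltW.
  rewrite (adjbP (V (r *: p))).
  suff -> : adjb (V (r *: p)) h = 0 by rewrite ip0r.
  by apply: (supp_bounded bA) => n v sv; rewrite -adjbP (loc n).
apply: contrapT => hn0; have nh : 0 < nrm h by apply: nrm_gt0; exact/eqP.
have [s s0 sP] := V_cont0 h nh; pose r := s / (1 + `|p|).
have np : 0 < 1 + `|p| by apply: ltr_pwDl.
have r0 : 0 < r by rewrite divr_gt0.
have Pq : P (r *: p) by apply: SP; exact: (coneZ (simplicial_cone C) (ltW r0) Sp).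
have : nrm (V (r *: p) h - h) < nrm h.
  apply: sP => //; rewrite normrZ (gtr0_norm r0) /r mulrAC ltr_pdivrMr// ltr_pM2l//.
  by rewrite ltrDr.
(* Since V_q h is orthogonal to h, |V_q h - h| is at least |h|, against strong continuity at 0. *)
apply/negP; rewrite -leNgt -(@ler_pXn2r _ 2)// ?nnegrE ?nrm_ge0// !sqr_nrm sqnormB.
by rewrite moved//= mulr0 subr0 lerDr sqnorm_ge0.
Qed.

End totality.

(** * Conjugacy invariants *)

Section module_intertwiners.
Variables (R : realType) (d : nat) (P : set 'rV[R]_d) (cP : is_cone P).
Hypothesis spanP : spanning_cone P.
Variables (A1 A2 : set 'rV[R]_d) (mA1 : P_module P A1) (mA2 : P_module P A2).
Variables (K1 K2 : hilbert R) (E1 : L2 A1 K1) (E2 : L2 A2 K2).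
Variables (V1 : 'rV[R]_d -> bop E1 E1) (V2 : 'rV[R]_d -> bop E2 E2).
Hypotheses (rV1 : module_representation P V1) (rV2 : module_representation P V2).

Lemma subcone_simplicial : exists B C : 'M[R]_d,
  [/\ B *m C = 1%:M, C *m B = 1%:M & simplicial C `<=` P].
Proof.
have [B [C [BC CB sub]]] := simplicial_subcone cP spanP; exists B, C; split=> // y Sy.
by rewrite -[y]mulmx1 -CB mulmxA; exact: sub.
Qed.

Lemma L2_nonzero k : has_dim K1 k -> k <> Some 0%N -> exists u : E1, u <> 0.
Proof.
move=> [e [eo _]] k0; have [B [C [BC CB SP]]] := subcone_simplicial.
have A10 : A1 0 by case: mA1.
have k1 : lt_dim 0 k by case: k k0 {eo} => // -[|n].
exists (pvec B C E1 0 (e 0%N)) => u0.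
have := pvec_ip CB E1 SP mA1 A10 A10 (eo _ _ k1 k1).
rewrite u0 ip0r mul1r => /(congr1 (@complex.Re R)) /= /eqP.
by rewrite lt_eqF// (profile_gram_gt0 BC CB).
Qed.

Lemma multiplicity_le k n : has_dim K1 k -> has_dim K2 (Some n) -> lt_dim n k ->
  (forall x, P x -> isom (V2 x)) ->
  (forall (u : E2) (r : R), 0 < r ->
    exists2 s : R, 0 < s & forall y, P y -> `|y| < s -> nrm (V2 y u - u) < r) ->
  forall U : bop E1 E2, isom U -> (forall x u, P x -> U (V1 x u) = V2 x (U u)) -> False.
Proof.
move=> [e1 [eo1 _]] [e2 [eo2 es2]] nk iV2 cV2 U iU UV.
have [B [C [BC CB SP]]] := subcone_simplicial.
have ltk (i : 'I_n.+1) : lt_dim i k.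
  by case: k nk {eo1} => //= m; apply: leq_trans; rewrite ltnS -ltnS.
apply: (@multiplicity_contradiction _ _ P cP spanP E1 E2 V1 V2 A1 A2 _ _ _ _ n
  (fun i q => pvec B C E1 q (e1 i)) (fun i q => pvec B C E2 q (e2 i)) (profile_gram B C)
  _ _ _ _ _ _ iV2 _ U iU UV).
- by case: mA1.
- by case: mA2.
- by move=> a x; exact: moduleD.
- by move=> a x; exact: moduleD.
- by move=> q r x; exact: profile_gramD.
- exact: profile_gram_gt0.
- by move=> i j q r Aq Ar; rewrite (pvec_ip CB E1 SP mA1 Aq Ar (eo1 _ _ (ltk i) (ltk j))).
- by move=> i j q r Aq Ar; rewrite (pvec_ip CB E2 SP mA2 Aq Ar (eo2 _ _ (ltn_ord i) (ltn_ord j))).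
- by move=> x i q Px Aq; exact: (V_pvec CB SP mA1 rV1).
- by move=> x i q Px Aq; exact: (V_pvec CB SP mA2 rV2).
- move=> h h0; apply: (pvec_total BC CB SP mA2 es2 rV2 cV2) => r i Ar ik.
  exact: (h0 (Ordinal ik)).
Qed.

End module_intertwiners.

Section cocycle_conjugacy.
Variables (R : realType) (d : nat) (P : set 'rV[R]_d) (cP : is_cone P).
Variables (H1 H2 : hilbert R) (V1 : 'rV[R]_d -> bop H1 H1) (V2 : 'rV[R]_d -> bop H2 H2).
Variables (F1 : fock H1) (F2 : fock H2) (f1 : flow P V1 F1) (f2 : flow P V2 F2).
Variable gamma : 'rV[R]_d -> bop F2 F2 -> bop F2 F2.
Variable Y : unitary F1 F2.
Hypothesis gammaY : forall x T, P x -> gamma x T = Ad Y (falpha f1 x (Ad_star Y T)).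
Variable U : 'rV[R]_d -> unitary F2 F2.
Hypothesis cU : cocycle P (falpha f2) U.
Hypothesis gammaU : forall x T, P x -> gamma x T = Ad (U x) (falpha f2 x T).

Lemma vacuum_ip (H : hilbert R) (V : 'rV[R]_d -> bop H H) (F : fock H) (f : flow P V F) :
  ip (expvec F 0) (expvec F 0) = 1.
Proof. by rewrite (exp_ip (fweylP f)) ip0r cexp0. Qed.

Lemma gammaYE x T u : P x -> gamma x T (Y u) = Y (falpha f1 x (Ad_star Y T) u).
Proof. by move=> Px; rewrite gammaY//= unitaryK. Qed.

Lemma gammaUE x T u : P x -> gamma x T (U x u) = U x (falpha f2 x T u).
Proof. by move=> Px; rewrite gammaU//= unitaryK. Qed.

Lemma alphaUV x y u : P x -> P y -> U (x + y) u = U x (falpha f2 x (U y) u).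
Proof. by move=> Px Py; rewrite -(cocycle_mul cU Px Py). Qed.

(** Conjugation by Y turns intertwiners of the first flow into those of [gamma x]; composing with
    the adjoint of U_x turns these into intertwiners of the second flow. *)
Let theta x (S : bop F1 F1) : bop F2 F2 := bcomp (uadj (U x)) (bcomp Y (bcomp S (uadj Y))).

Let theta_int x S : P x -> wint f1 x S -> intertwiner (falpha f2 x) (theta x S).
Proof.
move=> Px wS T u; have aS := wint_alpha Px wS.
apply: (can_inj (unitaryK (U x))); rewrite -gammaUE//= !unitaryKV gammaYE// aS.
by rewrite /= !unitaryKV.
Qed.

Lemma cocycle_isometry :
  (forall h, (forall x k, P x -> kerV V1 x k -> ip k h = 0) -> h = 0) ->
  exists U : bop H1 H2, [/\ isom U,
    forall x u, P x -> U (V1 x u) = V2 x (U u) &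
    forall x k, P x -> kerV V1 x k -> kerV V2 x (U k)].
Proof.
apply: (@theta_isometry _ _ P cP _ _ V1 V2 F1 F2 f1 f2 theta).
- by move=> x S Px wS; apply: intertwiner_wint => //; exact: theta_int.
(* Multiplicativity is the cocycle identity: U_(x+y) = U_x alpha_x(U_y), and alpha_x(U_y) passes
   through [theta x S] as U_y. *)
- move=> x y S T Px Py wS wT; apply: bopP => u.
  apply: (can_inj (unitaryK (U (x + y)))).
  rewrite [LHS]/= unitaryKV alphaUV// [bcomp _ _ u]/=.
  rewrite (theta_int Px wS) /= !unitaryKV !unitaryK.
  by [].
- move=> x S S' Px wS wS'; rewrite /= (adj_isom (U x)) (unitary_isom Y) (wint_ip wS wS').
  by rewrite (adj_isom Y) (vacuum_ip f2) mulr1.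
Qed.

Let theta' x (S : bop F2 F2) : bop F1 F1 := bcomp (uadj Y) (bcomp (U x) (bcomp S Y)).

Let theta_int' x S : P x -> wint f2 x S -> intertwiner (falpha f1 x) (theta' x S).
Proof.
move=> Px wS T u; have aS := wint_alpha Px wS.
apply: (can_inj (unitaryK Y)); pose T' := Ad Y T.
have -> : T = Ad_star Y T' by apply: bopP => v; rewrite /= !unitaryK.
by rewrite -gammaYE//= !unitaryKV gammaUE// aS.
Qed.

Lemma cocycle_isometry' :
  (forall h, (forall x k, P x -> kerV V2 x k -> ip k h = 0) -> h = 0) ->
  exists U : bop H2 H1, [/\ isom U,
    forall x u, P x -> U (V2 x u) = V1 x (U u) &
    forall x k, P x -> kerV V2 x k -> kerV V1 x (U k)].
Proof.
apply: (@theta_isometry _ _ P cP _ _ V2 V1 F2 F1 f2 f1 theta').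
- by move=> x S Px wS; apply: intertwiner_wint => //; exact: theta_int'.
- move=> x y S T Px Py wS wT; apply: bopP => u /=; congr (uadj Y _).
  by rewrite alphaUV// (wint_alpha Px wS) !unitaryKV.
- move=> x S S' Px wS wS'; rewrite /= (adj_isom Y) (unitary_isom (U x)) (wint_ip wS wS').
  by rewrite (unitary_isom Y) (vacuum_ip f1) mulr1.
Qed.

End cocycle_conjugacy.

(** * Unitary equivalence of the representations of translated modules *)

Section translated_modules.
Variables (R : realType) (d : nat) (P A : set 'rV[R]_d) (z : 'rV[R]_d).
Hypotheses (mA : P_module P A) (mAz : P_module P (translate A z)).
Variables (K1 K2 : hilbert R) (E1 : L2 A K1) (E2 : L2 (translate A z) K2).

Lemma has_dim_unitary k : has_dim K1 k -> has_dim K2 k -> exists J : unitary K1 K2, True.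
Proof.
move=> [e1 [eo1 s1]] [e2 [eo2 s2]]; pose I := {i | lt_dim i k}.
have tot (K : hilbert R) (e : nat -> K) :
    closure (lspan [set e i | i in [set i | lt_dim i k]]) = setT -> total (fun i : I => e (sval i)).
  move=> s h h0; apply: ip_eq0P => w.
  apply: ip_lspan0 (_ : closure (lspan [set e i | i in [set i | lt_dim i k]]) w); last by rewrite s.
  by move=> _ [i ik <-]; exact: (h0 (exist _ i ik)).
have [|T iT TE] := iso_ext (f := fun i : I => e1 (sval i)) (g := fun i : I => e2 (sval i)) _ (tot _ _ s1).
  by move=> [i ik] [j jk] /=; rewrite eo1// eo2.
have [|J _] := mk_unitary iT (tot _ _ s2); last by exists J.
by move=> i; exists (e1 (sval i)).
Qed.

Lemma sq_isom (K L : hilbert R) (J : bop K L) (f : 'rV[R]_d -> K) : isom J ->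
  sq_integrable setT f -> sq_integrable setT (fun y => J (f y)).
Proof.
move=> iJ [mf fi]; split.
  move=> Q oQ; apply: (mf (J @^-1` Q)); apply: open_comp => // u _; exact: bcont.
by under [X in leb_int _ X]funext => y do rewrite /sqnorm iJ.
Qed.

Variables (V1 : 'rV[R]_d -> bop E1 E1) (V2 : 'rV[R]_d -> bop E2 E2).
Hypotheses (rV1 : module_representation P V1) (rV2 : module_representation P V2).

Lemma translate_unitary (J : unitary K1 K2) :
  exists U : unitary E1 E2, forall x u, P x -> U (V1 x u) = V2 x (U u).
Proof.
have bA := module_borel mA; have bAz := module_borel mAz.
pose I := {f : 'rV[R]_d -> K1 | sq_integrable setT f /\ forall y, ~ A y -> f y = 0}.
pose g (f : 'rV[R]_d -> K1) y := J (f (y - z)).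
have sg f : sq_integrable setT f -> sq_integrable setT (g f).
  by move=> hf; apply: (sq_isom (@unitary_isom _ _ _ J)); exact: sq_shiftT.
have tot : total (fun i : I => L2_class E1 (sval i)).
  move=> h h0; apply: ip_eq0P => w; have [f [hf f0 <-]] := suppT bA w.
  have f0' y : ~ A y -> f y = 0 by move=> nA; apply: f0 => -[].
  exact: (h0 (exist _ f (conj hf f0'))).
have [|T iT TE] := iso_ext (f := fun i : I => L2_class E1 (sval i))
    (g := fun i : I => L2_class E2 (g (sval i))) _ tot.
  move=> [f [hf f0]] [f' [hf' f0']] /=.
  rewrite !L2_ip; [|exact: sqT_sq|exact: sqT_sq|exact: (sqT_sq bAz (sg _ _))..].
  rewrite -[RHS](leb_intC_translate A z); apply: leb_intC_eq => y _.
  by rewrite unitary_isom.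
have [|U UT] := mk_unitary iT (g := fun h : E2 => h) (fun h h0 => ip_eq0P h0).
  move=> h; have [f [hf f0 <-]] := suppT bAz h.
  have hf' : sq_integrable setT (fun y => uadj J (f (y - (- z)))).
    by apply: (sq_isom (@adj_isom _ _ _ J)); exact: sq_shiftT.
  have f0' y : ~ A y -> uadj J (f (y - (- z))) = 0.
    move=> nA; rewrite f0 ?bop0// => -[/mem_translate]; rewrite opprK addrK//.
  exists (L2_class E1 (fun y => uadj J (f (y - (- z))))).
  rewrite (TE (exist _ _ (conj hf' f0'))) /=; congr (L2_class E2); apply/funext => y.
  by rewrite /g opprK subrK unitaryKV.
exists U => x u Px; rewrite UT; have [f [hf f0 <-]] := suppT bA u.
have f0' y : ~ A y -> f y = 0 by move=> nA; apply: f0 => -[].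
rewrite (V_shift mA rV1 Px hf f0').
have fx0 y : ~ A y -> f (y - x) = 0.
  move=> nA; apply: f0' => Ay; apply: nA; rewrite -[y](subrK x); exact: (moduleD mA Ay Px).
rewrite (TE (exist _ _ (conj (sq_shiftT x hf) fx0))) (TE (exist _ _ (conj hf f0'))) /=.
rewrite (V_shift mAz rV2 Px (sg _ hf)).
  by congr (L2_class E2); apply/funext => y; rewrite /g addrAC.
by move=> y nA; rewrite /g f0' ?bop0// => /mem_translate.
Qed.

End translated_modules.

Section second_quantization.
Variables (R : realType) (d : nat) (P : set 'rV[R]_d).
Variables (H1 H2 : hilbert R) (V1 : 'rV[R]_d -> bop H1 H1) (V2 : 'rV[R]_d -> bop H2 H2).
Variables (F1 : fock H1) (F2 : fock H2) (f1 : flow P V1 F1) (f2 : flow P V2 F2).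

Lemma second_quantization (U : unitary H1 H2) :
  exists Y : unitary F1 F2, forall u, Y (expvec F1 u) = expvec F2 (U u).
Proof.
have [|T iT TE] := iso_ext (f := fun u : H1 => expvec F1 u) (g := fun u : H1 => expvec F2 (U u))
  _ (@exp_total _ _ F1).
  by move=> u v; rewrite (exp_ip (fweylP f2)) (exp_ip (fweylP f1)) unitary_isom.
have [|Y YT] := mk_unitary iT (@exp_total _ _ F2).
  by move=> v; exists (expvec F1 (uadj U v)); rewrite TE unitaryKV.
by exists Y => u; rewrite YT.
Qed.

(** Both sides are compared on the total set of vectors S u with S an intertwiner of the second
    flow; conjugation by Y turns S into an intertwiner of the first one, where [wint_alpha]
    applies. *)
Lemma unitarily_equivalent_conjugate (U : unitary H1 H2) :
  (forall x u, P x -> U (V1 x u) = V2 x (U u)) -> Defs.conjugate P (falpha f1) (falpha f2).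
Proof.
move=> UV; have [Y YE] := second_quantization U; exists Y => x T Px.
have YW u xi : Y (fweyl f1 u xi) = fweyl f2 (U u) (Y xi).
  have e : bcomp Y (fweyl f1 u) = bcomp (fweyl f2 (U u)) Y; last exact: (congr1 (fun T : bop F1 F2 => T xi) e).
  apply: (bop_total_eq (@exp_total _ _ F1)) => v /=.
  by rewrite (fweylP f1) bopZ !YE (fweylP f2) !unitary_isom bopD.
have YW' u xi : uadj Y (fweyl f2 (U u) xi) = fweyl f1 u (uadj Y xi).
  by apply: (can_inj (unitaryK Y)); rewrite YW !unitaryKV.
have wY S : wint f2 x S -> wint f1 x (bcomp (uadj Y) (bcomp S Y)).
  by move=> wS u xi; rewrite /= YW wS -UV// YW'.
pose I := {S : bop F2 F2 | wint f2 x S}.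
apply: (bop_total_eq (f := fun p : I * F2 => sval p.1 p.2)).
  move=> h h0; apply: (wint_total (f := f2) Px) => S wS u.
  exact: (h0 (exist _ S wS, u)).
move=> [[S wS] u] /=; rewrite (wint_alpha Px wS).
have := wint_alpha Px (wY _ wS) (Ad_star Y T) (uadj Y u).
by rewrite /= !unitaryKV => ->; rewrite !unitaryKV.
Qed.

End second_quantization.

(* [conjugate] also names a set operation on finite groups. *)
Import Defs.

Theorem theorem1p2 (R : realType) (d : nat) (d_ge1 : (1 <= d)%N)
    (P : set 'rV[R]_d)
    (P_cone : closed_convex_cone P) (P_pointed : pointed_cone P)
    (P_spanning : spanning_cone P)
    (A1 A2 : set 'rV[R]_d) (A1_module : P_module P A1) (A2_module : P_module P A2)
    (k1 k2 : option nat) (k1_ge1 : k1 <> Some 0%N) (k2_ge1 : k2 <> Some 0%N)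
    (K1 K2 : hilbert R) (K1_dim : has_dim K1 k1) (K2_dim : has_dim K2 k2)
    (E1 : L2 A1 K1) (E2 : L2 A2 K2) (F1 : fock E1) (F2 : fock E2)
    (alpha1 : 'rV[R]_d -> bop F1 F1 -> bop F1 F1)
    (alpha2 : 'rV[R]_d -> bop F2 F2 -> bop F2 F2)
    (alpha1_ccr : module_ccr_flow P alpha1) (alpha2_ccr : module_ccr_flow P alpha2) :
  [<-> conjugate P alpha1 alpha2;
       cocycle_conjugate P alpha1 alpha2;
       (exists z : 'rV[R]_d, translate A1 z = A2) /\ k1 = k2].
Proof.
have cP := closed_convex_cone_is_cone P_cone.
case: alpha1_ccr => V1 rV1 [E01 [W1 W1P W1V]]; case: alpha2_ccr => V2 rV2 [E02 [W2 W2P W2V]].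
pose f1 : flow P V1 F1 := Flow E01 W1P W1V; pose f2 : flow P V2 F2 := Flow E02 W2P W2V.
have i1 x (Px : P x) := V_isom f1 Px; have i2 x (Px : P x) := V_isom f2 Px.
tfae.
(* A conjugacy is a cocycle conjugacy with the constant cocycle 1. *)
- move=> alpha12; exists alpha2 => //.
  have idP : is_adjoint (bid F2) (bid F2) by [].
  have idK : bcomp (bid F2) (bid F2) = bid F2 by exact: bopP.
  pose one : unitary F2 F2 := Unitary idP idK idK.
  exists (fun=> one); last by move=> x T Px; exact: bopP.
  split; first by move=> xi; apply: (@continuous_subspaceT _ _ P (cst xi)); exact: cst_continuous.
  move=> x y Px Py; rewrite /= (endo1 (E0_endo E02 Px)); exact: idK.
- move=> [gamma [Y gY] [U cU gU]].
  (* One isometry already gives the translation; the two directions together bound each multiplicity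
     by the other. *)
  have [U12 [iU12 U12V kU12]] := cocycle_isometry cP (f1 := f1) (f2 := f2) gY cU gU
    (module_pure cP P_spanning A1_module rV1).
  have [U21 [iU21 U21V kU21]] := cocycle_isometry' cP (f1 := f1) (f2 := f2) gY cU gU
    (module_pure cP P_spanning A2_module rV2).
  split.
    have [u u0] := L2_nonzero cP P_spanning A1_module E1 K1_dim k1_ge1.
    exact: (intertwined_modules_translate cP P_spanning A1_module A2_module rV1 rV2 i1 i2 iU12 U12V kU12 u0).
  have le12 n : k2 = Some n -> lt_dim n k1 -> False.
    move=> kE nk; move: K2_dim; rewrite kE => dim2.
    exact: (multiplicity_le cP P_spanning A1_module A2_module rV1 rV2 K1_dim dim2 nk i2 (V_cont cP f2) iU12 U12V).
  have le21 n : k1 = Some n -> lt_dim n k2 -> False.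
    move=> kE nk; move: K1_dim; rewrite kE => dim1.
    exact: (multiplicity_le cP P_spanning A2_module A1_module rV2 rV1 K2_dim dim1 nk i1 (V_cont cP f1) iU21 U21V).
  case: k1 k2 le12 le21 {k1_ge1 k2_ge1 K1_dim K2_dim} => [m|] [n|] // le12 le21; last 2 first.
  + by case: (le21 m).
  + by case: (le12 n).
  have [nm|mn|->] := ltngtP n m => //.
  + by case: (le12 n).
  + by case: (le21 m).
- move=> [[z zE] kE]; subst A2 k2.
  have [J _] := has_dim_unitary K1_dim K2_dim.
  have [U UV] := translate_unitary A1_module A2_module rV1 rV2 J.
  exact: (unitarily_equivalent_conjugate f1 f2 UV).
Qed.
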